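(* Let $(H,m_H,\Delta_H,\eta_H,\varepsilon_H,S_H)$ be a Hopf algebra over a commutative field $k$. The set $\mathrm{Tor}(H)$ equipped with the composition law $\ast$ is a group whose unit element is the class of the trivial torsor $(H,m_H,1_H,\mu_H,\theta_H,i_{l,H},i_{r,H})$. The inverse of the class of $(T,m_T,1_T,\mu_T,\theta_T,i_{l,T},i_{r,T})$ is the class of the opposite torsor $(T^{\mathrm{op}},m_T^{\mathrm{op}},1_T,\mu_T^{\mathrm{op}},\theta_T,i_{l,T^{\mathrm{op}}},i_{r,T^{\mathrm{op}}})$, where $i_{l,T^{\mathrm{op}}}:=i_{r,T}\circ(\mathrm{Id}_T\otimes\theta_T)^{-1}$ and $i_{r,T^{\mathrm{op}}}:=i_{l,T}\circ(\theta_T\otimes \mathrm{Id}_T)^{-1}$.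
   Context: All tensor products are over $k$; algebras are unital and associative. $T^{\mathrm{op}}$ is the opposite algebra of $T$. A $k$-torsor is a quintuple $(T,m_T,1_T,\mu_T,\theta_T)$ where $(T,m_T,1_T)$ is a $k$-algebra, $\mu_T:T\to T\otimes T^{\mathrm{op}}\otimes T$ is a $k$-algebra morphism and $\theta_T:T\to T$ is a $k$-algebra automorphism such that: (i) $(\mathrm{Id}_T\otimes m_T)\circ\mu_T(x)=x\otimes 1_T$ for all $x\in T$; (ii) $(m_T\otimes \mathrm{Id}_T)\circ\mu_T(x)=1_T\otimes x$ for all $x\in T$; (iii) $(\mathrm{Id}_T\otimes \mathrm{Id}_{T^{\mathrm{op}}}\otimes\mu_T)\circ\mu_T=(\mu_T\otimes \mathrm{Id}_{T^{\mathrm{op}}}\otimes \mathrm{Id}_T)\circ\mu_T$; (iv) $\theta_T^{(3)}\circ(\mu_T\otimes \mathrm{Id}_{T^{\mathrm{op}}}\otimes \mathrm{Id}_T)\circ\mu_T=(\mathrm{Id}_T\otimes\mu_T^{\mathrm{op}}\otimes \mathrm{Id}_T)\circ\mu_T$; (v) $(\theta_T\otimes\theta_T\otimes\theta_T)\circ\mu_T=\mu_T\circ\theta_T$. Here $\mu_T^{\mathrm{op}}:=\tau_{(13)}\circ\mu_T$ (regarded as a map $T^{\mathrm{op}}\to T^{\mathrm{op}}\otimes T\otimes T^{\mathrm{op}}$), $\theta_T^{(3)}:=\mathrm{Id}_T\otimes \mathrm{Id}_{T^{\mathrm{op}}}\otimes\theta_T\otimes \mathrm{Id}_{T^{\mathrm{op}}}\otimes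 \mathrm{Id}_T$, and $\tau_{(ij)}$ exchanges the $i$-th and $j$-th tensor factors. If $T$ is a torsor, so is $(T^{\mathrm{op}},m_T^{\mathrm{op}},1_T,\mu_T^{\mathrm{op}},\theta_T)$, its opposite torsor. A torsor morphism is an algebra morphism $f:T_1\to T_2$ with $\mu_{T_2}\circ f=(f\otimes f\otimes f)\circ\mu_{T_1}$ and $\theta_{T_2}\circ f=f\circ\theta_{T_1}$. $H_l(T)$ is the set of $x\in T\otimes T^{\mathrm{op}}$ with $(\mathrm{Id}\otimes \mathrm{Id}\otimes\theta_T\otimes \mathrm{Id})\circ(\mu_T\otimes \mathrm{Id}_{T^{\mathrm{op}}})(x)=(\mathrm{Id}_T\otimes\mu_T^{\mathrm{op}})(x)$. It is a Hopf algebra with the product and unit of $T\otimes T^{\mathrm{op}}$, coproduct $\mu_T\otimes \mathrm{Id}_{T^{\mathrm{op}}}$, and counit given by $m_T(x)=\varepsilon_{H_l(T)}(x)1_T$. $H_r(T)$ is the set of $x\in T^{\mathrm{op}}\otimes T$ with $(\mathrm{Id}\otimes\theta_T\otimes \mathrm{Id}\otimes \mathrm{Id})\circ(\mathrm{Id}_{T^{\mathrm{op}}}\otimes\mu_T)(x)=(\mu_T^{\mathrm{op}}\otimes \mathrm{Id}_T)(x)$. It is a Hopf algebra with the product and unit of $T^{\mathrm{op}}\otimes T$, coproduct $\mathrm{Id}_{T^{\mathrm{op}}}\otimes\mu_T$, and counit given by $m_T(x)=\varepsilon_{H_r(T)}(x)1_T$. One has $\mu_T(T)\subset H_l(T)\otimes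 T$ and $\mu_T(T)\subset T\otimes H_r(T)$. The map $\theta_T\otimes \mathrm{Id}_T$ is a Hopf algebra isomorphism $H_l(T)\to H_r(T^{\mathrm{op}})$ and $\mathrm{Id}_T\otimes\theta_T$ is a Hopf algebra isomorphism $H_r(T)\to H_l(T^{\mathrm{op}})$, where $T^{\mathrm{op}}$ carries its opposite torsor structure. A torsor morphism $f:T_1\to T_2$ induces Hopf algebra morphisms $f_l:H_l(T_1)\to H_l(T_2)$ and $f_r:H_r(T_1)\to H_r(T_2)$ by restriction of $f\otimes f$. The set $\widehat{\mathrm{Tor}}(H)$ consists of septuples $(T,m_T,1_T,\mu_T,\theta_T,i_{l,T},i_{r,T})$ with $(T,m_T,1_T,\mu_T,\theta_T)$ a $k$-torsor and $i_{l,T}:H_l(T)\to H$, $i_{r,T}:H_r(T)\to H$ Hopf algebra isomorphisms. Two septuples (for $T_1$ and $T_2$) are equivalent if there is a torsor isomorphism $f:T_1\to T_2$ with $i_{l,T_1}=i_{l,T_2}\circ f_l$ and $i_{r,T_1}=i_{r,T_2}\circ f_r$. $\mathrm{Tor}(H)$ is the set of equivalence classes. Composition law $\ast$: the product of the classes of $(T_1,\ldots,i_{l,T_1},i_{r,T_1})$ and $(T_2,\ldots,i_{l,T_2},i_{r,T_2})$ is the class of $(T,\ldots,i_{l,T},i_{r,T})$, defined as follows. Put $\Phi:=i_{l,T_2}^{-1}\circ i_{r,T_1}:H_r(T_1)\to H_l(T_2)$ and $$T:=T_1\otimes_\Phi T_2:=\{x\in T_1\otimes T_2:(\mathrm{Id}_{T_1}\otimes\Phi\otimes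 \mathrm{Id}_{T_2})(\mu_{T_1}\otimes \mathrm{Id}_{T_2})(x)=(\mathrm{Id}_{T_1}\otimes\mu_{T_2})(x)\},$$ a subalgebra of $T_1\otimes T_2$ which is a torsor with $\theta_T$ the restriction of $\theta_{T_1}\otimes\theta_{T_2}$ and $$\mu_T\Big(\sum_i x_i\otimes y_i\Big)=\sum_i\tau_{(34)}\big(x_i^{(1)}\otimes\Phi(x_i^{(2)}\otimes x_i^{(3)})\otimes x_i^{(4)}\otimes x_i^{(5)}\otimes y_i\big),$$ where $x^{(1)}\otimes\cdots\otimes x^{(5)}=(\mu_{T_1}\otimes \mathrm{Id}\otimes \mathrm{Id})\circ\mu_{T_1}(x)$ and $H_l(T_2)\subset T_2\otimes T_2^{\mathrm{op}}$. Put $i_{l,T}:=i_{l,T_1}\circ(\mathrm{Id}_{T_1}\otimes\varepsilon_{H_l(T_2)}\otimes \mathrm{Id}_{T_1^{\mathrm{op}}})\circ\tau_{(34)}$ on $H_l(T)\subset T_1\otimes T_2\otimes T_1^{\mathrm{op}}\otimes T_2^{\mathrm{op}}$, and $i_{r,T}:=i_{r,T_2}\circ(\mathrm{Id}_{T_2^{\mathrm{op}}}\otimes\varepsilon_{H_r(T_1)}\otimes \mathrm{Id}_{T_2})\circ\tau_{(12)}$ on $H_r(T)\subset T_1^{\mathrm{op}}\otimes T_2^{\mathrm{op}}\otimes T_1\otimes T_2$; these are Hopf algebra isomorphisms onto $H$. This operation is compatible with the equivalence relation. Trivial torsor: $1_H=\eta_H(1)$, $\mu_H:=(\mathrm{Id}_H\otimes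 S_H\otimes \mathrm{Id}_H)\circ\Delta_H^{(2)}$ with $\Delta_H^{(2)}=(\Delta_H\otimes \mathrm{Id})\circ\Delta_H$, and $\theta_H:=S_H^2$. Then $H_l(H)=(\mathrm{Id}_H\otimes S_H)\circ\Delta_H(H)$, $H_r(H)=(S_H\otimes \mathrm{Id}_H)\circ\Delta_H(H)$, and $i_{l,H}:=\mathrm{Id}_H\otimes\varepsilon_H:H_l(H)\to H$, $i_{r,H}:=\varepsilon_H\otimes \mathrm{Id}_H:H_r(H)\to H$ are Hopf algebra isomorphisms.
   Formalization: The square of the antipode S_H is assumed bijective; otherwise θ_H = S_H² is not an automorphism, so the trivial torsor is not a torsor and the stated unit element does not exist. *)

(* Defs.v *)
From HB Require Import structures.
From mathcomp Require Import all_boot all_order all_algebra.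
From mathcomp Require Import boolp classical_sets.

Set Implicit Arguments.
Unset Strict Implicit.
Unset Printing Implicit Defensive.

Import GRing.Theory.
Local Open Scope quotient_scope.
Local Open Scope classical_set_scope.
Local Open Scope ring_scope.

(* V \ox W is the set of formal sums of pairs (v, w), two of them being equal
   when every bilinear map out of V x W takes the same value on them; the
   universal property is tlift / tlift_pure / tens_ext below. *)
Section TensorDef.
Variables (k : fieldType) (V W : lmodType k).

Definition teval (U : lmodType k) (b : V -> W -> U) (s : seq (V * W)) : U :=
  \sum_(p <- s) b p.1 p.2.

Definition tens_rel : rel (seq (V * W)) := fun s t =>
  `[< forall (U : lmodType k) (b : {bilinear V -> W -> U}),
        teval b s = teval b t >].

Lemma tens_rel_refl : reflexive tens_rel.
Proof. by move=> s; apply/asboolP. Qed.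

Lemma tens_rel_sym : symmetric tens_rel.
Proof. by move=> s t; apply/asboolP/asboolP => h U b; rewrite h. Qed.

Lemma tens_rel_trans : transitive tens_rel.
Proof. by move=> s t u /asboolP h /asboolP h'; apply/asboolP => U b; rewrite h h'. Qed.

Canonical tens_equiv :=
  EquivRel tens_rel tens_rel_refl tens_rel_sym tens_rel_trans.

Record tens : Type := Tens { tens_quot : {eq_quot tens_equiv} }.

Lemma tens_quotK : cancel tens_quot Tens.
Proof. by case. Qed.

HB.instance Definition _ := Choice.copy tens (can_type tens_quotK).

Definition formal_sum (s : seq (V * W)) : tens := Tens (\pi s).
Definition tens_seq (x : tens) : seq (V * W) := repr (tens_quot x).

(* Meaningful for bilinear b, in which case it does not depend on the
   representative. *)
Definition tlift (U : lmodType k) (b : V -> W -> U) (x : tens) : U :=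
  teval b (tens_seq x).

Definition pure (v : V) (w : W) : tens := formal_sum [:: (v, w)].

Lemma teval_cat (U : lmodType k) (b : V -> W -> U) s t :
  teval b (s ++ t) = teval b s + teval b t.
Proof. exact: big_cat. Qed.

Lemma tlift_formal_sum (U : lmodType k) (b : {bilinear V -> W -> U}) s : tlift b (formal_sum s) = teval b s.
Proof.
rewrite /tlift /tens_seq /=; case: piP => t /eqmodP /asboolP h.
by rewrite h.
Qed.

Lemma tens_inj (x y : tens) :
  (forall (U : lmodType k) (b : {bilinear V -> W -> U}), tlift b x = tlift b y) ->
  x = y.
Proof.
case: x => x; case: y => y.
elim/quotW: x => s; elim/quotW: y => t h; congr Tens; apply/eqmodP/asboolP => U b.
by rewrite -!tlift_formal_sum h.
Qed.

Definition tens_add (x y : tens) : tens := formal_sum (tens_seq x ++ tens_seq y).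
Definition tens_opp (x : tens) : tens := formal_sum [seq (- p.1, p.2) | p <- tens_seq x].
Definition tens_scale (a : k) (x : tens) : tens :=
  formal_sum [seq (a *: p.1, p.2) | p <- tens_seq x].

Lemma tlift_zero (U : lmodType k) (b : {bilinear V -> W -> U}) : tlift b (formal_sum [::]) = 0.
Proof. by rewrite tlift_formal_sum /teval big_nil. Qed.

Lemma tlift_add (U : lmodType k) (b : {bilinear V -> W -> U}) x y :
  tlift b (tens_add x y) = tlift b x + tlift b y.
Proof. by rewrite tlift_formal_sum teval_cat. Qed.

Lemma tlift_opp (U : lmodType k) (b : {bilinear V -> W -> U}) x :
  tlift b (tens_opp x) = - tlift b x.
Proof.
rewrite tlift_formal_sum /tlift /teval big_map -sumrN.
by apply: eq_bigr => p _; rewrite linearNl.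
Qed.

Lemma tlift_scale (U : lmodType k) (b : {bilinear V -> W -> U}) a x :
  tlift b (tens_scale a x) = a *: tlift b x.
Proof.
rewrite tlift_formal_sum /tlift /teval big_map scaler_sumr.
by apply: eq_bigr => p _; rewrite linearZl.
Qed.

Lemma tens_addA : associative tens_add.
Proof. by move=> x y z; apply: tens_inj => U b; rewrite !tlift_add addrA. Qed.
Lemma tens_addC : commutative tens_add.
Proof. by move=> x y; apply: tens_inj => U b; rewrite !tlift_add addrC. Qed.
Lemma tens_add0 : left_id (formal_sum [::] : tens) tens_add.
Proof. by move=> x; apply: tens_inj => U b; rewrite tlift_add tlift_zero add0r. Qed.
Lemma tens_addN : left_inverse (formal_sum [::] : tens) tens_opp tens_add.
Proof.
by move=> x; apply: tens_inj => U b; rewrite tlift_add tlift_opp tlift_zero addNr.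
Qed.

HB.instance Definition _ :=
  GRing.isZmodule.Build tens tens_addA tens_addC tens_add0 tens_addN.

Lemma tliftD (U : lmodType k) (b : {bilinear V -> W -> U}) x y :
  tlift b (x + y) = tlift b x + tlift b y.
Proof. exact: tlift_add. Qed.

Lemma tens_scaleA a b v : tens_scale a (tens_scale b v) = tens_scale (a * b) v.
Proof. by apply: tens_inj => U f; rewrite !tlift_scale scalerA. Qed.
Lemma tens_scale1 : left_id 1 tens_scale.
Proof. by move=> v; apply: tens_inj => U f; rewrite tlift_scale scale1r. Qed.
Lemma tens_scaleDr : right_distributive tens_scale +%R.
Proof.
by move=> a v w; apply: tens_inj => U f; rewrite tliftD !tlift_scale tliftD scalerDr.
Qed.
Lemma tens_scaleDl v : {morph tens_scale^~ v : a b / a + b}.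
Proof.
by move=> a b; apply: tens_inj => U f; rewrite tliftD !tlift_scale scalerDl.
Qed.

HB.instance Definition _ := GRing.Zmodule_isLmodule.Build k tens
  tens_scaleA tens_scale1 tens_scaleDr tens_scaleDl.

Lemma tlift_linear (U : lmodType k) (b : {bilinear V -> W -> U}) : linear (tlift b).
Proof. by move=> a x y; rewrite tliftD; congr (_ + _); exact: tlift_scale. Qed.

HB.instance Definition _ (U : lmodType k) (b : {bilinear V -> W -> U}) :=
  GRing.isLinear.Build k tens U _ (tlift b) (tlift_linear b).

Lemma tlift_pure (U : lmodType k) (b : {bilinear V -> W -> U}) v w : tlift b (pure v w) = b v w.
Proof. by rewrite tlift_formal_sum /teval big_seq1. Qed.

Lemma pure_bilinear : bilinear_for *:%R *:%R (pure : V -> W -> tens).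
Proof.
split=> [w a v v'|v a w w'] /=; apply: tens_inj => U b;
  by rewrite linearP /= !tlift_pure ?linearPl ?linearPr.
Qed.

HB.instance Definition _ :=
  bilinear_isBilinear.Build k V W tens _ _ pure pure_bilinear.

Lemma tens_sum (x : tens) : x = \sum_(p <- tens_seq x) pure p.1 p.2.
Proof.
apply: tens_inj => U b; rewrite linear_sum /= {1}/tlift /teval.
by apply: eq_bigr => p _; rewrite tlift_pure.
Qed.

Lemma tens_ext (U : lmodType k) (f g : {linear tens -> U}) :
  (forall v w, f (pure v w) = g (pure v w)) -> f =1 g.
Proof.
by move=> h x; rewrite (tens_sum x) !linear_sum; apply: eq_bigr => p _; rewrite h.
Qed.

End TensorDef.

Lemma tens_ind (k : fieldType) (V W : lmodType k) (P : tens V W -> Prop) :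
  (forall v w, P (pure v w)) -> (forall x y, P x -> P y -> P (x + y)) ->
  forall x, P x.
Proof.
move=> hp hD x; rewrite (tens_sum x); apply: (big_ind P) => //.
by have <- : pure 0 0 = 0 :> tens V W by rewrite linear0l.
Qed.

Notation "V ⊗ W" := (tens V%type W%type) (at level 40, left associativity) : type_scope.
Notation "v ⊗ w" := (pure v w) (at level 40, left associativity) : ring_scope.

Section TensorMap.
Variables (k : fieldType) (V W V' W' : lmodType k).

Definition tmap_fun (f : V -> V') (g : W -> W') v w : V' ⊗ W' := f v ⊗ g w.

Lemma tmap_fun_bilinear (f : {linear V -> V'}) (g : {linear W -> W'}) :
  bilinear_for *:%R *:%R (tmap_fun f g).
Proof.
by split=> [w a v v'|v a w w'] /=; rewrite /tmap_fun linearP ?linearPl ?linearPr.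
Qed.

HB.instance Definition _ (f : {linear V -> V'}) (g : {linear W -> W'}) :=
  bilinear_isBilinear.Build k V W (V' ⊗ W')%type _ _ (tmap_fun f g)
    (tmap_fun_bilinear f g).

Definition tmap (f : V -> V') (g : W -> W') : V ⊗ W -> V' ⊗ W' :=
  tlift (tmap_fun f g).

HB.instance Definition _ (f : {linear V -> V'}) (g : {linear W -> W'}) :=
  GRing.Linear.on (tmap f g).

Lemma tmapE (f : {linear V -> V'}) (g : {linear W -> W'}) v w :
  tmap f g (v ⊗ w) = f v ⊗ g w.
Proof. exact: tlift_pure. Qed.

End TensorMap.

Notation "f ⊠ g" := (tmap f g) (at level 40, left associativity) : ring_scope.

Section Separation.
Variables (k : fieldType) (V : lmodType k).

Lemma separating_form (v : V) : v != 0 -> exists f : {linear V -> k^o}, f v = 1.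
Proof.
move=> v0.
pose clin (M : set V) := forall a x y, M x -> M y -> M (a *: x + y).
pose P (M : set V) := clin M /\ ~ M v.
have [F FP Ftot|M [[Ml Mv] Mmax]] := @Zorn_bigcup V P.
  split=> [a x y [X FX Xx] [Y FY Yy]|[X FX Xv]]; last by have [_] := FP _ FX; apply.
  have [XY|YX] := Ftot _ _ FX FY.
    by exists Y => //; apply: (FP _ FY).1 => //; apply: XY.
  by exists X => //; apply: (FP _ FX).1 => //; apply: YX.
have M0 : M 0.
  apply: contrapT => nM0.
  have nM x : ~ M x.
    by move=> Mx; apply: nM0; rewrite -(addNr x) -scaleN1r; apply: Ml.
  apply: (Mmax [set 0]); last first.
    split=> [a x y /= -> ->|/= v00]; first by rewrite scaler0 addr0.
    by move: v0; rewrite v00 eqxx.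
  by split=> [x /nM[]//|/(_ 0 erefl)/nM].
have MZ a x : M x -> M (a *: x) by move=> Mx; rewrite -[_ *: _]addr0; apply: Ml.
have MD x y : M x -> M y -> M (x + y).
  by move=> Mx; rewrite -[x]scale1r; apply: Ml.
have ex x : exists c : k, M (x - c *: v).
  have [Mx|nMx] := EM (M x); first by exists 0; rewrite scale0r subr0.
  pose B := [set z | exists a y, M y /\ z = y + a *: x].
  have : ~ P B.
    apply: Mmax; split=> [y My|BM]; first by exists 0, y; split=> //; rewrite scale0r addr0.
    apply: nMx; apply: BM; exists 1, 0.
    by split=> //; rewrite add0r scale1r.
  move=> nPB; have : B v.
    apply: contrapT => nBv; apply: nPB; split=> // a y z [b [y' [My' ->]]] [c [z' [Mz' ->]]].
    exists (a * b + c), (a *: y' + z'); split; first exact: Ml.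
    by rewrite scalerDr scalerA scalerDl addrACA.
  move=> [a [y [My vE]]].
  have a0 : a != 0.
    by apply/eqP => a0; apply: Mv; rewrite vE a0 scale0r addr0.
  exists a^-1; rewrite vE scalerDr scalerA mulVf// scale1r opprD addrCA subrr addr0.
  by rewrite -scalerN -scaleN1r scalerA; apply: MZ.
have uniq x c c' : M (x - c *: v) -> M (x - c' *: v) -> c = c'.
  move=> Mc Mc'; apply/eqP; rewrite -subr_eq0; apply/negP => /negP cc'.
  apply: Mv; rewrite -[v]scale1r -(mulVf cc') -scalerA; apply: MZ.
  have -> : (c - c') *: v = (-1) *: (x - c *: v) + (x - c' *: v).
    by rewrite scaleN1r opprB scalerBl addrA subrK.
  exact: Ml.
pose f x : k^o := projT1 (cid (ex x)).
have fM x : M (x - f x *: v) by rewrite /f; case: cid.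
have flin : linear f.
  move=> a x y; apply: (@uniq (a *: x + y)); first exact: fM.
  have -> : a *: x + y - (a *: f x + f y) *: v
     = a *: (x - f x *: v) + (y - f y *: v).
    by rewrite scalerBr scalerDl scalerA opprD addrACA.
  exact: Ml.
pose fm := GRing.isLinear.Build k V k^o _ f flin.
pose fL : {linear V -> k^o} := HB.pack f fm.
exists fL; apply: (@uniq v); first exact: (fM v).
by rewrite scale1r subrr.
Qed.

End Separation.

Lemma pure_neq0 (k : fieldType) (V W : lmodType k) (v : V) (w : W) :
  v != 0 -> w != 0 -> v ⊗ w != 0.
Proof.
move=> /separating_form[f fv] /separating_form[g gw].
apply/eqP => /(congr1 (f ⊠ g)); rewrite tmapE fv gw linear0.
pose b (x y : k^o) : k^o := x * y.
have bb : bilinear_for *:%R *:%R b.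
  split=> [y a x x'|x a y y'] /=; rewrite /b; first by rewrite mulrDl scalerAl.
  by rewrite mulrDr scalerAr.
pose bm := bilinear_isBilinear.Build k _ _ _ _ _ b bb.
pose bL : {bilinear k^o -> k^o -> k^o} := HB.pack b bm.
move=> /(congr1 (tlift bL)); rewrite tlift_pure linear0 /= /b mulr1.
by apply/eqP; rewrite oner_eq0.
Qed.

Section TensorAlgebra.
Variables (k : fieldType) (A B : algType k).

Definition tmul_fun2 (a : A) (b : B) a' b' : A ⊗ B := (a * a') ⊗ (b * b').

Lemma tmul_fun2_bilinear a b : bilinear_for *:%R *:%R (tmul_fun2 a b).
Proof.
split=> [w c v v'|v c w w'] /=; rewrite /tmul_fun2 mulrDr -scalerAr.
  by rewrite linearPl.
by rewrite linearPr.
Qed.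

HB.instance Definition _ a b :=
  bilinear_isBilinear.Build k A B (A ⊗ B)%type _ _ (tmul_fun2 a b)
    (tmul_fun2_bilinear a b).

Definition tmul_fun (y : A ⊗ B) a b : A ⊗ B := tlift (tmul_fun2 a b) y.

Lemma tmul_fun_bilinear y : bilinear_for *:%R *:%R (tmul_fun y).
Proof.
split=> [w c v v'|v c w w'] /=; rewrite /tmul_fun.
  elim/tens_ind: y => [a b|y z hy hz].
    by rewrite !tlift_pure /= /tmul_fun2 mulrDl -scalerAl linearPl.
  by rewrite !linearD /= hy hz addrACA.
elim/tens_ind: y => [a b|y z hy hz].
  by rewrite !tlift_pure /= /tmul_fun2 mulrDl -scalerAl linearPr.
by rewrite !linearD /= hy hz addrACA.
Qed.

HB.instance Definition _ y :=
  bilinear_isBilinear.Build k A B (A ⊗ B)%type _ _ (tmul_fun y)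
    (tmul_fun_bilinear y).

Definition tmul (x y : A ⊗ B) : A ⊗ B := tlift (tmul_fun y) x.

Lemma tmul_pure a b a' b' :
  tmul (a ⊗ b) (a' ⊗ b') = (a * a') ⊗ (b * b').
Proof. by rewrite /tmul tlift_pure /= /tmul_fun tlift_pure. Qed.

Lemma tmulDl : left_distributive tmul +%R.
Proof. by move=> x y z; rewrite /tmul linearD. Qed.

Lemma tmulDr : right_distributive tmul +%R.
Proof.
move=> x y z; elim/tens_ind: x => [a b|x x' hx hx'].
  by rewrite /tmul !tlift_pure /= /tmul_fun linearD.
by rewrite !tmulDl hx hx' addrACA.
Qed.

Lemma tmulA : associative tmul.
Proof.
move=> x y z; elim/tens_ind: x => [a b|x x' hx hx']; last by rewrite !tmulDl hx hx'.
elim/tens_ind: y => [a' b'|y y' hy hy']; last by rewrite tmulDl !tmulDr tmulDl hy hy'.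
elim/tens_ind: z => [a'' b''|z z' hz hz']; last by rewrite !tmulDr hz hz'.
by rewrite !tmul_pure !mulrA.
Qed.

Lemma tmul1 : left_id ((1 : A) ⊗ (1 : B)) tmul.
Proof.
elim/tens_ind => [a b|x y hx hy]; last by rewrite tmulDr hx hy.
by rewrite tmul_pure !mul1r.
Qed.

Lemma tmulr1 : right_id ((1 : A) ⊗ (1 : B)) tmul.
Proof.
elim/tens_ind => [a b|x y hx hy]; last by rewrite tmulDl hx hy.
by rewrite tmul_pure !mulr1.
Qed.

Lemma tone_neq0 : (1 : A) ⊗ (1 : B) != 0.
Proof. by apply: pure_neq0; rewrite oner_neq0. Qed.

HB.instance Definition _ := GRing.Zmodule_isNzRing.Build (A ⊗ B)%type
  tmulA tmul1 tmulr1 tmulDl tmulDr tone_neq0.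

Lemma mul_pure (a a' : A) (b b' : B) :
  (a ⊗ b) * (a' ⊗ b') = (a * a') ⊗ (b * b').
Proof. exact: tmul_pure. Qed.

Lemma tmul_scaleAl (c : k) (x y : A ⊗ B) : c *: (x * y) = c *: x * y.
Proof. by rewrite /GRing.mul /= /tmul linearZ. Qed.

HB.instance Definition _ :=
  GRing.Lmodule_isLalgebra.Build k (A ⊗ B)%type tmul_scaleAl.

Lemma tmul_scaleAr (c : k) (x y : A ⊗ B) : c *: (x * y) = x * (c *: y).
Proof.
elim/tens_ind: x => [a b|x x' hx hx']; last by rewrite !mulrDl scalerDr hx hx'.
elim/tens_ind: y => [a' b'|y y' hy hy'].
  by rewrite -[c *: (a' ⊗ b')]linearZl !mul_pure -scalerAr linearZl.
by rewrite mulrDr !scalerDr mulrDr hy hy'.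
Qed.

HB.instance Definition _ :=
  GRing.Lalgebra_isAlgebra.Build k (A ⊗ B)%type tmul_scaleAr.

End TensorAlgebra.

Section TensorMapAlgebra.
Variables (k : fieldType) (A B A' B' : algType k).
Variables (f : {lrmorphism A -> A'}) (g : {lrmorphism B -> B'}).

Lemma tmap_monoid_morphism : monoid_morphism (f ⊠ g).
Proof.
split=> [|x y]; first by rewrite tmapE !rmorph1.
elim/tens_ind: x => [a b|x x' hx hx']; last by rewrite !(mulrDl, linearD) /= hx hx'.
elim/tens_ind: y => [a' b'|y y' hy hy']; last by rewrite !(mulrDr, linearD) /= hy hy'.
by rewrite !(tmapE, mul_pure) !rmorphM.
Qed.

HB.instance Definition _ :=
  GRing.isMonoidMorphism.Build _ _ (f ⊠ g) tmap_monoid_morphism.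

End TensorMapAlgebra.

Section OppositeAlgebra.
Variables (k : fieldType).

HB.instance Definition _ (V : lmodType k) := GRing.Lmodule.on V^c.

Variable A : algType k.

Lemma opp_scaleAl (c : k) (x y : A^c) :
  c *: (x * y : A^c) = (c *: x : A^c) * y :> A^c.
Proof. exact: (@scalerAr k A c y x). Qed.

HB.instance Definition _ := GRing.Lmodule_isLalgebra.Build k A^c opp_scaleAl.

Lemma opp_scaleAr (c : k) (x y : A^c) :
  c *: (x * y : A^c) = x * (c *: y : A^c) :> A^c.
Proof. exact: (@scalerAl k A c y x). Qed.

HB.instance Definition _ := GRing.Lalgebra_isAlgebra.Build k A^c opp_scaleAr.

End OppositeAlgebra.

Section Structural.
Variables (k : fieldType).

Section Swap.
Variables (V W : lmodType k).

Definition tswap_fun (v : V) (w : W) : W ⊗ V := w ⊗ v.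

Lemma tswap_fun_bilinear : bilinear_for *:%R *:%R tswap_fun.
Proof.
by split=> [w a v v'|v a w w'] /=; rewrite /tswap_fun ?linearPl ?linearPr.
Qed.

HB.instance Definition _ :=
  bilinear_isBilinear.Build k V W (W ⊗ V)%type _ _ tswap_fun tswap_fun_bilinear.

Definition tswap : V ⊗ W -> W ⊗ V := tlift tswap_fun.

HB.instance Definition _ := GRing.Linear.on tswap.

Lemma tswapE v w : tswap (v ⊗ w) = w ⊗ v.
Proof. exact: tlift_pure. Qed.

End Swap.

Section Assoc.
Variables (V W U : lmodType k).

Definition tassoc_fun2 (u : U) (v : V) (w : W) : V ⊗ (W ⊗ U) := v ⊗ (w ⊗ u).

Lemma tassoc_fun2_bilinear u : bilinear_for *:%R *:%R (tassoc_fun2 u).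
Proof.
by split=> [w a v v'|v a w w'] /=; rewrite /tassoc_fun2 ?linearPl ?linearPr.
Qed.

HB.instance Definition _ u :=
  bilinear_isBilinear.Build k V W (V ⊗ (W ⊗ U))%type _ _ (tassoc_fun2 u)
    (tassoc_fun2_bilinear u).

Definition tassoc_fun (x : V ⊗ W) (u : U) : V ⊗ (W ⊗ U) := tlift (tassoc_fun2 u) x.

Lemma tassoc_fun_bilinear : bilinear_for *:%R *:%R tassoc_fun.
Proof.
split=> [u a x x'|x a u u'] /=; rewrite /tassoc_fun; first by rewrite linearP.
elim/tens_ind: x => [v w|x y hx hy].
  by rewrite !tlift_pure /= /tassoc_fun2 !linearPr.
by rewrite !linearD /= hx hy addrACA.
Qed.

HB.instance Definition _ :=
  bilinear_isBilinear.Build k (V ⊗ W)%type U (V ⊗ (W ⊗ U))%type _ _ tassoc_fun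
    tassoc_fun_bilinear.

Definition tassoc : V ⊗ W ⊗ U -> V ⊗ (W ⊗ U) := tlift tassoc_fun.

HB.instance Definition _ := GRing.Linear.on tassoc.

Lemma tassocE v w u : tassoc (v ⊗ w ⊗ u) = v ⊗ (w ⊗ u).
Proof. by rewrite /tassoc tlift_pure /= /tassoc_fun tlift_pure. Qed.

Definition tassocI_fun2 (v : V) (w : W) (u : U) : V ⊗ W ⊗ U := v ⊗ w ⊗ u.

Lemma tassocI_fun2_bilinear v : bilinear_for *:%R *:%R (tassocI_fun2 v).
Proof.
by split=> [u a w w'|w a u u'] /=;
  rewrite /tassocI_fun2 ?(linearPl, linearPr) //= linearPl.
Qed.

HB.instance Definition _ v :=
  bilinear_isBilinear.Build k W U (V ⊗ W ⊗ U)%type _ _ (tassocI_fun2 v)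
    (tassocI_fun2_bilinear v).

Definition tassocI_fun (v : V) (y : W ⊗ U) : V ⊗ W ⊗ U := tlift (tassocI_fun2 v) y.

Lemma tassocI_fun_bilinear : bilinear_for *:%R *:%R tassocI_fun.
Proof.
split=> [y a v v'|v a y y'] /=; rewrite /tassocI_fun; last by rewrite linearP.
elim/tens_ind: y => [w u|y y' hy hy'].
  by rewrite !tlift_pure /= /tassocI_fun2 !linearPl.
by rewrite !linearD /= hy hy' addrACA.
Qed.

HB.instance Definition _ :=
  bilinear_isBilinear.Build k V (W ⊗ U)%type (V ⊗ W ⊗ U)%type _ _ tassocI_fun
    tassocI_fun_bilinear.

Definition tassocI : V ⊗ (W ⊗ U) -> V ⊗ W ⊗ U := tlift tassocI_fun.

HB.instance Definition _ := GRing.Linear.on tassocI.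

Lemma tassocIE v w u : tassocI (v ⊗ (w ⊗ u)) = v ⊗ w ⊗ u.
Proof. by rewrite /tassocI tlift_pure /= /tassocI_fun tlift_pure. Qed.

End Assoc.

Definition tswap23 (V W U : lmodType k) : V ⊗ W ⊗ U -> V ⊗ U ⊗ W :=
  @tassocI V U W \o (idfun ⊠ @tswap W U) \o @tassoc V W U.

Definition tswap13 (V W U : lmodType k) : V ⊗ W ⊗ U -> U ⊗ W ⊗ V :=
  @tassocI U W V \o (idfun ⊠ @tswap V W) \o @tswap (V ⊗ W)%type U.

Definition tflat3 (X V W U : lmodType k) : X ⊗ (V ⊗ W ⊗ U) -> X ⊗ V ⊗ W ⊗ U :=
  (@tassocI X V W ⊠ idfun) \o @tassocI X (V ⊗ W)%type U.

Section Contraction.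
Variables (V W : lmodType k).

Definition tcontrr_fun (e : W -> k^o) (v : V) (w : W) : V := e w *: v.

Lemma tcontrr_fun_bilinear (e : {linear W -> k^o}) :
  bilinear_for *:%R *:%R (tcontrr_fun e).
Proof.
split=> [w a v v'|v a w w'] /=; rewrite /tcontrr_fun.
  by rewrite scalerDr !scalerA mulrC.
by rewrite linearP scalerDl scalerA.
Qed.

HB.instance Definition _ (e : {linear W -> k^o}) :=
  bilinear_isBilinear.Build k V W V _ _ (tcontrr_fun e) (tcontrr_fun_bilinear e).

Definition tcontrr (e : W -> k^o) : V ⊗ W -> V := tlift (tcontrr_fun e).

HB.instance Definition _ (e : {linear W -> k^o}) := GRing.Linear.on (tcontrr e).

Definition tcontrl_fun (e : V -> k^o) (v : V) (w : W) : W := e v *: w.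

Lemma tcontrl_fun_bilinear (e : {linear V -> k^o}) :
  bilinear_for *:%R *:%R (tcontrl_fun e).
Proof.
split=> [w a v v'|v a w w'] /=; rewrite /tcontrl_fun.
  by rewrite linearP scalerDl scalerA.
by rewrite scalerDr !scalerA mulrC.
Qed.

HB.instance Definition _ (e : {linear V -> k^o}) :=
  bilinear_isBilinear.Build k V W W _ _ (tcontrl_fun e) (tcontrl_fun_bilinear e).

Definition tcontrl (e : V -> k^o) : V ⊗ W -> W := tlift (tcontrl_fun e).

HB.instance Definition _ (e : {linear V -> k^o}) := GRing.Linear.on (tcontrl e).

End Contraction.

Section Multiplication.
Variable A : algType k.

Definition tmult_fun (a b : A) : A := a * b.

Lemma tmult_fun_bilinear : bilinear_for *:%R *:%R tmult_fun.
Proof.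
split=> [b c a a'|a c b b'] /=; rewrite /tmult_fun.
  by rewrite mulrDl scalerAl.
by rewrite mulrDr scalerAr.
Qed.

HB.instance Definition _ :=
  bilinear_isBilinear.Build k A A A _ _ tmult_fun tmult_fun_bilinear.

Definition tmult : A ⊗ A -> A := tlift tmult_fun.

HB.instance Definition _ := GRing.Linear.on tmult.

End Multiplication.

End Structural.

Section StructuralAlgebra.
Variables (k : fieldType).

Section Assoc.
Variables (A B C : algType k).

Lemma tens3_ind (P : A ⊗ B ⊗ C -> Prop) :
  (forall a b c, P (a ⊗ b ⊗ c)) -> (forall x y, P x -> P y -> P (x + y)) ->
  forall x, P x.
Proof.
move=> hp hD; elim/tens_ind => [x c|]; last exact: hD.
elim/tens_ind: x => [a b|x y hx hy]; first exact: hp.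
by rewrite linearDl; apply: hD.
Qed.

Lemma tassoc_monoid_morphism : monoid_morphism (@tassoc k A B C).
Proof.
split=> [|x y]; first exact: tassocE.
elim/tens3_ind: x => [a b c|x x' hx hx']; last by rewrite !(mulrDl, linearD) /= hx hx'.
elim/tens3_ind: y => [a' b' c'|y y' hy hy']; last by rewrite !(mulrDr, linearD) /= hy hy'.
by rewrite !(tassocE, mul_pure).
Qed.

HB.instance Definition _ :=
  GRing.isMonoidMorphism.Build _ _ (@tassoc k A B C) tassoc_monoid_morphism.

Lemma tassocK : cancel (@tassoc k A B C) (@tassocI k A B C).
Proof.
by elim/tens3_ind => [a b c|x y hx hy]; rewrite ?tassocE ?tassocIE // !linearD /= hx hy.
Qed.

Lemma tassocIK : cancel (@tassocI k A B C) (@tassoc k A B C).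
Proof.
elim/tens_ind => [a x|x y hx hy]; last by rewrite !linearD /= hx hy.
elim/tens_ind: x => [b c|x y hx hy]; first by rewrite tassocIE tassocE.
by rewrite linearDr !linearD /= hx hy.
Qed.

Lemma tassocI_monoid_morphism : monoid_morphism (@tassocI k A B C).
Proof.
split=> [|x y]; first exact: tassocIE.
by rewrite -[x]tassocIK -[y]tassocIK -rmorphM !tassocK.
Qed.

HB.instance Definition _ :=
  GRing.isMonoidMorphism.Build _ _ (@tassocI k A B C) tassocI_monoid_morphism.

End Assoc.

HB.instance Definition _ (X V W U : lmodType k) :=
  GRing.Linear.on (@tflat3 k X V W U).

Lemma tflat3_monoid_morphism (X A B C : algType k) :
  monoid_morphism (@tflat3 k X A B C).
Proof. by split=> [|x y]; rewrite /tflat3 /= ?rmorph1 ?rmorphM. Qed.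

HB.instance Definition _ (X A B C : algType k) :=
  GRing.isMonoidMorphism.Build _ _ (@tflat3 k X A B C)
    (@tflat3_monoid_morphism X A B C).

HB.instance Definition _ (A B C : lmodType k) :=
  GRing.Linear.on (@tswap13 k A B C).
HB.instance Definition _ (A B C : lmodType k) :=
  GRing.Linear.on (@tswap23 k A B C).

Lemma tswap13E (A B C : lmodType k) (a : A) (b : B) (c : C) :
  tswap13 (a ⊗ b ⊗ c) = c ⊗ b ⊗ a.
Proof. by rewrite /tswap13 /= tswapE tmapE /= tswapE tassocIE. Qed.

Lemma tswap23E (A B C : lmodType k) (a : A) (b : B) (c : C) :
  tswap23 (a ⊗ b ⊗ c) = a ⊗ c ⊗ b.
Proof. by rewrite /tswap23 /= tassocE tmapE /= tswapE tassocIE. Qed.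

Lemma tflat3E (X A B C : lmodType k) (x : X) (a : A) (b : B) (c : C) :
  tflat3 (x ⊗ (a ⊗ b ⊗ c)) = x ⊗ a ⊗ b ⊗ c.
Proof. by rewrite /tflat3 /= tassocIE tmapE /= tassocIE. Qed.

End StructuralAlgebra.

Section Subalgebras.
Variables (k : fieldType) (A : algType k).

Section Equalizer.
Variables (B : algType k) (f g : {lrmorphism A -> B}).

Definition equalizer_pred : {pred A} := fun x => f x == g x.

Lemma mem_equalizer x : (x \in equalizer_pred) = (f x == g x).
Proof. by []. Qed.

Lemma equalizer_closed : subalg_closed equalizer_pred.
Proof.
split=> [|a x y|x y]; rewrite !mem_equalizer; first by rewrite !rmorph1 eqxx.
  by move=> /eqP hx /eqP hy; rewrite !linearP /= hx hy eqxx.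
by move=> /eqP hx /eqP hy; rewrite !rmorphM /= hx hy eqxx.
Qed.

HB.instance Definition _ :=
  GRing.isSubalgClosed.Build k A equalizer_pred equalizer_closed.

Record equalizer := Equalizer {
  equalizer_val : A; equalizerP : equalizer_val \in equalizer_pred }.

HB.instance Definition _ := [isSub for equalizer_val].
HB.instance Definition _ := [Choice of equalizer by <:].
HB.instance Definition _ := [SubChoice_isSubAlgebra of equalizer by <:].

Lemma equalizer_val_linear : linear equalizer_val.
Proof. exact: (linearP (\val : equalizer -> A)). Qed.
Lemma equalizer_val_monoid_morphism : monoid_morphism equalizer_val.
Proof. exact: (rmorphism_monoidP (\val : equalizer -> A)). Qed.

HB.instance Definition _ :=
  GRing.isLinear.Build k equalizer A _ equalizer_val equalizer_val_linear.
HB.instance Definition _ :=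
  GRing.isMonoidMorphism.Build equalizer A equalizer_val equalizer_val_monoid_morphism.

End Equalizer.

(* The x such that g x is defined and equal to h x, where g is the partial map
   sending x to p z whenever i z = j x; i is meant to be the inclusion of a
   subalgebra. *)
Section LiftEqualizer.
Variables (Z B C : algType k).
Variables (i : {lrmorphism Z -> B}) (j : {lrmorphism A -> B}).
Variables (p : {lrmorphism Z -> C}) (h : {lrmorphism A -> C}).

Definition lift_equalizer_pred : {pred A} :=
  fun x => `[< exists2 z, i z = j x & p z = h x >].

Lemma mem_lift_equalizer x :
  (x \in lift_equalizer_pred) = `[< exists2 z, i z = j x & p z = h x >].
Proof. by []. Qed.

Lemma lift_equalizer_closed : subalg_closed lift_equalizer_pred.
Proof.
split=> [|a x y|x y]; rewrite ?mem_lift_equalizer.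
- by apply/asboolP; exists 1; rewrite !rmorph1.
- move=> /asboolP[z zx zx'] /asboolP[t ty ty']; apply/asboolP.
  by exists (a *: z + t); rewrite !linearP /= ?zx ?zx' ?ty ?ty'.
- move=> /asboolP[z zx zx'] /asboolP[t ty ty']; apply/asboolP.
  by exists (z * t); rewrite !rmorphM /= ?zx ?zx' ?ty ?ty'.
Qed.

HB.instance Definition _ :=
  GRing.isSubalgClosed.Build k A lift_equalizer_pred lift_equalizer_closed.

Record lift_equalizer := LiftEqualizer {
  lift_equalizer_val : A;
  lift_equalizerP : lift_equalizer_val \in lift_equalizer_pred }.

HB.instance Definition _ := [isSub for lift_equalizer_val].
HB.instance Definition _ := [Choice of lift_equalizer by <:].
HB.instance Definition _ := [SubChoice_isSubAlgebra of lift_equalizer by <:].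

Lemma lift_equalizer_val_linear : linear lift_equalizer_val.
Proof. exact: (linearP (\val : lift_equalizer -> A)). Qed.
Lemma lift_equalizer_val_monoid_morphism : monoid_morphism lift_equalizer_val.
Proof. exact: (rmorphism_monoidP (\val : lift_equalizer -> A)). Qed.

HB.instance Definition _ :=
  GRing.isLinear.Build k lift_equalizer A _ lift_equalizer_val lift_equalizer_val_linear.
HB.instance Definition _ :=
  GRing.isMonoidMorphism.Build lift_equalizer A lift_equalizer_val lift_equalizer_val_monoid_morphism.

End LiftEqualizer.
End Subalgebras.

Section Torsor.
Variable k : fieldType.

(* Iterated tensor products are bracketed to the left, and tassoc, tassocI and
   tflat3 only move brackets.
   mu lands in the tensor product of T, T^op and T; since the underlying vector
   spaces of T and T^op coincide, tensor products in which the algebra structure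
   plays no role are often written without ^c. *)
Record torsor (T : algType k) := Torsor {
  mu : {lrmorphism T -> T ⊗ T^c ⊗ T};
  theta : {lrmorphism T -> T};
  theta_bij : bijective theta;
  mu_unitr : forall x, (idfun ⊠ @tmult k T) (tassoc (mu x : T ⊗ T ⊗ T)) = x ⊗ 1;
  mu_unitl : forall x, (@tmult k T ⊠ idfun) (mu x : T ⊗ T ⊗ T) = 1 ⊗ x;
  mu_assoc : forall x,
    tflat3 (((idfun : T ⊗ T^c -> T ⊗ T^c) ⊠ mu) (mu x : T ⊗ T^c ⊗ T)) =
    (mu ⊠ idfun ⊠ idfun) (mu x : T ⊗ T^c ⊗ T) :> T ⊗ T ⊗ T ⊗ T ⊗ T;
  mu_theta : forall x : T,
    (idfun ⊠ idfun ⊠ theta ⊠ idfun ⊠ idfun)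
      ((mu ⊠ idfun ⊠ idfun) (mu x : T ⊗ T ⊗ T) : T ⊗ T ⊗ T ⊗ T ⊗ T) =
    (@tflat3 k T T T T ⊠ idfun)
      ((idfun ⊠ (@tswap13 k T T T \o mu) ⊠ idfun) (mu x : T ⊗ T ⊗ T));
  theta_mu : forall x, (theta ⊠ theta ⊠ theta) (mu x : T ⊗ T ⊗ T) = mu (theta x)
}.

End Torsor.

Section OppositeMu.
Variables (k : fieldType) (T : algType k) (s : torsor T).

Definition mu_op (x : T^c) : T^c ⊗ T ⊗ T^c := @tswap13 k T T T (mu s x).

Lemma tswap13_rev (x y : T ⊗ T^c ⊗ T) :
  @tswap13 k T T T (y * x) =
  ((@tswap13 k T T T x : T^c ⊗ T ⊗ T^c) * (@tswap13 k T T T y : T^c ⊗ T ⊗ T^c)).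
Proof.
have tD (u v : T ⊗ T^c ⊗ T) : @tswap13 k T T T (u + v) =
    (@tswap13 k T T T u : T^c ⊗ T ⊗ T^c) + (@tswap13 k T T T v : T^c ⊗ T ⊗ T^c).
  exact: linearD.
elim/tens3_ind: x => [a b c|x x' hx hx']; last first.
  by rewrite mulrDr !tD hx hx' mulrDl.
elim/tens3_ind: y => [a' b' c'|y y' hy hy']; last first.
  by rewrite mulrDl !tD hy hy' mulrDr.
by rewrite !mul_pure !tswap13E !mul_pure.
Qed.

Lemma mu_op_linear : linear mu_op.
Proof. by move=> a x y; rewrite /mu_op; rewrite (linearP (mu s) a x y) [LHS]linearP. Qed.

Lemma mu_op_monoid_morphism : monoid_morphism mu_op.
Proof.
split=> [|x y]; rewrite /mu_op.
  by rewrite (rmorph1 (mu s)) [LHS]tswap13E.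
by rewrite (rmorphM (mu s) y x) tswap13_rev.
Qed.

HB.instance Definition _ :=
  GRing.isLinear.Build k (T^c)%type (T^c ⊗ T ⊗ T^c)%type _ mu_op mu_op_linear.
HB.instance Definition _ :=
  GRing.isMonoidMorphism.Build (T^c)%type (T^c ⊗ T ⊗ T^c)%type mu_op mu_op_monoid_morphism.

End OppositeMu.

Section HopfOfTorsor.
Variables (k : fieldType) (T : algType k) (s : torsor T).

Definition Hl_theta_mu : {lrmorphism T ⊗ T^c -> T ⊗ T^c ⊗ T ⊗ T^c} :=
  (@idfun T ⊠ @idfun T^c ⊠ theta s ⊠ @idfun T^c) \o (mu s ⊠ @idfun T^c).

Definition Hl_mu_op : {lrmorphism T ⊗ T^c -> T ⊗ T^c ⊗ T ⊗ T^c} :=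
  @tflat3 k T T^c T T^c \o (@idfun T ⊠ mu_op s).

Definition Hl : Type := equalizer Hl_theta_mu Hl_mu_op.
HB.instance Definition _ := GRing.SubAlgebra.on Hl.
Definition Hl_val : {lrmorphism Hl -> T ⊗ T^c} := @equalizer_val _ _ _ _ _.

Definition Hr_theta_mu : {lrmorphism T^c ⊗ T -> T^c ⊗ T ⊗ T^c ⊗ T} :=
  (@idfun T^c ⊠ theta s ⊠ @idfun T^c ⊠ @idfun T) \o
  @tflat3 k T^c T T^c T \o (@idfun T^c ⊠ mu s).

Definition Hr_mu_op : {lrmorphism T^c ⊗ T -> T^c ⊗ T ⊗ T^c ⊗ T} :=
  mu_op s ⊠ @idfun T.

Definition Hr : Type := equalizer Hr_theta_mu Hr_mu_op.
HB.instance Definition _ := GRing.SubAlgebra.on Hr.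
Definition Hr_val : {lrmorphism Hr -> T^c ⊗ T} := @equalizer_val _ _ _ _ _.

End HopfOfTorsor.

Record hopf (k : fieldType) (H : algType k) := Hopf {
  comul : {lrmorphism H -> H ⊗ H};
  counit : {lrmorphism H -> k^o};
  antipode : {linear H -> H};
  comulA : forall x : H,
    tassoc ((comul ⊠ idfun) (comul x : H ⊗ H) : H ⊗ H ⊗ H) =
    (idfun ⊠ comul) (comul x : H ⊗ H);
  counitl : forall x : H, tcontrl counit (comul x : H ⊗ H) = x;
  counitr : forall x : H, tcontrr counit (comul x : H ⊗ H) = x;
  antipodel : forall x : H,
    tmult ((antipode ⊠ idfun) (comul x : H ⊗ H) : H ⊗ H) = (counit x)%:A;
  antipoder : forall x : H,
    tmult ((idfun ⊠ antipode) (comul x : H ⊗ H) : H ⊗ H) = (counit x)%:A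
}.

Section InverseIso.
Variables (k : fieldType) (A B : algType k) (f : {lrmorphism A -> B}).
Hypothesis f_bij : bijective f.

Lemma bij_ex_inv : exists g : B -> A, cancel f g /\ cancel g f.
Proof. by case: f_bij => g fK gK; exists g. Qed.

Definition inv_iso : B -> A := projT1 (cid bij_ex_inv).

Lemma iso_invK : cancel f inv_iso.
Proof. by rewrite /inv_iso; case: cid => g []. Qed.

Lemma inv_isoK : cancel inv_iso f.
Proof. by rewrite /inv_iso; case: cid => g []. Qed.

HB.instance Definition _ :=
  GRing.isLinear.Build k B A _ inv_iso (can2_linear iso_invK inv_isoK).
HB.instance Definition _ :=
  GRing.isMonoidMorphism.Build B A inv_iso
    (can2_monoid_morphism iso_invK inv_isoK).

End InverseIso.

Section Septuple.
Variables (k : fieldType) (H : algType k) (hH : hopf H).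

(* The coproduct of Hl s is the corestriction of mu ⊠ id to Hl s ⊗ Hl s, and
   its counit e is defined by m_T(x) = e(x) 1. *)
Record hopf_iso_l (T : algType k) (s : torsor T) (i : {lrmorphism Hl s -> H}) :
    Prop := HopfIsoL {
  iso_l_bij : bijective i;
  iso_l_comul : forall x : Hl s, exists2 z : Hl s ⊗ Hl s,
    (Hl_val s ⊠ Hl_val s) z =
      tassoc ((mu s ⊠ idfun) (Hl_val s x : T ⊗ T) : T ⊗ T ⊗ T ⊗ T) &
    (i ⊠ i) z = comul hH (i x);
  iso_l_counit : forall x : Hl s,
    tmult (Hl_val s x : T ⊗ T) = (counit hH (i x))%:A }.

Record hopf_iso_r (T : algType k) (s : torsor T) (i : {lrmorphism Hr s -> H}) :
    Prop := HopfIsoR {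
  iso_r_bij : bijective i;
  iso_r_comul : forall x : Hr s, exists2 z : Hr s ⊗ Hr s,
    (Hr_val s ⊠ Hr_val s) z =
      tassoc (tflat3 ((idfun ⊠ mu s) (Hr_val s x : T ⊗ T)) : T ⊗ T ⊗ T ⊗ T) &
    (i ⊠ i) z = comul hH (i x);
  iso_r_counit : forall x : Hr s,
    tmult (Hr_val s x : T ⊗ T) = (counit hH (i x))%:A }.

Record septuple (T : algType k) := Septuple {
  tor : torsor T;
  il : {lrmorphism Hl tor -> H};
  ir : {lrmorphism Hr tor -> H};
  il_iso : hopf_iso_l il;
  ir_iso : hopf_iso_r ir }.

Record Tor_hat := TorHat { carrier : algType k; data : septuple carrier }.

Definition tor_equiv (t1 t2 : Tor_hat) : Prop :=
  let T1 := carrier t1 in let T2 := carrier t2 in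
  let s1 := data t1 in let s2 := data t2 in
  exists f : {lrmorphism T1 -> T2},
  [/\ bijective f,
      forall x, mu (tor s2) (f x) = (f ⊠ f ⊠ f) (mu (tor s1) x : T1 ⊗ T1 ⊗ T1),
      forall x, theta (tor s2) (f x) = f (theta (tor s1) x),
      forall x, exists2 y, Hl_val _ y = (f ⊠ f) (Hl_val _ x : T1 ⊗ T1) &
        il s1 x = il s2 y &
      forall x, exists2 y, Hr_val _ y = (f ⊠ f) (Hr_val _ x : T1 ⊗ T1) &
        ir s1 x = ir s2 y].

Definition tor_class (t : Tor_hat) : Tor_hat -> Prop := tor_equiv t.

Definition Tor (C : Tor_hat -> Prop) : Prop := exists t, C = tor_class t.

Section Product.
Variables (T1 T2 : algType k) (s1 : septuple T1) (s2 : septuple T2).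

Definition Phi : {lrmorphism Hr (tor s1) -> Hl (tor s2)} :=
  inv_iso (iso_l_bij (il_iso s2)) \o ir s1.

Definition cotensor_i :
    {lrmorphism T1 ⊗ Hr (tor s1) ⊗ T2 -> T1 ⊗ (T1^c ⊗ T1) ⊗ T2} :=
  idfun ⊠ Hr_val (tor s1) ⊠ idfun.
Definition cotensor_j : {lrmorphism T1 ⊗ T2 -> T1 ⊗ (T1^c ⊗ T1) ⊗ T2} :=
  (@tassoc k T1 T1^c T1 ⊠ idfun) \o (mu (tor s1) ⊠ idfun).
Definition cotensor_p :
    {lrmorphism T1 ⊗ Hr (tor s1) ⊗ T2 -> T1 ⊗ T2 ⊗ T2^c ⊗ T2} :=
  (@tassocI k T1 T2 T2^c ⊠ idfun) \o (idfun ⊠ (Hl_val (tor s2) \o Phi) ⊠ idfun).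
Definition cotensor_h : {lrmorphism T1 ⊗ T2 -> T1 ⊗ T2 ⊗ T2^c ⊗ T2} :=
  @tflat3 k T1 T2 T2^c T2 \o (idfun ⊠ mu (tor s2)).

Definition cotensor : Type :=
  lift_equalizer cotensor_i cotensor_j cotensor_p cotensor_h.
HB.instance Definition _ := GRing.SubAlgebra.on cotensor.

Definition cot_val : {lrmorphism cotensor -> T1 ⊗ T2} :=
  @lift_equalizer_val _ _ _ _ _ _ _ _ _.

(* By iso_l_counit and iso_r_counit, these are the counits of Hl (tor s2) and
   Hr (tor s1). *)
Definition counit_l : {lrmorphism Hl (tor s2) -> k^o} := counit hH \o il s2.
Definition counit_r : {lrmorphism Hr (tor s1) -> k^o} := counit hH \o ir s1.

Definition mu5 : T1 -> T1 ⊗ T1 ⊗ T1 ⊗ T1 ⊗ T1 :=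
  (mu (tor s1) ⊠ idfun ⊠ idfun) \o (mu (tor s1) : T1 -> T1 ⊗ T1 ⊗ T1).

Definition apply_Phi (w : T1 ⊗ Hr (tor s1) ⊗ T1 ⊗ T1 ⊗ T2) :
    T1 ⊗ T2 ⊗ T2 ⊗ T1 ⊗ T1 ⊗ T2 :=
  (@tassocI k T1 T2 T2 ⊠ idfun ⊠ idfun ⊠ idfun)
    ((idfun ⊠ (Hl_val (tor s2) \o Phi) ⊠ idfun ⊠ idfun ⊠ idfun) w).

(* For x in T1 ⊗ T2 with components x_i, y_i, the element y is
   tau_(34) (x_i^(1) ⊗ Phi (x_i^(2) ⊗ x_i^(3)) ⊗ x_i^(4) ⊗ x_i^(5) ⊗ y_i);
   w is the same 6-fold tensor before Phi, its second factor lying in Hr. *)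
Definition prod_mu_graph (x : T1 ⊗ T2)
    (y : (T1 ⊗ T2) ⊗ (T1 ⊗ T2) ⊗ (T1 ⊗ T2)) : Prop :=
  exists2 w : T1 ⊗ Hr (tor s1) ⊗ T1 ⊗ T1 ⊗ T2,
    (idfun ⊠ Hr_val (tor s1) ⊠ idfun ⊠ idfun ⊠ idfun) w =
      (@tassoc k T1 T1 T1 ⊠ idfun ⊠ idfun ⊠ idfun) ((mu5 ⊠ idfun) x) &
    y = (@tassoc k (T1 ⊗ T2)%type T1 T2 ⊠ idfun) (tassoc
          ((@tswap23 k (T1 ⊗ T2)%type T2 T1 ⊠ idfun ⊠ idfun) (apply_Phi w))).

Definition prod_il_graph (x : (T1 ⊗ T2) ⊗ (T1 ⊗ T2)) (y : T1 ⊗ T1) : Prop :=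
  exists2 w : T1 ⊗ Hl (tor s2) ⊗ T1,
    (idfun ⊠ Hl_val (tor s2) ⊠ idfun) w =
      (@tassoc k T1 T2 T2 ⊠ idfun) (tswap23 (tassocI x)) &
    y = (@tcontrr k T1 _ counit_l ⊠ idfun) w.

Definition prod_ir_graph (x : (T1 ⊗ T2) ⊗ (T1 ⊗ T2)) (y : T2 ⊗ T2) : Prop :=
  exists2 w : T2 ⊗ Hr (tor s1) ⊗ T2,
    (idfun ⊠ Hr_val (tor s1) ⊠ idfun) w =
      (@tassoc k T2 T1 T1 ⊠ idfun) (tassocI ((@tswap k T1 T2 ⊠ idfun) x)) &
    y = (@tcontrr k T2 _ counit_r ⊠ idfun) w.

Definition is_product (s : septuple cotensor) : Prop :=
  [/\ forall x, cot_val (theta (tor s) x) =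
                (theta (tor s1) ⊠ theta (tor s2)) (cot_val x),
      forall x, prod_mu_graph (cot_val x)
        ((cot_val ⊠ cot_val ⊠ cot_val)
           (mu (tor s) x : cotensor ⊗ cotensor ⊗ cotensor)),
      forall x : Hl (tor s), exists2 y : Hl (tor s1),
        prod_il_graph ((cot_val ⊠ cot_val) (Hl_val (tor s) x)) (Hl_val _ y) &
        il s x = il s1 y &
      forall x : Hr (tor s), exists2 y : Hr (tor s2),
        prod_ir_graph ((cot_val ⊠ cot_val) (Hr_val (tor s) x)) (Hr_val _ y) &
        ir s x = ir s2 y].

End Product.

Definition is_trivial (s : septuple H) : Prop :=
  [/\ forall x, mu (tor s) x =
        (idfun ⊠ antipode hH ⊠ idfun)
          ((comul hH ⊠ idfun) (comul hH x) : H ⊗ H ⊗ H),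
      forall x, theta (tor s) x = antipode hH (antipode hH x),
      forall x, il s x = tcontrr (counit hH) (Hl_val _ x : H ⊗ H) &
      forall x, ir s x = tcontrl (counit hH) (Hr_val _ x : H ⊗ H)].

Definition is_opposite (T : algType k) (s : septuple T) (s' : septuple T^c) :
    Prop :=
  [/\ forall x : T, mu (tor s') x = tswap13 (mu (tor s) x : T ⊗ T ⊗ T),
      forall x : T, theta (tor s') x = theta (tor s) x,
      forall x : Hl (tor s'), exists2 y : Hr (tor s),
        Hl_val _ x = (idfun ⊠ theta (tor s)) (Hr_val _ y : T ⊗ T) &
        il s' x = ir s y &
      forall x : Hr (tor s'), exists2 y : Hl (tor s),
        Hr_val _ x = (theta (tor s) ⊠ idfun) (Hl_val _ y : T ⊗ T) &
        ir s' x = il s y].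

(* The structure maps prescribed by is_product, is_trivial and is_opposite
   determine the septuple up to tor_equiv; that suitable septuples exist and
   that the sets below are single classes is part of the closure clauses of
   group_on. *)
Definition tor_mul (C1 C2 : Tor_hat -> Prop) : Tor_hat -> Prop := fun t =>
  exists t1 t2 (s : septuple (cotensor (data t1) (data t2))),
    [/\ C1 t1, C2 t2, is_product s & tor_equiv (TorHat s) t].

Definition tor_one : Tor_hat -> Prop := fun t =>
  exists2 s : septuple H, is_trivial s & tor_equiv (TorHat s) t.

Definition tor_inv (C : Tor_hat -> Prop) : Tor_hat -> Prop := fun t =>
  exists t0 (s : septuple (carrier t0)^c),
    [/\ C t0, is_opposite (data t0) s & tor_equiv (TorHat s) t].

End Septuple.

Record group_on (X : Type) (G : X -> Prop) (op : X -> X -> X) (e : X)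
    (inv : X -> X) : Prop := GroupOn {
  op_closed : forall x y, G x -> G y -> G (op x y);
  unit_closed : G e;
  inv_closed : forall x, G x -> G (inv x);
  op_assoc : forall x y z, G x -> G y -> G z -> op x (op y z) = op (op x y) z;
  op_unitl : forall x, G x -> op e x = x;
  op_unitr : forall x, G x -> op x e = x;
  op_invl : forall x, G x -> op (inv x) x = e;
  op_invr : forall x, G x -> op x (inv x) = e }.

Arguments Tor {k H} hH C.
Arguments tor_mul {k H} hH C1 C2 t.
Arguments tor_one {k H} hH t.
Arguments tor_inv {k H} hH C t.

(* Main.v *)
(* Writing mu(x) = x<1> ⊗ x<2> ⊗ x<3>, the inclusions mu(T) ⊂ H_l(T) ⊗ T and
   mu(T) ⊂ T ⊗ H_r(T), together with the identifications of H_l(T) and H_r(T)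
   with H, make T an H-bicomodule algebra that is Galois on both sides; the
   inverses of i_l and i_r are its translation maps del and gam, and theta is
   characterised by del(S h) = sum b ⊗ theta(a) for del h = sum a ⊗ b. Conversely
   such data determine a septuple, and two septuples are equivalent exactly when
   the algebras are isomorphic by a bicolinear map. Under this dictionary the
   trivial torsor is H itself, the product is the cotensor product over H, and
   the opposite torsor is T^op with its coactions exchanged and twisted by the
   inverse antipode. So everything reduces to bicolinear isomorphisms: the
   coaction T -> H □ T for the unit, gam : H -> T^op □ T for the inverse, and
   rebracketing for associativity; a left unit and left inverses suffice. *)

(* The subalgebras [Hl] and [Hr] are subtypes, and the product is described by relations on tensors
   over them; computing there would carry membership proofs through every step. The translation maps
   [del] and [gam], plain linear maps out of [H], turn every identity into a manipulation of
   iterated sums. The passage rests on the base being a field: tensoring preserves kernels, so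
   membership in [Hl ⊗ T] or in a cotensor product is tested slot by slot. Theta can be forgotten
   when septuples are compared, because a bicolinear algebra map preserves the translation maps, by
   their uniqueness, and these determine theta. Bijectivity of the square of the antipode is the
   bijectivity of theta on the trivial torsor; it also yields the inverse antipode of the opposite
   and lets theta restrict bijectively to a cotensor product. *)
Require Import Defs.
From HB Require Import structures.
From mathcomp Require Import all_boot all_order all_algebra.
From mathcomp Require Import boolp classical_sets.

Set Implicit Arguments.
Unset Strict Implicit.
Unset Printing Implicit Defensive.

Import GRing.Theory.
Local Open Scope ring_scope.

(** * Sweedler notation *)

(* The sum of e over the terms of some expression of x as a sum of pure tensors
   a ⊗ b; it depends on x only when e is bilinear in a and b. *)
Notation "\sw_ ( a , b <- x ) e" := (tlift (fun a b => e) x)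
  (at level 41, a name, b name, x at level 200, e at level 41,
   format "'[' \sw_ ( a ,  b  <-  x ) '/  '  e ']'") : ring_scope.

Section Multilinear.
Variable k : fieldType.
Implicit Types U V W X Y Z : lmodType k.

(* Multilinearity as a plain predicate on functions, so that the tactic lin below
   can establish it by following the syntax of the function. *)
Definition lin1 V W (f : V -> W) := forall a x y, f (a *: x + y) = a *: f x + f y.
Definition lin2 V W U (f : V -> W -> U) :=
  (forall w, lin1 (fun v => f v w)) /\ (forall v, lin1 (f v)).
Definition lin3 V W U X (f : V -> W -> U -> X) :=
  [/\ forall w u, lin1 (fun v => f v w u), forall v u, lin1 (fun w => f v w u) &
      forall v w, lin1 (f v w)].
Definition lin4 V W U X Y (f : V -> W -> U -> X -> Y) :=
  [/\ forall w u x, lin1 (fun v => f v w u x), forall v u x, lin1 (fun w => f v w u x),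
      forall v w x, lin1 (fun u => f v w u x) & forall v w u, lin1 (f v w u)].
Definition lin5 V W U X Y Z (f : V -> W -> U -> X -> Y -> Z) :=
  [/\ forall w u x y, lin1 (fun v => f v w u x y), forall v u x y, lin1 (fun w => f v w u x y),
      forall v w x y, lin1 (fun u => f v w u x y), forall v w u y, lin1 (fun x => f v w u x y)
    & forall v w u x, lin1 (f v w u x)].

Section Tlift.
Variables (V W U : lmodType k) (F : V -> W -> U).
Hypothesis F2 : lin2 F.

Lemma lin2_bilinear : bilinear_for *:%R *:%R F.
Proof. by case: F2 => Fl Fr; split=> [w a v v'|v a w w']; [exact: Fl | exact: Fr]. Qed.

Lemma sw_lin1 : lin1 (tlift F).
Proof.
pose m := bilinear_isBilinear.Build k V W U _ _ F lin2_bilinear.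
pose G : {bilinear V -> W -> U} := HB.pack F m.
exact: (tlift_linear G).
Qed.

Lemma sw_pure v w : \sw_(a, b <- v ⊗ w) F a b = F v w.
Proof.
pose m := bilinear_isBilinear.Build k V W U _ _ F lin2_bilinear.
pose G : {bilinear V -> W -> U} := HB.pack F m.
exact: (tlift_pure G).
Qed.

End Tlift.

Lemma lin1_add V W (f : V -> W) x y : lin1 f -> f (x + y) = f x + f y.
Proof. by move=> fl; have := fl 1 x y; rewrite !scale1r. Qed.

Lemma lin1_zero V W (f : V -> W) : lin1 f -> f 0 = 0.
Proof.
by move=> fl; apply: (@addrI _ (f 0)); rewrite -lin1_add // !addr0.
Qed.

Lemma lin1_sum V W (f : V -> W) I (r : seq I) E :
  lin1 f -> f (\sum_(i <- r) E i) = \sum_(i <- r) f (E i).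
Proof.
move=> fl; elim: r => [|i r ih]; first by rewrite !big_nil lin1_zero.
by rewrite !big_cons lin1_add // ih.
Qed.

Lemma lin1_sw V W U X (f : U -> X) (F : V -> W -> U) z :
  lin1 f -> f (\sw_(a, b <- z) F a b) = \sw_(a, b <- z) f (F a b).
Proof. by move=> fl; apply: lin1_sum. Qed.

Lemma lin1_scale V W (f : V -> W) c x : lin1 f -> f (c *: x) = c *: f x.
Proof. by move=> fl; rewrite -[c *: x]addr0 fl lin1_zero // addr0. Qed.

Lemma sw_sw V W V' W' U (F : V -> W -> U) (G : V' -> W' -> V ⊗ W) z :
  lin2 F ->
  \sw_(a, b <- \sw_(c, d <- z) G c d) F a b =
  \sw_(c, d <- z) \sw_(a, b <- G c d) F a b.
Proof. by move=> F2; apply: lin1_sw; apply: sw_lin1. Qed.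

Lemma sw_id V W (z : V ⊗ W) : \sw_(a, b <- z) a ⊗ b = z.
Proof. exact/esym/tens_sum. Qed.

(** Both sides are finite sums over the chosen representatives of [x] and [y], so this is an
    exchange of finite sums. *)
Lemma sw_exch V W V' W' U (F : V -> W -> V' -> W' -> U) (x : V ⊗ W) (y : V' ⊗ W') :
  \sw_(a, b <- x) \sw_(c, d <- y) F a b c d =
  \sw_(c, d <- y) \sw_(a, b <- x) F a b c d.
Proof. exact: exchange_big. Qed.

Lemma eq_sw V W U (F G : V -> W -> U) z :
  (forall a b, F a b = G a b) -> \sw_(a, b <- z) F a b = \sw_(a, b <- z) G a b.
Proof. by move=> FG; apply: eq_bigr => p _. Qed.

Lemma lin1_id V : lin1 (fun x : V => x). Proof. by []. Qed.

Lemma lin1_can V W (f : {linear V -> W}) : lin1 f.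
Proof. exact: linearP. Qed.

Lemma lin1_app V W U (f : {linear W -> U}) (E : V -> W) :
  lin1 E -> lin1 (fun x => f (E x)).
Proof. by move=> El a x y; rewrite El linearP. Qed.

Lemma lin1_purel V W U (E : V -> W) (u : U) : lin1 E -> lin1 (fun x => E x ⊗ u).
Proof. by move=> El a x y; rewrite El linearPl. Qed.

Lemma lin1_purer V W U (E : V -> W) (u : U) : lin1 E -> lin1 (fun x => u ⊗ E x).
Proof. by move=> El a x y; rewrite El linearPr. Qed.

Lemma lin1_sw_arg V W U X (E : X -> V ⊗ W) (F : V -> W -> U) :
  lin2 F -> lin1 E -> lin1 (fun x => \sw_(a, b <- E x) F a b).
Proof. by move=> F2 El c x y; rewrite El sw_lin1. Qed.

Lemma lin1_sw_body V W U X z (F : X -> V -> W -> U) :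
  (forall a b, lin1 (fun x => F x a b)) -> lin1 (fun x => \sw_(a, b <- z) F x a b).
Proof.
move=> Fl c x y; rewrite /tlift /teval scaler_sumr -big_split /=.
by apply: eq_bigr => p _; rewrite Fl.
Qed.

Lemma lin1_scalel V W (E : V -> k^o) (w : W) : lin1 E -> lin1 (fun x => E x *: w).
Proof. by move=> El a x y; rewrite El scalerDl scalerA. Qed.

Lemma lin1_scaler V W c (E : V -> W) : lin1 E -> lin1 (fun x => c *: E x).
Proof. by move=> El a x y; rewrite El scalerDr !scalerA mulrC. Qed.

Lemma lin1_mull V (A : algType k) (E : V -> A) (b : A) :
  lin1 E -> lin1 (fun x => E x * b).
Proof. by move=> El a x y; rewrite El mulrDl scalerAl. Qed.

Lemma lin1_mulr V (A : algType k) (E : V -> A) (b : A) :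
  lin1 E -> lin1 (fun x => b * E x).
Proof. by move=> El a x y; rewrite El mulrDr scalerAr. Qed.

Lemma lin1_hyp V W U (F : V -> W) (E : U -> V) : lin1 F -> lin1 E -> lin1 (fun x => F (E x)).
Proof. by move=> Fl El a x y; rewrite El Fl. Qed.

End Multilinear.

Ltac lin_app :=
  match goal with
  | |- lin1 (fun x => ?f x) => exact: lin1_can
  | |- lin1 (fun x => ?f (@?E x)) => apply: (@lin1_app _ _ _ _ _ E)
  | |- lin1 ?f => exact: lin1_can
  end.
(** Decomposes the goal along the head symbol of the function. The cases with [H : _] deal with
    functions that are multilinear by hypothesis, abstracting one argument at a time. *)
Ltac lin_step :=
  match goal with
  | |- lin5 _ => split => [? ? ? ?|? ? ? ?|? ? ? ?|? ? ? ?|? ? ? ?]; cbv beta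
  | |- lin4 _ => split => [? ? ?|? ? ?|? ? ?|? ? ?]; cbv beta
  | |- lin3 _ => split => [? ?|? ?|? ?]; cbv beta
  | |- lin2 _ => split => [?|?]; cbv beta
  | |- lin1 _ => first [ assumption | match goal with
    | |- lin1 (fun x => x) => exact: lin1_id
    | |- lin1 (fun x => @pure _ _ _ (@?E x) ?u) => apply: lin1_purel
    | |- lin1 (fun x => @pure _ _ _ ?u (@?E x)) => apply: lin1_purer
    | |- lin1 (fun x => (@?E x) * ?u) => apply: lin1_mull
    | |- lin1 (fun x => ?u * (@?E x)) => apply: lin1_mulr
    | |- lin1 (fun x => ?u *: (@?E x)) => apply: lin1_scaler
    | |- lin1 (fun x => (@?E x) *: ?u) => apply: lin1_scalel
    | |- lin1 (fun x => @tlift _ _ _ _ (@?F x) ?z) => apply: lin1_sw_body => ? ?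
    | |- lin1 (fun x => @tlift _ _ _ _ ?F (@?E x)) => apply: lin1_sw_arg
    | |- lin1 (@pure _ _ _ ?u) => exact: (lin1_purer u (@lin1_id _ _))
    | |- lin1 ( *%R ?u) => exact: (lin1_mulr u (@lin1_id _ _))
    | |- lin1 ( *:%R ?u) => exact: (lin1_scaler u (@lin1_id _ _))
    | |- lin1 (tlift _) => apply: sw_lin1
    | H : _ |- _ => solve [apply H]
    | H : _ |- lin1 (fun x => ?F (@?E x)) => apply: (@lin1_hyp _ _ _ _ F E); [solve [apply H] |]
    | H : _ |- lin1 (fun x => ?F (@?E x) ?b) =>
        apply: (@lin1_hyp _ _ _ _ (fun a => F a b) E); [solve [apply H] |]
    | H : _ |- lin1 (fun x => ?F (@?E x) ?b ?c) =>
        apply: (@lin1_hyp _ _ _ _ (fun a => F a b c) E); [solve [apply H] |]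
    | H : _ |- lin1 (fun x => ?F (@?E x) ?b ?c ?d) =>
        apply: (@lin1_hyp _ _ _ _ (fun a => F a b c d) E); [solve [apply H] |]
    | H : _ |- lin1 (fun x => ?F (@?E x) ?b ?c ?d ?e) =>
        apply: (@lin1_hyp _ _ _ _ (fun a => F a b c d e) E); [solve [apply H] |]
    | _ => lin_app
    end ]
  end.
Ltac lin_hyps :=
  repeat match goal with
  | H : lin5 _ |- _ => case: (H) => ? ? ? ? ?; clear H
  | H : lin4 _ |- _ => case: (H) => ? ? ? ?; clear H
  | H : lin3 _ |- _ => case: (H) => ? ? ?; clear H
  | H : lin2 _ |- _ => case: (H) => ? ?; clear H
  end.
Ltac lin := solve [lin_hyps; repeat lin_step].
#[export] Hint Extern 0 (lin1 _) => lin : core.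
#[export] Hint Extern 0 (lin2 _) => lin : core.
#[export] Hint Extern 0 (lin3 _) => lin : core.
#[export] Hint Extern 0 (lin4 _) => lin : core.

(** Tries [tac] on the goal and, if it fails, goes under the outermost sum of the left-hand side and
    tries again. There the right-hand side is an existential variable filled in by [reflexivity], so
    below the top level only the left-hand side is rewritten. *)
Ltac deep tac := first
  [ tac
  | etransitivity; [apply: eq_sw; intros ? ?; deep tac; reflexivity |]; cbv beta ].

(** * Tensor products as iterated sums, exactness over a field, lifting of morphisms *)

Section Structural.
Variable k : fieldType.
Implicit Types V W U X P : lmodType k.

Lemma tmap_sw V W V' W' (f : V -> V') (g : W -> W') (z : V ⊗ W) :
  tmap f g z = \sw_(a, b <- z) f a ⊗ g b.
Proof. by []. Qed.

Lemma tmap_pure V W V' W' (f : V -> V') (g : W -> W') a b :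
  lin1 f -> lin1 g -> tmap f g (a ⊗ b) = f a ⊗ g b.
Proof. by move=> fl gl; rewrite tmap_sw sw_pure //; lin. Qed.

Lemma tmap_swr V W V' W' X P (f : V -> V') (g : W -> W') (F : X -> P -> V ⊗ W) z :
  lin1 (f ⊠ g) -> (f ⊠ g) (\sw_(a, b <- z) F a b) = \sw_(a, b <- z) (f ⊠ g) (F a b).
Proof. exact: lin1_sw. Qed.

Lemma tmul_sw (A B : algType k) (u v : A ⊗ B) :
  u * v = \sw_(a, b <- u) \sw_(c, d <- v) (a * c) ⊗ (b * d).
Proof. by []. Qed.

Lemma tmult_sw (A : algType k) (u : A ⊗ A) : tmult u = \sw_(a, b <- u) a * b.
Proof. by []. Qed.

Lemma tassoc_sw V W U (z : V ⊗ W ⊗ U) :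
  tassoc z = \sw_(x, c <- z) \sw_(a, b <- x) a ⊗ (b ⊗ c).
Proof. by []. Qed.

Lemma tassocI_sw V W U (z : V ⊗ (W ⊗ U)) :
  tassocI z = \sw_(a, y <- z) \sw_(b, c <- y) a ⊗ b ⊗ c.
Proof. by []. Qed.

Lemma tswap_sw V W (z : V ⊗ W) : tswap z = \sw_(a, b <- z) b ⊗ a.
Proof. by []. Qed.

Lemma lin1_sw3 V W U X (f : V ⊗ W ⊗ U -> X) z : lin1 f ->
  f z = \sw_(x, c <- z) \sw_(a, b <- x) f (a ⊗ b ⊗ c).
Proof.
move=> fl; rewrite -{1}(sw_id z) lin1_sw //; apply: eq_sw => x c.
by rewrite -{1}(sw_id x) (lin1_sw (f := fun x => f (x ⊗ c)))//; lin.
Qed.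

Lemma tswap13_sw V W U (z : V ⊗ W ⊗ U) :
  tswap13 z = \sw_(u, c <- z) \sw_(a, b <- u) c ⊗ b ⊗ a.
Proof.
rewrite (lin1_sw3 (f := @tswap13 k V W U)) //.
by do !apply: eq_sw => ? ?; rewrite tswap13E.
Qed.

Lemma tswap23_sw V W U (z : V ⊗ W ⊗ U) :
  tswap23 z = \sw_(u, c <- z) \sw_(a, b <- u) a ⊗ c ⊗ b.
Proof.
rewrite (lin1_sw3 (f := @tswap23 k V W U)) //.
by do !apply: eq_sw => ? ?; rewrite tswap23E.
Qed.

Lemma tflat3_sw V W U X (z : X ⊗ (V ⊗ W ⊗ U)) :
  tflat3 z = \sw_(x, u <- z) \sw_(v, c <- u) \sw_(a, b <- v) x ⊗ a ⊗ b ⊗ c.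
Proof.
rewrite -{1}(sw_id z) (lin1_sw _ _ (f := @tflat3 k X V W U)) //.
apply: eq_sw => x u; rewrite (lin1_sw3 (f := fun u => tflat3 (x ⊗ u))) //.
by do !apply: eq_sw => ? ?; rewrite tflat3E.
Qed.

Lemma sw_purel V W U X (F : V -> W -> U) (z : V ⊗ W) (x : X) :
  (\sw_(a, b <- z) F a b) ⊗ x = \sw_(a, b <- z) F a b ⊗ x.
Proof. by rewrite (lin1_sw _ _ (f := fun t => t ⊗ x)) //. Qed.

Lemma sw_purer V W U X (F : V -> W -> U) (z : V ⊗ W) (x : X) :
  x ⊗ (\sw_(a, b <- z) F a b) = \sw_(a, b <- z) x ⊗ F a b.
Proof. by rewrite (lin1_sw _ _ (f := fun t => x ⊗ t)) //. Qed.

Lemma pure0l V W (w : W) : (0 : V) ⊗ w = 0.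
Proof. exact: linear0l. Qed.

Lemma pure0r V W (v : V) : v ⊗ (0 : W) = 0.
Proof. exact: linear0r. Qed.

(** Elimination on the length of the sum. If some [f p.1] is nonzero, choose a form [phi] with
    [phi (f p.1) = 1] and subtract [phi (f q.1) *: p.1] from every [q.1]. The total correction is
    [p.1] tensored with a contraction of [(f ⊠ idfun) x], hence zero, and the term of [p] itself
    disappears. *)
Lemma tens_ker V W U (f : {linear V -> W}) (x : V ⊗ U) : (f ⊠ idfun) x = 0 ->
  exists2 s : seq (V * U), x = \sum_(p <- s) p.1 ⊗ p.2 & {in s, forall p, f p.1 = 0}.
Proof.
suff H n (s : seq (V * U)) : size s = n -> (f ⊠ idfun) (\sum_(p <- s) p.1 ⊗ p.2) = 0 ->
    exists2 t : seq (V * U), \sum_(p <- s) p.1 ⊗ p.2 = \sum_(p <- t) p.1 ⊗ p.2 &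
      {in t, forall p, f p.1 = 0}.
  by rewrite (tens_sum x) => /H; apply.
elim: n s => [|n IH] s; first by move=> /size0nil -> _; exists [::].
move=> sn fs0; have [alls|] := EM {in s, forall p, f p.1 = 0}; first by exists s.
move=> nalls.
have [p ps fp] : exists2 p, p \in s & f p.1 != 0.
  apply: contrapT => nex; apply: nalls => p ps; apply/eqP/negP => /negP fp.
  by apply: nex; exists p.
have [phi phip] := separating_form fp.
pose t := [seq (q.1 - phi (f q.1) *: p.1, q.2) | q <- rem p s].
have tn : size t = n by rewrite size_map size_rem // sn.
have E : \sum_(q <- s) phi (f q.1) *: q.2 = 0.
  transitivity (tcontrl phi ((f ⊠ idfun) (\sum_(p <- s) p.1 ⊗ p.2))).
    rewrite (lin1_sum _ _ (f := f ⊠ idfun)); last lin.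
    rewrite (lin1_sum _ _ (f := tcontrl phi)); last lin.
    by apply: eq_bigr => q _; rewrite tmapE /tcontrl tlift_pure.
  by rewrite fs0 linear0.
have st : \sum_(q <- s) q.1 ⊗ q.2 = \sum_(q <- t) q.1 ⊗ q.2.
  rewrite big_map /=.
  have -> : \sum_(q <- rem p s) ((q.1 - phi (f q.1) *: p.1) ⊗ q.2) =
      \sum_(q <- s) ((q.1 - phi (f q.1) *: p.1) ⊗ q.2).
    by rewrite [RHS](perm_big _ (perm_to_rem ps)) big_cons phip scale1r subrr pure0l Monoid.mul1m.
  transitivity (\sum_(q <- s) q.1 ⊗ q.2 - p.1 ⊗ (\sum_(q <- s) phi (f q.1) *: q.2)).
    by rewrite E pure0r subr0.
  rewrite linear_sumr -sumrB; apply: eq_bigr => q _.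
  by rewrite linearBl linearZl_LR linearZr_LR.
by move: fs0; rewrite st => /(IH _ tn).
Qed.

Lemma tens_kerr V W U (f : {linear V -> W}) (x : U ⊗ V) : (idfun ⊠ f) x = 0 ->
  exists2 s : seq (U * V), x = \sum_(p <- s) p.1 ⊗ p.2 & {in s, forall p, f p.2 = 0}.
Proof.
move=> fx; have /tens_ker[s xs fs] : (f ⊠ idfun) (tswap x) = 0.
  rewrite -(linear0 (@tswap k _ _)) -fx.
  elim/tens_ind: {fx} x => [a b|x y hx hy]; last by rewrite !linearD /= hx hy.
  by rewrite tswapE !tmapE; apply/esym/tswapE.
exists [seq (q.2, q.1) | q <- s]; last first.
  by move=> _ /mapP[q qs ->]; exact: fs.
rewrite big_map.
have <- : tswap (tswap x) = x.
  elim/tens_ind: {fx xs} x => [a b|x y hx hy]; last by rewrite !linearD /= hx hy.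
  by rewrite !tswapE.
rewrite xs (lin1_sum _ _ (f := @tswap k V U)); last lin.
by apply: eq_bigr => p _; apply: tswapE.
Qed.

Lemma tmap_injl V W U (f : {linear V -> W}) :
  injective f -> injective (f ⊠ (idfun : U -> U)).
Proof.
move=> finj; apply: raddf_inj => x /tens_ker[s -> fs].
rewrite big_seq big1 // => p /fs; rewrite -(linear0 f) => /finj ->.
by rewrite pure0l.
Qed.

Lemma tmap_injr V W U (f : {linear V -> W}) :
  injective f -> injective ((idfun : U -> U) ⊠ f).
Proof.
move=> finj; apply: raddf_inj => x /tens_kerr[s -> fs].
rewrite big_seq big1 // => p /fs; rewrite -(linear0 f) => /finj ->.
by rewrite pure0r.
Qed.

Lemma tmap_comp V W U V' W' U' (f : {linear W -> U}) (g : {linear V -> W})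
    (f' : {linear W' -> U'}) (g' : {linear V' -> W'}) z :
  (f ⊠ f') ((g ⊠ g') z) = ((f \o g) ⊠ (f' \o g')) z.
Proof.
by rewrite !tmap_sw sw_sw; last lin; apply: eq_sw => a b; rewrite sw_pure //; lin.
Qed.

Lemma tmap_inj V W V' W' (f : {linear V -> W}) (g : {linear V' -> W'}) :
  injective f -> injective g -> injective (f ⊠ g).
Proof.
move=> fi gi x y.
have E z : (f ⊠ g) z = (f ⊠ idfun) ((idfun ⊠ g) z) by rewrite tmap_comp.
by rewrite !E => /(tmap_injl fi)/(tmap_injr gi).
Qed.

(* Over a field, tensoring with U preserves equalizers. *)
Lemma tens_equalizerl V W P U (f g : {linear V -> W}) (v : {linear P -> V}) (z : V ⊗ U) :
  (forall e, f e = g e -> exists p, v p = e) ->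
  (f ⊠ idfun) z = (g ⊠ idfun) z -> exists w, (v ⊠ idfun) w = z.
Proof.
move=> ex fg.
have : ((f \- g) ⊠ idfun) z = 0.
  transitivity ((f ⊠ idfun) z - (g ⊠ idfun) z); last by rewrite fg subrr.
  rewrite !tmap_sw /tlift /teval -sumrB; apply: eq_bigr => p _.
  by rewrite /= linearBl.
move=> /tens_ker[s -> hs]; elim: s hs => [|[a u] s IH] hs.
  by exists 0; rewrite linear0 big_nil.
have [|w hw] := IH; first by move=> p ps; apply: hs; rewrite inE ps orbT.
have [p pa] := ex a (subr0_eq (hs (a, u) (mem_head _ _))).
by exists (p ⊗ u + w); rewrite linearD /= hw tmapE big_cons pa.
Qed.

Lemma tens_equalizerr V W P U (f g : {linear V -> W}) (v : {linear P -> V}) (z : U ⊗ V) :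
  (forall e, f e = g e -> exists p, v p = e) ->
  (idfun ⊠ f) z = (idfun ⊠ g) z -> exists w, (idfun ⊠ v) w = z.
Proof.
move=> ex fg.
have : (idfun ⊠ (f \- g)) z = 0.
  transitivity ((idfun ⊠ f) z - (idfun ⊠ g) z); last by rewrite fg subrr.
  rewrite !tmap_sw /tlift /teval -sumrB; apply: eq_bigr => p _.
  by rewrite /= linearBr.
move=> /tens_kerr[s -> hs]; elim: s hs => [|[u a] s IH] hs.
  by exists 0; rewrite linear0 big_nil.
have [|w hw] := IH; first by move=> p ps; apply: hs; rewrite inE ps orbT.
have [p pa] := ex a (subr0_eq (hs (u, a) (mem_head _ _))).
by exists (u ⊗ p + w); rewrite linearD /= hw tmapE big_cons pa.
Qed.

(** Once the left slot is lifted, injectivity of [v] cancels it from the equation on the right slot,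
    which can then be lifted too. *)
Lemma tens_equalizer2 V W P (f g : {linear V -> W}) (v : {linear P -> V}) (z : V ⊗ V) :
  injective v -> (forall e, f e = g e -> exists p, v p = e) ->
  (f ⊠ idfun) z = (g ⊠ idfun) z -> (idfun ⊠ f) z = (idfun ⊠ g) z ->
  exists w, (v ⊠ v) w = z.
Proof.
move=> vi ex fgl fgr; have [w1 E1] := tens_equalizerl ex fgl.
have [|w E] := @tens_equalizerr _ _ _ _ f g v w1 ex.
  by apply: (tmap_injl vi); move: fgr; rewrite -E1 !tmap_comp.
by exists w; rewrite -E1 -E tmap_comp.
Qed.

(** Choice gives a lift of each value; injectivity of [i] makes it unique, hence linear in the
    argument. *)
Lemma linear_lift V W P (i : {linear P -> W}) (f : {linear V -> W}) :
  injective i -> (forall a, exists z, i z = f a) ->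
  exists g : {linear V -> P}, forall a, i (g a) = f a.
Proof.
move=> ii ex; pose g a := projT1 (cid (ex a)).
have gE a : i (g a) = f a by rewrite /g; case: cid.
have gl : linear g by move=> c x y; apply: ii; rewrite linearP !gE linearP.
pose m := GRing.isLinear.Build k V P _ g gl.
by exists (HB.pack g m : {linear V -> P}).
Qed.

Lemma lrmorphism_lift (A B Z : algType k) (i : {lrmorphism Z -> B}) (f : {lrmorphism A -> B}) :
  injective i -> (forall a, exists z, i z = f a) ->
  exists g : {lrmorphism A -> Z}, forall a, i (g a) = f a.
Proof.
move=> ii ex; have [g gE] := linear_lift ii ex.
have gm : monoid_morphism g.
  by split=> [|x y]; apply: ii; rewrite gE ?rmorph1 // !rmorphM /= !gE.
pose m := GRing.isMonoidMorphism.Build A Z g gm.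
by exists (HB.pack_for {lrmorphism A -> Z} (g : A -> Z) g m).
Qed.

(** Each embedding lifts through the other, and injectivity makes the two lifts mutually inverse.
    The maps [il], [ir] and theta, and the isomorphisms for the unit, the inverse and associativity,
    all arise from two embeddings into one ambient algebra with the same image. *)
Lemma lrmorphism_iso (A B E : algType k) (u : {lrmorphism A -> E}) (v : {lrmorphism B -> E}) :
  injective u -> injective v ->
  (forall a, exists b, v b = u a) -> (forall b, exists a, u a = v b) ->
  exists2 f : {lrmorphism A -> B}, bijective f & forall a, v (f a) = u a.
Proof.
move=> ui vi uv vu; have [f fE] := lrmorphism_lift vi uv.
have [g gE] := lrmorphism_lift ui vu.
exists f => //; exists g => x; first by apply: ui; rewrite gE fE.
by apply: vi; rewrite fE gE.
Qed.

End Structural.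

Lemma comp_app (A B C : Type) (f : B -> C) (g : A -> B) x : (f \o g) x = f (g x).
Proof. by []. Qed.

Ltac sw_unf := rewrite ?(tmap_sw, tassoc_sw, tassocI_sw, tswap_sw, tmult_sw,
  tswap13_sw, tswap23_sw, tflat3_sw, comp_app).
(** Flattens nested structural maps into iterated sums and strips the sums common to both sides.
    Sums that occur in a different order are left to [sw_exch]. *)
Ltac sw_step := first
  [ reflexivity
  | progress sw_unf
  | rewrite sw_sw; [|lin]
  | rewrite sw_pure; [|lin]
  | rewrite sw_purel
  | rewrite sw_purer
  | apply: eq_sw; intros ? ?; cbv beta ].
Ltac sw := repeat sw_step.

Section Products.
Variables (k : fieldType) (A B : algType k) (U : lmodType k).

Lemma sw_mul (F : A -> B -> U) (u v : A ⊗ B) : lin2 F ->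
  \sw_(a, b <- u * v) F a b =
  \sw_(a, b <- u) \sw_(c, d <- v) F (a * c) (b * d).
Proof. by move=> F2; rewrite tmul_sw; sw. Qed.

Lemma mul_purel (a : A) (b : B) z : a ⊗ b * z = \sw_(c, d <- z) (a * c) ⊗ (b * d).
Proof. by rewrite tmul_sw sw_pure. Qed.

Lemma sw_one (F : A -> B -> U) : lin2 F -> \sw_(a, b <- 1) F a b = F 1 1.
Proof. by move=> F2; exact: sw_pure. Qed.

Lemma sw_scale (V W : lmodType k) c (F : V -> W -> U) (z : V ⊗ W) :
  \sw_(a, b <- z) c *: F a b = c *: \sw_(a, b <- z) F a b.
Proof. by rewrite -(lin1_sw F z (f := fun u => c *: u)) //; lin. Qed.

End Products.

(** * Antipodes *)

Section HopfAlgebra.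
Variables (k : fieldType) (H : algType k) (hH : hopf H).
Local Notation D := (comul hH).
Local Notation e := (counit hH).
Local Notation S := (antipode hH).

Section Sweedler.
Variables (U : lmodType k).

Lemma sw_comulA (F : H -> H -> H -> U) x : lin3 F ->
  \sw_(a, b <- D x) \sw_(c, d <- D a) F c d b =
  \sw_(a, b <- D x) \sw_(c, d <- D b) F a c d.
Proof.
move=> F3; have := congr1 (fun t => \sw_(a, y <- t) \sw_(c, d <- y) F a c d) (comulA hH x).
by move=> E; transitivity (\sw_(a, y <- tassoc ((D ⊠ idfun) (D x))) \sw_(c, d <- y) F a c d);
  [sw | rewrite E; sw].
Qed.

Lemma sw_counitl (F : H -> U) x : lin1 F -> \sw_(a, b <- D x) e a *: F b = F x.
Proof.
move=> F1; rewrite -{2}(counitl hH x) /tcontrl (lin1_sw _ _ (f := F)) //.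
by apply: eq_sw => a b; rewrite lin1_scale.
Qed.

Lemma sw_counitr (F : H -> U) x : lin1 F -> \sw_(a, b <- D x) e b *: F a = F x.
Proof.
move=> F1; rewrite -{2}(counitr hH x) /tcontrr (lin1_sw _ _ (f := F)) //.
by apply: eq_sw => a b; rewrite lin1_scale.
Qed.

Lemma sw_antipodel (F : H -> U) x : lin1 F -> \sw_(a, b <- D x) F (S a * b) = e x *: F 1.
Proof.
move=> F1; transitivity (F (tmult ((S ⊠ idfun) (D x)))).
  by sw_unf; rewrite (lin1_sw _ _ (f := F)) //; sw.
by rewrite antipodel lin1_scale.
Qed.

Lemma sw_antipoder (F : H -> U) x : lin1 F -> \sw_(a, b <- D x) F (a * S b) = e x *: F 1.
Proof.
move=> F1; transitivity (F (tmult ((idfun ⊠ S) (D x)))).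
  by sw_unf; rewrite (lin1_sw _ _ (f := F)) //; sw.
by rewrite antipoder lin1_scale.
Qed.

End Sweedler.

Lemma counit_mul x y : e (x * y) = e x *: e y.
Proof. exact: rmorphM. Qed.

(** [S (x * y)] and [S y * S x] are both convolution inverses of the multiplication, seen as a map
    on [H ⊗ H]. The intermediate sum is their threefold convolution with the multiplication in the
    middle: contracting its left half leaves the former, contracting its right half leaves the
    latter. *)
Lemma antipodeM x y : S (x * y) = S y * S x.
Proof.
transitivity (\sw_(a, b <- D x) \sw_(b1, b2 <- D b) \sw_(c, d <- D y) \sw_(d1, d2 <- D d)
                (S c * S a * (b1 * d1)) * S (b2 * d2)).
  rewrite -(sw_comulA _ (F := fun a b1 b2 => \sw_(c, d <- D y) \sw_(d1, d2 <- D d)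
                (S c * S a * (b1 * d1)) * S (b2 * d2))) //.
  apply: esym.
  deep ltac:(rewrite -sw_comulA; last lin).
  deep ltac:(rewrite sw_exch).
  transitivity (\sw_(a, b <- D x) \sw_(a0, b0 <- D y) \sw_(c, d <- D a0)
     e a *: (S c * d * S (b * b0))).
    apply: eq_sw => a b; apply: eq_sw => a0 b0.
    rewrite sw_exch; apply: eq_sw => c d.
    transitivity (\sw_(c0, d0 <- D a) S c * (S c0 * d0) * d * S (b * b0)).
      by apply: eq_sw => c0 d0; rewrite !mulrA.
    rewrite (sw_antipodel _ (F := fun t => S c * t * d * S (b * b0))) //.
    by rewrite mulr1.
  transitivity (\sw_(a, b <- D x) \sw_(a0, b0 <- D y) e a *: (e a0 *: S (b * b0))).
    apply: eq_sw => a b; apply: eq_sw => a0 b0; rewrite sw_scale.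
    rewrite (sw_antipodel _ (F := fun t => t * S (b * b0))) //.
    by rewrite mul1r.
  deep ltac:(rewrite sw_scale).
  deep ltac:(rewrite sw_counitl; last lin).
  by rewrite sw_counitl.
transitivity (\sw_(a, b <- D x) \sw_(c, d <- D y) e b *: (e d *: (S c * S a))); last first.
  deep ltac:(rewrite sw_scale).
  deep ltac:(rewrite (sw_counitr _ (F := fun c => S c * S _)); last lin).
  by rewrite (sw_counitr _ (F := fun a => S y * S a)).
apply: eq_sw => a b; rewrite sw_exch; apply: eq_sw => c d.
rewrite scalerA; transitivity (\sw_(u, v <- D (b * d)) (S c * S a) * (u * S v)).
  rewrite rmorphM sw_mul //.
  by apply: eq_sw => b1 b2; apply: eq_sw => d1 d2; rewrite !mulrA.
rewrite (sw_antipoder _ (F := fun t => S c * S a * t)) //.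
by rewrite counit_mul mulr1.
Qed.

Lemma counit_mulC x y : e (x * y) = e y *: e x.
Proof. by rewrite rmorphM; exact: mulrC. Qed.

Lemma antipode1 : S 1 = 1.
Proof.
have := sw_antipodel 1 (@lin1_id k H); rewrite rmorph1 sw_one //.
by rewrite mulr1 (rmorph1 e) scale1r.
Qed.

Lemma counit_antipode x : e (S x) = e x.
Proof.
have : \sw_(a, b <- D x) e (S a * b) = e x *: (e 1 : k^o).
  by rewrite (sw_antipodel _ (F := fun t => e t : k^o)).
under eq_sw => a b do rewrite counit_mulC.
rewrite (sw_counitr x (F := fun a => e (S a))) //.
by rewrite rmorph1 => ->; exact: mulr1.
Qed.

Let N x : H ⊗ H := \sw_(a, b <- D x) S b ⊗ S a.

Lemma flip_antipode_comul x : \sw_(a, b <- D x) N a * D b = (e x : k) *: (1 : (H ⊗ H)%type).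
Proof.
transitivity (\sw_(a, b <- D x) \sw_(c, d <- D a) (S d ⊗ S c) * D b).
  by apply: eq_sw => a b; rewrite (lin1_sw _ _ (f := fun t => t * D b)) //.
rewrite sw_comulA //.
transitivity (\sw_(a, b <- D x) \sw_(c, d <- D b) \sw_(p, q <- D d) (S c * p) ⊗ (S a * q)).
  apply: eq_sw => a b; apply: eq_sw => c d.
  exact: mul_purel.
deep ltac:(rewrite -(sw_comulA _ (F := fun c p q => (S c * p) ⊗ (S _ * q))); last lin).
deep ltac:(rewrite (sw_antipodel _ (F := fun t => t ⊗ (S _ * _))); last lin).
deep ltac:(rewrite (sw_counitl _ (F := fun t => 1 ⊗ (S _ * t))); last lin).
by rewrite (sw_antipodel _ (F := fun t => 1 ⊗ t)).
Qed.

(** [N] is a left and [D \o S] a right convolution inverse of [D : H -> H ⊗ H], so they agree; the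
    middle term is the convolution of [N], [D] and [D \o S]. *)
Lemma comul_antipode x : D (S x) = \sw_(a, b <- D x) S b ⊗ S a.
Proof.
transitivity (\sw_(a, b <- D x) \sw_(c, d <- D b) N a * D c * D (S d)).
  rewrite -(sw_comulA _ (F := fun a c d => N a * D c * D (S d))); last by rewrite /N; lin.
  apply: esym; transitivity (\sw_(a, b <- D x) ((e a : k) *: (1 : (H ⊗ H)%type)) * D (S b)).
    apply: eq_sw => a b; rewrite -flip_antipode_comul.
    by rewrite (lin1_sw _ _ (f := fun t => t * D (S b))).
  deep ltac:(rewrite -scalerAl mul1r).
  by rewrite (sw_counitl _ (F := fun b => D (S b))).
transitivity (\sw_(a, b <- D x) (e b : k) *: N a).
  apply: eq_sw => a b; transitivity (N a * D (\sw_(c, d <- D b) c * S d)).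
    rewrite (lin1_sw _ _ (f := fun t => N a * D t)) //.
    by apply: eq_sw => c d; rewrite rmorphM mulrA.
  rewrite (sw_antipoder _ (@lin1_id _ _)).
  by rewrite linearZ rmorph1 -scalerAr mulr1.
by rewrite sw_counitr //; rewrite /N; lin.
Qed.

Lemma sw_comul_antipode (U : lmodType k) (F : H -> H -> U) x : lin2 F ->
  \sw_(a, b <- D (S x)) F a b = \sw_(a, b <- D x) F (S b) (S a).
Proof. by move=> F2; rewrite comul_antipode; sw. Qed.

(** [S] is injective because [S \o S] is, and [S \o g] is a right inverse of it, hence a two-sided
    one. *)
Lemma antipode_bij : bijective (S \o S) -> bijective S.
Proof.
case=> g gK Kg; have Si : injective S by move=> x y xy; apply: (can_inj gK) => /=; rewrite xy.
by exists (S \o g) => x; last exact: Kg; apply: Si; apply: Kg.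
Qed.

Lemma antipode_inv : bijective (S \o S) ->
  exists Si : {linear H -> H}, cancel S Si /\ cancel Si S.
Proof.
move=> /antipode_bij[g gK Kg].
pose m := GRing.isLinear.Build k H H _ g (can2_linear gK Kg).
by exists (HB.pack_for {linear H -> H} g m).
Qed.

Section AntipodeInverse.
Variables (Si : {linear H -> H}) (SK : cancel S Si) (SiK : cancel Si S).

Lemma antipodeVM x y : Si (x * y) = Si y * Si x.
Proof. by apply: (can_inj SK); rewrite antipodeM !SiK. Qed.

Lemma antipodeV1 : Si 1 = 1.
Proof. by apply: (can_inj SK); rewrite SiK antipode1. Qed.

Lemma counit_antipodeV x : e (Si x) = e x.
Proof. by rewrite -counit_antipode SiK. Qed.

Lemma sw_comul_antipodeV (U : lmodType k) (F : H -> H -> U) x : lin2 F ->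
  \sw_(a, b <- D (Si x)) F a b = \sw_(a, b <- D x) F (Si b) (Si a).
Proof.
move=> F2; rewrite -{2}[x]SiK (sw_comul_antipode _ (F := fun a b => F (Si b) (Si a))) //.
by apply: eq_sw => a b; rewrite !SK.
Qed.

End AntipodeInverse.
End HopfAlgebra.

(** Proves an equation of sums from an equation [E] whose sides normalise to those of the goal; [E]
    is a tensor identity to which a multilinear expression has been applied. *)
Ltac sw_from E :=
  match type of E with
  | ?l = ?r => refine (etrans (y := l) _ (etrans E _)); cbv beta; sw
  end.

(** Over a field a tensor of nonzero vectors is nonzero. An equation in [V] can thus be proved after
    adding a unit factor, which gives room for further legs. *)
Lemma pure1_inj (k : fieldType) (V : lmodType k) (A : algType k) :
  injective (pure (1 : A) : V -> A ⊗ V).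
Proof.
move=> x y; apply: contra_eq => xy; rewrite -subr_eq0 -linearBr.
by apply: pure_neq0; rewrite ?oner_neq0 // subr_eq0.
Qed.

Lemma pure1r_inj (k : fieldType) (V : lmodType k) (A : algType k) :
  injective (fun v : V => v ⊗ (1 : A)).
Proof.
move=> x y; apply: contra_eq => xy; rewrite -subr_eq0 -linearBl.
by apply: pure_neq0; rewrite ?oner_neq0 // subr_eq0.
Qed.

(** * Bi-Galois algebras *)

Section BiGalois.
Variables (k : fieldType) (H : algType k) (hH : hopf H).
Local Notation D := (comul hH).
Local Notation e := (counit hH).
Local Notation S := (antipode hH).

(* An H-bicomodule algebra T, with coactions lam and rho, that is Galois on both
   sides: del h and gam h are the preimages of h ⊗ 1 and 1 ⊗ h under the Galois
   maps a ⊗ b |-> lam a * (1 ⊗ b) and a ⊗ b |-> (a ⊗ 1) * rho b. *)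
Record bigal (T : algType k) := Bigal {
  lam : {lrmorphism T -> H ⊗ T};
  rho : {lrmorphism T -> T ⊗ H};
  del : {linear H -> (T ⊗ T)%type};
  gam : {linear H -> (T ⊗ T)%type};
  lamA : forall x, \sw_(h, y <- lam x) \sw_(a, b <- D h) a ⊗ b ⊗ y =
                   \sw_(h, y <- lam x) \sw_(g, z <- lam y) h ⊗ g ⊗ z;
  lam1 : forall x, \sw_(h, y <- lam x) e h *: y = x;
  rhoA : forall x, \sw_(y, h <- rho x) \sw_(a, b <- D h) y ⊗ a ⊗ b =
                   \sw_(y, h <- rho x) \sw_(z, g <- rho y) z ⊗ g ⊗ h;
  rho1 : forall x, \sw_(y, h <- rho x) e h *: y = x;
  lamrho : forall x, \sw_(y, h <- rho x) \sw_(g, z <- lam y) g ⊗ z ⊗ h =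
                     \sw_(g, y <- lam x) \sw_(z, h <- rho y) g ⊗ z ⊗ h;
  gall : forall h, \sw_(a, b <- del h) \sw_(g, c <- lam a) g ⊗ (c * b) = h ⊗ 1;
  gallV : forall x, \sw_(h, y <- lam x) \sw_(a, b <- del h) a ⊗ (b * y) = x ⊗ 1;
  galr : forall h, \sw_(a, b <- gam h) \sw_(c, g <- rho b) (a * c) ⊗ g = 1 ⊗ h;
  galrV : forall x, \sw_(y, h <- rho x) \sw_(a, b <- gam h) (y * a) ⊗ b = 1 ⊗ x }.

Section Theory.
Variables (T : algType k) (B : bigal T) (U : lmodType k).
Local Notation lam := (lam B).
Local Notation rho := (rho B).
Local Notation del := (del B).
Local Notation gam := (gam B).

Lemma sw_lamA (F : H -> H -> T -> U) x : lin3 F ->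
  \sw_(h, y <- lam x) \sw_(a, b <- D h) F a b y =
  \sw_(h, y <- lam x) \sw_(g, z <- lam y) F h g z.
Proof.
by move=> F3; sw_from (congr1 (fun t => \sw_(u, c <- t) \sw_(a, b <- u) F a b c) (lamA B x)).
Qed.

Lemma sw_lam1 (F : T -> U) x : lin1 F -> \sw_(h, y <- lam x) e h *: F y = F x.
Proof.
move=> F1; rewrite -{2}(lam1 B x) (lin1_sw _ _ (f := F)) //.
by apply: eq_sw => a b; rewrite lin1_scale.
Qed.

Lemma sw_rhoA (F : T -> H -> H -> U) x : lin3 F ->
  \sw_(y, h <- rho x) \sw_(a, b <- D h) F y a b =
  \sw_(y, h <- rho x) \sw_(z, g <- rho y) F z g h.
Proof.
by move=> F3; sw_from (congr1 (fun t => \sw_(u, c <- t) \sw_(a, b <- u) F a b c) (rhoA B x)).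
Qed.

Lemma sw_rho1 (F : T -> U) x : lin1 F -> \sw_(y, h <- rho x) e h *: F y = F x.
Proof.
move=> F1; rewrite -{2}(rho1 B x) (lin1_sw _ _ (f := F)) //.
by apply: eq_sw => a b; rewrite lin1_scale.
Qed.

Lemma sw_lamrho (F : H -> T -> H -> U) x : lin3 F ->
  \sw_(y, h <- rho x) \sw_(g, z <- lam y) F g z h =
  \sw_(g, y <- lam x) \sw_(z, h <- rho y) F g z h.
Proof.
by move=> F3; sw_from (congr1 (fun t => \sw_(u, c <- t) \sw_(a, b <- u) F a b c) (lamrho B x)).
Qed.

Lemma sw_gall (F : H -> T -> U) h : lin2 F ->
  \sw_(a, b <- del h) \sw_(g, c <- lam a) F g (c * b) = F h 1.
Proof. by move=> F2; sw_from (congr1 (fun t => \sw_(a, b <- t) F a b) (gall B h)). Qed.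

Lemma sw_gallV (F : T -> T -> U) x : lin2 F ->
  \sw_(h, y <- lam x) \sw_(a, b <- del h) F a (b * y) = F x 1.
Proof. by move=> F2; sw_from (congr1 (fun t => \sw_(a, b <- t) F a b) (gallV B x)). Qed.

Lemma sw_galr (F : T -> H -> U) h : lin2 F ->
  \sw_(a, b <- gam h) \sw_(c, g <- rho b) F (a * c) g = F 1 h.
Proof. by move=> F2; sw_from (congr1 (fun t => \sw_(a, b <- t) F a b) (galr B h)). Qed.

Lemma sw_galrV (F : T -> T -> U) x : lin2 F ->
  \sw_(y, h <- rho x) \sw_(a, b <- gam h) F (y * a) b = F 1 x.
Proof. by move=> F2; sw_from (congr1 (fun t => \sw_(a, b <- t) F a b) (galrV B x)). Qed.

Lemma sw_lamM (F : H -> T -> U) x y : lin2 F ->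
  \sw_(g, c <- lam (x * y)) F g c =
  \sw_(g, c <- lam x) \sw_(h, d <- lam y) F (g * h) (c * d).
Proof. by move=> F2; rewrite rmorphM sw_mul. Qed.

Lemma sw_rhoM (F : T -> H -> U) x y : lin2 F ->
  \sw_(c, g <- rho (x * y)) F c g =
  \sw_(c, g <- rho x) \sw_(d, h <- rho y) F (c * d) (g * h).
Proof. by move=> F2; rewrite rmorphM sw_mul. Qed.

(** Colinearity of the first leg of the translation map. The element [c] is rewritten through a
    second translation by [sw_gallV], coassociativity moves a coproduct onto the outer coefficient,
    and [sw_gall] then removes the original translation. *)
Lemma sw_del_lam (F : H -> T -> T -> U) h : lin3 F ->
  \sw_(a, b <- del h) \sw_(g, c <- lam a) F g c b =
  \sw_(h1, h2 <- D h) \sw_(a, b <- del h2) F h1 a b.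
Proof.
move=> F3.
transitivity (\sw_(a, b <- del h) \sw_(g, c <- lam a) \sw_(g', c' <- lam c)
    \sw_(p, q <- del g') F g p (q * c' * b)).
  apply: eq_sw => a b; apply: eq_sw => g c.
  by rewrite (sw_gallV _ (F := fun p q => F g p (q * b))) ?mul1r.
transitivity (\sw_(a, b <- del h) \sw_(g, c <- lam a) \sw_(g1, g2 <- D g)
    \sw_(p, q <- del g2) F g1 p (q * (c * b))).
  apply: eq_sw => a b; apply: esym.
  rewrite (sw_lamA _ (F := fun g1 g2 c => \sw_(p, q <- del g2) F g1 p (q * (c * b)))) //.
  by do !apply: eq_sw => ? ?; rewrite -!mulrA.
rewrite (sw_gall _ (F := fun g t => \sw_(g1, g2 <- D g) \sw_(p, q <- del g2) F g1 p (q * t))).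
  by do !apply: eq_sw => ? ?; rewrite mulr1.
by lin.
Qed.

Lemma sw_gam_rho (F : T -> T -> H -> U) h : lin3 F ->
  \sw_(a, b <- gam h) \sw_(c, g <- rho b) F a c g =
  \sw_(h1, h2 <- D h) \sw_(a, b <- gam h1) F a b h2.
Proof.
move=> F3.
transitivity (\sw_(a, b <- gam h) \sw_(c, g <- rho b) \sw_(c', g' <- rho c)
    \sw_(p, q <- gam g') F (a * (c' * p)) q g).
  apply: eq_sw => a b; apply: eq_sw => c g.
  by rewrite (sw_galrV _ (F := fun p q => F (a * p) q g)) ?mulr1.
transitivity (\sw_(a, b <- gam h) \sw_(c, g <- rho b) \sw_(g1, g2 <- D g)
    \sw_(p, q <- gam g1) F (a * c * p) q g2).
  apply: eq_sw => a b; apply: esym.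
  rewrite (sw_rhoA _ (F := fun c g1 g2 => \sw_(p, q <- gam g1) F (a * c * p) q g2)) //.
  by do !apply: eq_sw => ? ?; rewrite -!mulrA.
rewrite (sw_galr _ (F := fun t g => \sw_(g1, g2 <- D g) \sw_(p, q <- gam g1) F (t * p) q g2)).
  by do !apply: eq_sw => ? ?; rewrite mul1r.
by lin.
Qed.

(** Apply the counit to the [H]-factor of [gall]. *)
Lemma sw_del_mult (F : T -> U) h : lin1 F ->
  \sw_(a, b <- del h) F (a * b) = e h *: F 1.
Proof.
move=> F1; rewrite -(sw_gall _ (F := fun g t => e g *: F t)) //.
by apply: eq_sw => a b; rewrite (sw_lam1 _ (F := fun c => F (c * b))) //.
Qed.

Lemma sw_gam_mult (F : T -> U) h : lin1 F ->
  \sw_(a, b <- gam h) F (a * b) = e h *: F 1.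
Proof.
move=> F1; rewrite -(sw_galr _ (F := fun t g => e g *: F t)) //.
by apply: eq_sw => a b; rewrite (sw_rho1 _ (F := fun c => F (a * c))) //.
Qed.

(** Two consecutive translations compose to one: by colinearity the coproduct of [h] becomes the
    coaction on the first leg of a single translation, and [sw_gallV] contracts the other one. *)
Lemma sw_del_insert (F : T -> T -> T -> U) h : lin3 F ->
  \sw_(h1, h2 <- D h) \sw_(a, b <- del h1) \sw_(c, d <- del h2) F a (b * c) d =
  \sw_(a, b <- del h) F a 1 b.
Proof.
move=> F3; deep ltac:(rewrite sw_exch).
rewrite -(sw_del_lam _ (F := fun g c d => \sw_(a, b <- del g) F a (b * c) d)) //.
by apply: eq_sw => c d; rewrite (sw_gallV _ (F := fun p q => F p q d)) //.
Qed.

Lemma sw_gam_insert (F : T -> T -> T -> U) h : lin3 F ->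
  \sw_(h1, h2 <- D h) \sw_(a, b <- gam h1) \sw_(c, d <- gam h2) F a (b * c) d =
  \sw_(a, b <- gam h) F a 1 b.
Proof.
move=> F3.
rewrite -(sw_gam_rho _ (F := fun a c g => \sw_(p, q <- gam g) F a (c * p) q)) //.
by apply: eq_sw => c d; rewrite (sw_galrV _ (F := fun p q => F c p q)) //.
Qed.

(** On the second leg the coaction appears through the antipode. A product [c * d] coming from
    [del v], equal to a scalar, is inserted and its coaction split by multiplicativity; colinearity
    turns the coaction on [c] into a coproduct that cancels [S u], and [sw_del_insert] removes
    [b * c], leaving the coaction on [d]. *)
Lemma sw_del_lam2 (F : T -> H -> T -> U) h : lin3 F ->
  \sw_(a, b <- del h) \sw_(g, c <- lam b) F a g c =
  \sw_(h1, h2 <- D h) \sw_(a, b <- del h1) F a (S h2) b.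
Proof.
move=> F3; apply: esym.
transitivity (\sw_(h1, h2 <- D h) \sw_(a, b <- del h1) \sw_(u, v <- D h2)
   \sw_(c, d <- del v) \sw_(g, t <- lam c) \sw_(g', t' <- lam d)
      F a (S u * (g * g')) (b * (t * t'))).
  apply: eq_sw => h1 h2; apply: eq_sw => a b; apply: esym.
  transitivity (\sw_(u, v <- D h2) e v *: F a (S u) b); last by rewrite sw_counitr.
  apply: eq_sw => u v.
  transitivity (\sw_(c, d <- del v) \sw_(g, t <- lam (c * d)) F a (S u * g) (b * t)).
    apply: eq_sw => c d.
    by rewrite (sw_lamM _ _ (F := fun g t => F a (S u * g) (b * t))).
  rewrite (sw_del_mult _ (F := fun x => \sw_(g, t <- lam x) F a (S u * g) (b * t))) //.
  by rewrite rmorph1 sw_one ?mulr1.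
transitivity (\sw_(h1, h2 <- D h) \sw_(a, b <- del h1) \sw_(u, v <- D h2)
   \sw_(v1, v2 <- D v) \sw_(c, d <- del v2) \sw_(g', t' <- lam d)
      F a (S u * v1 * g') (b * (c * t'))).
  apply: eq_sw => h1 h2; apply: eq_sw => a b; apply: eq_sw => u v.
  rewrite -(sw_del_lam _ (F := fun v1 c d => \sw_(g', t' <- lam d)
      F a (S u * v1 * g') (b * (c * t')))) //.
  by do !apply: eq_sw => ? ?; rewrite -!mulrA.
transitivity (\sw_(h1, h2 <- D h) \sw_(a, b <- del h1) \sw_(c, d <- del h2)
      \sw_(g', t' <- lam d) F a g' (b * c * t')).
  apply: eq_sw => h1 h2; apply: eq_sw => a b.
  rewrite -(sw_comulA _ (F := fun u v1 v2 => \sw_(c, d <- del v2) \sw_(g', t' <- lam d)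
      F a (S u * v1 * g') (b * (c * t')))) //.
  transitivity (\sw_(u, v <- D h2) e u *: \sw_(c, d <- del v) \sw_(g', t' <- lam d)
      F a (1 * g') (b * (c * t'))).
    apply: eq_sw => u v.
    by rewrite (sw_antipodel _ (F := fun w => \sw_(c, d <- del v) \sw_(g', t' <- lam d)
      F a (w * g') (b * (c * t')))) //.
  rewrite (sw_counitl _ (F := fun v => \sw_(c, d <- del v) \sw_(g', t' <- lam d)
      F a (1 * g') (b * (c * t')))) //.
  by do !apply: eq_sw => ? ?; rewrite mul1r -!mulrA.
rewrite (sw_del_insert _ (F := fun a w d => \sw_(g', t' <- lam d) F a g' (w * t'))) //.
by do !apply: eq_sw => ? ?; rewrite mul1r.
Qed.

Lemma sw_gam_rho2 (F : T -> H -> T -> U) h : lin3 F ->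
  \sw_(a, b <- gam h) \sw_(c, g <- rho a) F c g b =
  \sw_(h1, h2 <- D h) \sw_(a, b <- gam h2) F a (S h1) b.
Proof.
move=> F3; apply: esym.
transitivity (\sw_(h1, h2 <- D h) \sw_(a, b <- gam h2) \sw_(u, v <- D h1)
   \sw_(c, d <- gam u) \sw_(t, g <- rho c) \sw_(t', g' <- rho d)
      F (t * t' * a) (g * g' * S v) b).
  apply: eq_sw => h1 h2; apply: eq_sw => a b; apply: esym.
  transitivity (\sw_(u, v <- D h1) e u *: F a (S v) b); last by rewrite sw_counitl.
  apply: eq_sw => u v.
  transitivity (\sw_(c, d <- gam u) \sw_(t, g <- rho (c * d)) F (t * a) (g * S v) b).
    apply: eq_sw => c d.
    by rewrite (sw_rhoM _ _ (F := fun t g => F (t * a) (g * S v) b)).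
  rewrite (sw_gam_mult _ (F := fun x => \sw_(t, g <- rho x) F (t * a) (g * S v) b)) //.
  by rewrite rmorph1 sw_one ?mul1r.
transitivity (\sw_(h1, h2 <- D h) \sw_(a, b <- gam h2) \sw_(u, v <- D h1)
   \sw_(u1, u2 <- D u) \sw_(c, d <- gam u1) \sw_(t, g <- rho c)
      F (t * d * a) (g * (u2 * S v)) b).
  apply: eq_sw => h1 h2; apply: eq_sw => a b; apply: eq_sw => u v.
  rewrite -(sw_gam_rho _ (F := fun c d u2 => \sw_(t, g <- rho c)
      F (t * d * a) (g * (u2 * S v)) b)) //.
  apply: eq_sw => c d; rewrite sw_exch.
  by do !apply: eq_sw => ? ?; rewrite -!mulrA.
transitivity (\sw_(h1, h2 <- D h) \sw_(a, b <- gam h2) \sw_(c, d <- gam h1)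
      \sw_(t, g <- rho c) F (t * (d * a)) g b).
  apply: eq_sw => h1 h2; apply: eq_sw => a b.
  rewrite (sw_comulA _ (F := fun u1 u2 v => \sw_(c, d <- gam u1) \sw_(t, g <- rho c)
      F (t * d * a) (g * (u2 * S v)) b)) //.
  transitivity (\sw_(u, v <- D h1) e v *: \sw_(c, d <- gam u) \sw_(t, g <- rho c)
      F (t * d * a) (g * 1) b).
    apply: eq_sw => u v.
    by rewrite (sw_antipoder _ (F := fun w => \sw_(c, d <- gam u) \sw_(t, g <- rho c)
      F (t * d * a) (g * w) b)) //.
  rewrite (sw_counitr _ (F := fun u => \sw_(c, d <- gam u) \sw_(t, g <- rho c)
      F (t * d * a) (g * 1) b)) //.
  by do !apply: eq_sw => ? ?; rewrite mulr1 -!mulrA.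
deep ltac:(rewrite sw_exch).
rewrite (sw_gam_insert _ (F := fun c w b => \sw_(t, g <- rho c) F (t * w) g b)) //.
by do !apply: eq_sw => ? ?; rewrite mulr1.
Qed.

(** The two sides are the two readings of [mu x], through [Hl] and through [Hr]. Expanding [y] by
    [sw_galrV] brings in both coactions; as they commute, [sw_gallV] can contract the left one
    instead. *)
Lemma sw_del_gam (F : T -> T -> T -> U) x : lin3 F ->
  \sw_(h, y <- lam x) \sw_(a, b <- del h) F a b y =
  \sw_(y, h <- rho x) \sw_(a, b <- gam h) F y a b.
Proof.
move=> F3.
transitivity (\sw_(h, y <- lam x) \sw_(y0, h' <- rho y) \sw_(a, b <- del h)
    \sw_(c, d <- gam h') F a (b * (y0 * c)) d).
  apply: eq_sw => h y; apply: esym; rewrite sw_exch; apply: eq_sw => a b.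
  by rewrite (sw_galrV _ (F := fun p q => F a (b * p) q)) ?mulr1.
rewrite -(sw_lamrho _ (F := fun h y0 h' => \sw_(a, b <- del h)
    \sw_(c, d <- gam h') F a (b * (y0 * c)) d)) //.
apply: eq_sw => y h.
transitivity (\sw_(g, z <- lam y) \sw_(a, b <- del g) \sw_(c, d <- gam h) F a (b * z * c) d).
  by do !apply: eq_sw => ? ?; rewrite -!mulrA.
rewrite (sw_gallV _ (F := fun a w => \sw_(c, d <- gam h) F a (w * c) d)) //.
by do !apply: eq_sw => ? ?; rewrite mul1r.
Qed.

End Theory.

Section Uniqueness.
Variables (T : algType k) (B : bigal T).
Local Notation lam := (lam B).
Local Notation rho := (rho B).
Local Notation del := (del B).
Local Notation gam := (gam B).

(** Sending [g ⊗ t] to [del g], with [t] multiplied onto its second leg, is a left inverse of the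
    Galois map by [gallV]; apply it to both sides of the hypothesis. *)
Lemma del_uniq (u : T ⊗ T) h :
  \sw_(a, b <- u) \sw_(g, c <- lam a) g ⊗ (c * b) = h ⊗ 1 -> u = del h.
Proof.
move=> uh.
transitivity (\sw_(g, t <- h ⊗ (1 : T)) \sw_(a, b <- del g) a ⊗ (b * t)); last first.
  rewrite sw_pure //.
  by rewrite -[RHS]sw_id; apply: eq_sw => a b; rewrite mulr1.
rewrite -uh -{1}(sw_id u) sw_sw //.
apply: eq_sw => a b.
rewrite sw_sw //.
transitivity (\sw_(g, c <- lam a) \sw_(p, q <- del g) p ⊗ (q * c * b)); last first.
  by apply: eq_sw => g c; rewrite sw_pure; [apply: eq_sw => p q; rewrite mulrA|lin].
by rewrite (sw_gallV _ (F := fun p q => p ⊗ (q * b))) ?mul1r.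
Qed.

Lemma gam_uniq (u : T ⊗ T) h :
  \sw_(a, b <- u) \sw_(c, g <- rho b) (a * c) ⊗ g = 1 ⊗ h -> u = gam h.
Proof.
move=> uh.
transitivity (\sw_(t, g <- (1 : T) ⊗ h) \sw_(a, b <- gam g) (t * a) ⊗ b); last first.
  rewrite sw_pure //.
  by rewrite -[RHS]sw_id; apply: eq_sw => a b; rewrite mul1r.
rewrite -uh -{1}(sw_id u) sw_sw //.
apply: eq_sw => a b.
rewrite sw_sw //.
transitivity (\sw_(c, g <- rho b) \sw_(p, q <- gam g) (a * (c * p)) ⊗ q); last first.
  by apply: eq_sw => g c; rewrite sw_pure; [apply: eq_sw => p q; rewrite mulrA|lin].
by rewrite (sw_galrV _ (F := fun p q => (a * p) ⊗ q)) ?mulr1.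
Qed.

Lemma del_inj : injective del.
Proof.
move=> x y xy; apply: (@pure1r_inj _ _ T).
by rewrite -(gall B x) -(gall B y) xy.
Qed.

Lemma gam_inj : injective gam.
Proof.
move=> x y xy; apply: (@pure1_inj _ _ T).
by rewrite -(galr B x) -(galr B y) xy.
Qed.

Lemma del1 : del 1 = 1 ⊗ 1.
Proof.
apply/esym/del_uniq; rewrite sw_pure //.
by rewrite rmorph1 sw_one ?mulr1.
Qed.

Lemma gam1 : gam 1 = 1 ⊗ 1.
Proof.
apply/esym/gam_uniq; rewrite sw_pure //.
by rewrite rmorph1 sw_one ?mulr1.
Qed.

(** By uniqueness it suffices to apply the Galois map to the right-hand side, where [sw_gall]
    contracts the inner translation and then the outer one. The order [d * b] is that of the product
    in [T^c]. *)
Lemma delM g h : del (g * h) = \sw_(a, b <- del g) \sw_(c, d <- del h) (a * c) ⊗ (d * b).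
Proof.
apply/esym/del_uniq; rewrite sw_sw //.
transitivity (\sw_(a, b <- del g) \sw_(p, x <- lam a) \sw_(c, d <- del h) \sw_(q, y <- lam c)
  (p * q) ⊗ (x * (y * d) * b)).
  apply: eq_sw => a b; rewrite sw_sw //.
  rewrite [RHS]sw_exch; apply: eq_sw => c d.
  rewrite sw_pure //.
  rewrite sw_lamM //.
  by do !apply: eq_sw => ? ?; rewrite -!mulrA.
transitivity (\sw_(a, b <- del g) \sw_(p, x <- lam a) (p * h) ⊗ (x * b)).
  apply: eq_sw => a b; apply: eq_sw => p x.
  by rewrite (sw_gall _ (F := fun q y => (p * q) ⊗ (x * y * b))) ?mulr1.
by rewrite (sw_gall _ (F := fun p x => (p * h) ⊗ x)).
Qed.

Lemma gamM g h : gam (g * h) = \sw_(a, b <- gam g) \sw_(c, d <- gam h) (c * a) ⊗ (b * d).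
Proof.
apply/esym/gam_uniq; rewrite sw_sw //.
transitivity (\sw_(c, d <- gam h) \sw_(y, q <- rho d) \sw_(a, b <- gam g) \sw_(x, p <- rho b)
  (c * (a * x) * y) ⊗ (p * q)).
  transitivity (\sw_(a, b <- gam g) \sw_(c, d <- gam h) \sw_(x, p <- rho b) \sw_(y, q <- rho d)
     (c * (a * x) * y) ⊗ (p * q)).
    apply: eq_sw => a b; rewrite sw_sw //.
    apply: eq_sw => c d.
    rewrite sw_pure //.
    rewrite sw_rhoM //.
    by do !apply: eq_sw => ? ?; rewrite -!mulrA.
  rewrite sw_exch; apply: eq_sw => c d; rewrite [RHS]sw_exch; apply: eq_sw => a b.
  exact: sw_exch.
transitivity (\sw_(c, d <- gam h) \sw_(y, q <- rho d) (c * y) ⊗ (g * q)).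
  apply: eq_sw => a b; apply: eq_sw => p x.
  by rewrite (sw_galr _ (F := fun y q => (a * y * p) ⊗ (q * x))) ?mulr1.
by rewrite (sw_galr _ (F := fun p x => p ⊗ (g * x))).
Qed.

End Uniqueness.

(* As del identifies H with H_l(T), th_del is the equation defining H_l(T); it
   also determines th. *)
Record bigal_theta (T : algType k) (B : bigal T) (th : {lrmorphism T -> T}) : Prop :=
  BigalTheta {
    th_bij : bijective th;
    th_del : forall h, del B (S h) = \sw_(a, b <- del B h) b ⊗ th a }.

Section Theta.
Variables (T : algType k) (B : bigal T) (th : {lrmorphism T -> T}).
Hypothesis thP : bigal_theta B th.
Local Notation lam := (lam B).
Local Notation rho := (rho B).
Local Notation del := (del B).
Local Notation gam := (gam B).

Lemma sw_th_del (U : lmodType k) (F : T -> T -> U) h : lin2 F ->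
  \sw_(a, b <- del (S h)) F a b = \sw_(a, b <- del h) F b (th a).
Proof. by move=> F2; rewrite (th_del thP); sw. Qed.

(** Two uses of [th_del] give [del (S (S h)) = (th ⊠ th) (del h)]; [gall] and [gallV] convert this
    property of [del] into one of [lam]. *)
Lemma lam_th (U : lmodType k) (F : H -> T -> U) x : lin2 F ->
  \sw_(h, y <- lam (th x)) F h y = \sw_(h, y <- lam x) F (S (S h)) (th y).
Proof.
move=> F2; apply: esym.
transitivity (\sw_(h, y <- lam x) \sw_(a, b <- del (S (S h))) \sw_(g, c <- lam a) F g (c * b * th y)).
  apply: eq_sw => h y.
  by rewrite (sw_gall _ (F := fun g t => F g (t * th y))) ?mul1r.
transitivity (\sw_(h, y <- lam x) \sw_(a, b <- del h) \sw_(g, c <- lam (th a)) F g (c * th (b * y))).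
  apply: eq_sw => h y; rewrite !sw_th_del //.
  by do !apply: eq_sw => ? ?; rewrite rmorphM mulrA.
rewrite (sw_gallV _ (F := fun a b => \sw_(g, c <- lam (th a)) F g (c * th b))) //.
by do !apply: eq_sw => ? ?; rewrite rmorph1 mulr1.
Qed.

(** This is the equation defining [Hl], at [del h]. Colinearity of the two legs reduces both sides
    to a pair of translations at [h1] and [h2], and the antipode caused by the second leg is
    absorbed by [th_del]. *)
Lemma sw_del_Hl (U : lmodType k) (F : T -> T -> T -> T -> U) h : lin4 F ->
  \sw_(a, b <- del h) \sw_(g, c <- lam a) \sw_(p, q <- del g) F p q (th c) b =
  \sw_(a, b <- del h) \sw_(g, c <- lam b) \sw_(p, q <- del g) F a c q p.
Proof.
move=> F4.
rewrite (sw_del_lam _ (F := fun g c b => \sw_(p, q <- del g) F p q (th c) b)) //.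
rewrite (sw_del_lam2 _ (F := fun a g c => \sw_(p, q <- del g) F a c q p)) //.
apply: eq_sw => h1 h2; rewrite sw_exch; apply: eq_sw => p q.
by rewrite sw_th_del.
Qed.

(** The bridge from the axiom [th_del] on the left translation to the right one. [th y] is expanded
    by [sw_gallV], [sw_del_Hl] trades theta for a flipped translation, and [sw_del_gam] passes to
    [gam]. The last argument of [F], equal to 1 at both ends, is the slot for the products that
    cancel in between. *)
Lemma sw_del_gam_th (U : lmodType k) (F : T -> T -> T -> T -> U) x : lin4 F ->
  \sw_(k, y <- lam x) \sw_(p, q <- del k) F p q (th y) 1 =
  \sw_(y, k <- rho x) \sw_(p, q <- gam (S k)) F y q p 1.
Proof.
move=> F4.
transitivity (\sw_(h, y <- lam x) \sw_(r, s <- del h) \sw_(g, t <- lam r)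
    \sw_(p, q <- del g) F p q (th t) (s * y)).
  transitivity (\sw_(h, y <- lam x) \sw_(g, z <- lam y) \sw_(r, s <- del g)
      \sw_(p, q <- del h) F p q (th r) (s * z)).
    apply: eq_sw => h y.
    by rewrite (sw_gallV _ (F := fun r s => \sw_(p, q <- del h) F p q (th r) s)).
  rewrite -(sw_lamA _ (F := fun h g z => \sw_(r, s <- del g)
      \sw_(p, q <- del h) F p q (th r) (s * z))) //.
  apply: eq_sw => h y.
  by rewrite (sw_del_lam _ (F := fun g t s => \sw_(p, q <- del g) F p q (th t) (s * y))).
transitivity (\sw_(h, y <- lam x) \sw_(a, b <- del h) \sw_(g, c <- lam b)
    \sw_(p, q <- del g) F a c q (p * y)).
  apply: eq_sw => h y.
  by rewrite (sw_del_Hl _ (F := fun p q t s => F p q t (s * y))).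
transitivity (\sw_(h, y <- lam x) \sw_(a, b <- del h) \sw_(c, g <- rho b)
    \sw_(p, q <- gam g) F a q p (c * y)).
  apply: eq_sw => h y; apply: eq_sw => a b.
  by rewrite (sw_del_gam _ _ (F := fun p q c => F a c q (p * y))).
rewrite (sw_del_gam _ _ (F := fun a b y => \sw_(c, g <- rho b)
    \sw_(p, q <- gam g) F a q p (c * y))) //.
apply: eq_sw => y h.
rewrite (sw_gam_rho2 _ (F := fun c g b => \sw_(p, q <- gam g) F y q p (c * b))) //.
transitivity (\sw_(h1, h2 <- D h) e h2 *: \sw_(p, q <- gam (S h1)) F y q p 1).
  apply: eq_sw => h1 h2; rewrite sw_exch -(sw_scale (e h2 : k)); apply: eq_sw => p q.
  by rewrite (sw_gam_mult _ (F := fun t => F y q p t)).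
by rewrite (sw_counitr _ (F := fun h => \sw_(p, q <- gam (S h)) F y q p 1)).
Qed.

(** [bigal_theta] constrains [del] only. The mirror identity comes from [sw_del_gam_th] applied to
    the second leg of [gam h], whose first leg is then cancelled by [galr]; the unit factor in front
    holds that first leg. *)
Lemma th_gam h : gam (S h) = \sw_(a, b <- gam h) th b ⊗ a.
Proof.
suff E : \sw_(a, b <- gam (S h)) b ⊗ a = \sw_(a, b <- gam h) a ⊗ th b.
  rewrite -[LHS]sw_id.
  transitivity (\sw_(a, b <- \sw_(a, b <- gam (S h)) b ⊗ a) b ⊗ a); first by sw.
  by rewrite E; sw.
apply: (@pure1_inj _ _ T).
(* The factor [t * 1] keeps the shape of the slot that [sw_del_gam_th] fills with 1. *)
pose G t g : T ⊗ (T ⊗ T) := \sw_(p, q <- gam (S g)) (t * 1) ⊗ (q ⊗ p).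
transitivity (G 1 h).
  rewrite /G mulr1 (lin1_sw _ _ (f := fun u => 1 ⊗ u)); last lin.
  by [].
rewrite -(sw_galr B _ (F := G)); last by rewrite /G; lin.
transitivity (\sw_(a, b <- gam h) \sw_(k, y <- lam b) \sw_(p, q <- del k)
    (a * p * 1) ⊗ (q ⊗ th y)).
  apply: eq_sw => a b.
  by rewrite (sw_del_gam_th _ (F := fun p q t u => (a * p * u) ⊗ (q ⊗ t))).
transitivity (\sw_(a, b <- gam h) \sw_(y, g <- rho b) \sw_(c, d <- gam g) (a * y * 1) ⊗ (c ⊗ th d)).
  apply: eq_sw => a b.
  by rewrite (sw_del_gam _ _ (F := fun p q y => (a * p * 1) ⊗ (q ⊗ th y))).
rewrite (sw_galr _ (F := fun y g => \sw_(c, d <- gam g) (y * 1) ⊗ (c ⊗ th d))) //.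
rewrite (lin1_sw _ _ (f := fun u => 1 ⊗ u)) //.
by rewrite mulr1.
Qed.

Lemma sw_th_gam (U : lmodType k) (F : T -> T -> U) h : lin2 F ->
  \sw_(a, b <- gam (S h)) F a b = \sw_(a, b <- gam h) F (th b) a.
Proof. by move=> F2; rewrite th_gam; sw. Qed.

Lemma rho_th (U : lmodType k) (F : T -> H -> U) x : lin2 F ->
  \sw_(y, h <- rho (th x)) F y h = \sw_(y, h <- rho x) F (th y) (S (S h)).
Proof.
move=> F2; apply: esym.
transitivity (\sw_(y, h <- rho x) \sw_(a, b <- gam (S (S h))) \sw_(c, g <- rho b) F (th y * (a * c)) g).
  apply: eq_sw => h y.
  by rewrite (sw_galr _ (F := fun t g => F (th h * t) g)) ?mulr1.
transitivity (\sw_(y, h <- rho x) \sw_(a, b <- gam h) \sw_(c, g <- rho (th b)) F (th (y * a) * c) g).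
  apply: eq_sw => h y; rewrite !sw_th_gam //.
  by do !apply: eq_sw => ? ?; rewrite rmorphM mulrA.
rewrite (sw_galrV _ (F := fun a b => \sw_(c, g <- rho (th b)) F (th a * c) g)) //.
by do !apply: eq_sw => ? ?; rewrite rmorph1 mul1r.
Qed.

Lemma sw_gam_Hr (U : lmodType k) (F : T -> T -> T -> T -> U) h : lin4 F ->
  \sw_(a, b <- gam h) \sw_(c, g <- rho b) \sw_(p, q <- gam g) F a (th c) p q =
  \sw_(a, b <- gam h) \sw_(c, g <- rho a) \sw_(p, q <- gam g) F q p c b.
Proof.
move=> F4.
rewrite (sw_gam_rho _ (F := fun a c g => \sw_(p, q <- gam g) F a (th c) p q)) //.
rewrite (sw_gam_rho2 _ (F := fun c g b => \sw_(p, q <- gam g) F q p c b)) //.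
apply: eq_sw => h1 h2; apply: esym; rewrite sw_exch sw_th_gam; last lin.
by [].
Qed.

End Theta.
End BiGalois.

(** * From bi-Galois algebras to torsors *)

Section Build.
Variables (k : fieldType) (H : algType k) (hH : hopf H) (T : algType k).
Variables (B : bigal hH T) (th : {lrmorphism T -> T}) (thP : bigal_theta B th).
Local Notation e := (counit hH).
Local Notation lam := (lam B).
Local Notation rho := (rho B).
Local Notation del := (del B).
Local Notation gam := (gam B).

Lemma del_monoid_morphism : monoid_morphism (del : H -> T ⊗ T^c).
Proof. by split=> [|g h]; [exact: (del1 B) | exact: (delM B)]. Qed.

Lemma gam_monoid_morphism : monoid_morphism (gam : H -> T^c ⊗ T).
Proof. by split=> [|g h]; [exact: (gam1 B) | exact: (gamM B)]. Qed.

Definition del_lr : {lrmorphism H -> T ⊗ T^c} :=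
  HB.pack_for {lrmorphism H -> T ⊗ T^c} (del : H -> T ⊗ T^c)
    (GRing.isLinear.Build k H (T ⊗ T^c)%type _ (del : H -> T ⊗ T^c) (linearP del))
    (GRing.isMonoidMorphism.Build H (T ⊗ T^c)%type (del : H -> T ⊗ T^c) del_monoid_morphism).

Definition gam_lr : {lrmorphism H -> T^c ⊗ T} :=
  HB.pack_for {lrmorphism H -> T^c ⊗ T} (gam : H -> T^c ⊗ T)
    (GRing.isLinear.Build k H (T^c ⊗ T)%type _ (gam : H -> T^c ⊗ T) (linearP gam))
    (GRing.isMonoidMorphism.Build H (T^c ⊗ T)%type (gam : H -> T^c ⊗ T) gam_monoid_morphism).

Definition mu_lr : {lrmorphism T -> T ⊗ T^c ⊗ T} := (del_lr ⊠ idfun) \o lam.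

(** [mu_lr] on the underlying vector spaces: free of [^c], it is within reach of the Sweedler
    lemmas, and the torsor axioms for [mu_lr] are convertible to statements about it. *)
Definition mu0 (x : T) : T ⊗ T ⊗ T := \sw_(h, y <- lam x) del h ⊗ y.

Lemma mu0_linear : linear mu0.
Proof. by rewrite /mu0; have : lin1 mu0 by rewrite /mu0; lin. Qed.

HB.instance Definition _ := GRing.isLinear.Build k T (T ⊗ T ⊗ T)%type _ mu0 mu0_linear.

Ltac swu := repeat first [sw_step | progress rewrite /mu0].

Lemma mu0_unitr x : (idfun ⊠ @tmult k T) (tassoc (mu0 x)) = x ⊗ 1.
Proof.
rewrite -(gallV B x) /mu0; sw.
Qed.
Lemma mu0_unitl x : (@tmult k T ⊠ idfun) (mu0 x) = 1 ⊗ x.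
Proof.
transitivity (\sw_(h, y <- lam x) \sw_(a, b <- del h) (a * b) ⊗ y).
  by rewrite /mu0; sw.
deep ltac:(rewrite (sw_del_mult B _ (F := fun t => t ⊗ _)); last lin).
by rewrite (sw_lam1 B _ (F := fun y => 1 ⊗ y)).
Qed.
Lemma mu0_assoc x :
  tflat3 (((idfun : T ⊗ T -> T ⊗ T) ⊠ mu0) (mu0 x)) = (mu0 ⊠ idfun ⊠ idfun) (mu0 x).
Proof.
transitivity (\sw_(h, y <- lam x) \sw_(g, z <- lam y) \sw_(a, b <- del g) del h ⊗ a ⊗ b ⊗ z).
  swu.
rewrite -(sw_lamA B _ (F := fun h g z => \sw_(a, b <- del g) del h ⊗ a ⊗ b ⊗ z)) //.
transitivity (\sw_(h, y <- lam x) \sw_(a, b <- del h) \sw_(g, c <- lam a) del g ⊗ c ⊗ b ⊗ y).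
  apply: eq_sw => h y.
  by rewrite (sw_del_lam B _ (F := fun g c b => del g ⊗ c ⊗ b ⊗ y)).
swu.
Qed.

Lemma Hl_del h :
  (idfun ⊠ idfun ⊠ th ⊠ idfun) ((mu0 ⊠ idfun) (del h)) =
  tflat3 ((idfun ⊠ (@tswap13 k T T T \o mu0)) (del h)) :> T ⊗ T ⊗ T ⊗ T.
Proof.
transitivity (\sw_(a, b <- del h) \sw_(g, c <- lam a) \sw_(p, q <- del g) p ⊗ q ⊗ th c ⊗ b).
  by swu.
rewrite (sw_del_Hl thP _ (F := fun a b c d => a ⊗ b ⊗ c ⊗ d)) //.
by swu.
Qed.

Lemma mu0_theta x :
  (idfun ⊠ idfun ⊠ th ⊠ idfun ⊠ idfun) ((mu0 ⊠ idfun ⊠ idfun) (mu0 x)) =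
  (@tflat3 k T T T T ⊠ idfun) ((idfun ⊠ (@tswap13 k T T T \o mu0) ⊠ idfun) (mu0 x)).
Proof.
transitivity (\sw_(h, y <- lam x)
  (idfun ⊠ idfun ⊠ th ⊠ idfun) ((mu0 ⊠ idfun) (del h)) ⊗ y).
  by swu.
transitivity (\sw_(h, y <- lam x)
  tflat3 ((idfun ⊠ (@tswap13 k T T T \o mu0)) (del h)) ⊗ y).
  by apply: eq_sw => h y; rewrite Hl_del.
by swu.
Qed.

Lemma th_mu0 x : (th ⊠ th ⊠ th) (mu0 x) = mu0 (th x).
Proof.
rewrite /mu0 (lam_th thP _ (F := fun h y => del h ⊗ y)) //.
rewrite tmap_sw sw_sw //.
apply: eq_sw => h y; rewrite sw_pure //.
by congr (_ ⊗ _); rewrite (th_del thP) (sw_th_del thP).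
Qed.

Definition build_torsor : torsor T :=
  @Torsor k T mu_lr th (th_bij thP) mu0_unitr mu0_unitl mu0_assoc mu0_theta th_mu0.

Lemma mu0_rho x : mu0 x = \sw_(y, h <- rho x) \sw_(a, b <- gam h) y ⊗ a ⊗ b.
Proof.
rewrite -(sw_del_gam B _ (F := fun a b c => a ⊗ b ⊗ c)) //.
by apply: eq_sw => h y; rewrite -{1}(sw_id (del h)) sw_purel.
Qed.

Ltac swr := repeat first [progress rewrite ?mu0_rho | sw_step].

Lemma Hr_gam h :
  (idfun ⊠ th ⊠ idfun ⊠ idfun) (tflat3 ((idfun ⊠ mu0) (gam h))) =
  ((@tswap13 k T T T \o mu0) ⊠ idfun) (gam h) :> T ⊗ T ⊗ T ⊗ T.
Proof.
transitivity (\sw_(a, b <- gam h) \sw_(c, g <- rho b) \sw_(p, q <- gam g) a ⊗ th c ⊗ p ⊗ q).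
  by swr.
rewrite (sw_gam_Hr thP _ (F := fun a b c d => a ⊗ b ⊗ c ⊗ d)) //.
by swr.
Qed.

(** The hypothesis says that [v ⊗ 1] is [del ⊠ idfun] of the Galois image of [v]. Contracting the
    last factor with a form [phi] such that [phi 1 = 1] exhibits [v] as a value of [del]. *)
Lemma del_ex (v : T ⊗ T) :
  \sw_(a, b <- v) \sw_(g, c <- lam a) del g ⊗ (c * b) = v ⊗ 1 -> exists h, del h = v.
Proof.
have [phi phi1] := separating_form (oner_neq0 T).
move=> vE; exists (\sw_(a, b <- v) \sw_(g, c <- lam a) phi (c * b) *: g).
transitivity (tcontrr phi (v ⊗ (1 : T))).
  rewrite -vE /tcontrr sw_sw; last by rewrite /tcontrr_fun; lin.
  rewrite (lin1_sw _ _ (f := del)) //.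
  apply: eq_sw => a b; rewrite (lin1_sw _ _ (f := del)) //.
  rewrite sw_sw; last by rewrite /tcontrr_fun; lin.
  apply: eq_sw => g c; rewrite sw_pure; last by rewrite /tcontrr_fun; lin.
  by rewrite linearZ.
rewrite /tcontrr sw_pure /tcontrr_fun //.
by rewrite phi1 scale1r.
Qed.

Lemma gam_ex (v : T ⊗ T) :
  \sw_(a, b <- v) \sw_(c, g <- rho b) (a * c) ⊗ gam g = 1 ⊗ v -> exists h, gam h = v.
Proof.
have [phi phi1] := separating_form (oner_neq0 T).
move=> vE; exists (\sw_(a, b <- v) \sw_(c, g <- rho b) phi (a * c) *: g).
transitivity (tcontrl phi ((1 : T) ⊗ v)).
  rewrite -vE /tcontrl sw_sw; last by rewrite /tcontrl_fun; lin.
  rewrite (lin1_sw _ _ (f := gam)) //.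
  apply: eq_sw => a b; rewrite (lin1_sw _ _ (f := gam)) //.
  rewrite sw_sw; last by rewrite /tcontrl_fun; lin.
  apply: eq_sw => g c; rewrite sw_pure; last by rewrite /tcontrl_fun; lin.
  by rewrite linearZ.
rewrite /tcontrl sw_pure /tcontrl_fun //.
by rewrite phi1 scale1r.
Qed.

(** The criterion of [del_ex] may be checked after the injective map [th] on the last factor. It
    then follows from the equation defining [Hl], with [th] of the last factor multiplied onto the
    third: on the right-hand side this product is the one of [del (S g)], hence the counit of
    [g]. *)
Lemma Hl_del_ex (v : T ⊗ T) :
  (idfun ⊠ idfun ⊠ th ⊠ idfun) ((mu0 ⊠ idfun) v) =
    tflat3 ((idfun ⊠ (@tswap13 k T T T \o mu0)) v) :> T ⊗ T ⊗ T ⊗ T ->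
  exists h, del h = v.
Proof.
move=> E; apply: del_ex.
apply: (tmap_injr (bij_inj (th_bij thP))).
pose F (p q t b : T) : T ⊗ T ⊗ T := p ⊗ q ⊗ (t * th b).
have E' := congr1 (fun t => \sw_(x, d <- t) \sw_(y, c <- x) \sw_(a, b <- y) F a b c d) E.
transitivity (\sw_(a, b <- v) \sw_(g, c <- lam a) \sw_(p, q <- del g) F p q (th c) b).
  rewrite /F tmap_sw sw_sw //.
  apply: eq_sw => a b; rewrite sw_sw //.
  apply: eq_sw => g c; rewrite sw_pure //.
  by rewrite -{1}(sw_id (del g)) sw_purel rmorphM.
transitivity (\sw_(a, b <- v) \sw_(g, c <- lam b) \sw_(p, q <- del g) F a c q p).
  refine (etrans _ (etrans E' _)); rewrite /F.
    by swu.
  by swu.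
rewrite /F tmapE rmorph1 -{2}(sw_id v) sw_purel; apply: eq_sw => a b.
transitivity (\sw_(g, c <- lam b) (e g : k) *: (a ⊗ c ⊗ (1 : T))); last first.
  by rewrite (sw_lam1 B _ (F := fun c => a ⊗ c ⊗ (1 : T))).
apply: eq_sw => g c.
rewrite -(sw_th_del thP _ (F := fun p q => a ⊗ c ⊗ (p * q))) //.
rewrite (sw_del_mult B _ (F := fun t => a ⊗ c ⊗ t)) //.
by rewrite counit_antipode.
Qed.

Lemma Hr_gam_ex (v : T ⊗ T) :
  (idfun ⊠ th ⊠ idfun ⊠ idfun) (tflat3 ((idfun ⊠ mu0) v)) =
  ((@tswap13 k T T T \o mu0) ⊠ idfun) v :> T ⊗ T ⊗ T ⊗ T ->
  exists h, gam h = v.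
Proof.
move=> E; apply: gam_ex.
apply: (tmap_injl (bij_inj (th_bij thP))).
pose F (a t p q : T) : T ⊗ (T ⊗ T) := (th a * t) ⊗ (p ⊗ q).
have E' := congr1 (fun t => \sw_(x, d <- t) \sw_(y, c <- x) \sw_(a, b <- y) F a b c d) E.
transitivity (\sw_(a, b <- v) \sw_(c, g <- rho b) \sw_(p, q <- gam g) F a (th c) p q).
  rewrite /F tmap_sw sw_sw //.
  apply: eq_sw => a b; rewrite sw_sw //.
  apply: eq_sw => g c; rewrite sw_pure //.
  by rewrite -{1}(sw_id (gam c)) sw_purer rmorphM.
transitivity (\sw_(a, b <- v) \sw_(c, g <- rho a) \sw_(p, q <- gam g) F q p c b).
  refine (etrans _ (etrans E' _)); rewrite /F.
    by swr.
  by swr.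
rewrite /F tmapE rmorph1 -{2}(sw_id v) sw_purer; apply: eq_sw => a b.
transitivity (\sw_(c, g <- rho a) (e g : k) *: ((1 : T) ⊗ (c ⊗ b))); last first.
  by rewrite (sw_rho1 B _ (F := fun c => (1 : T) ⊗ (c ⊗ b))).
apply: eq_sw => c g.
rewrite -(sw_th_gam thP _ (F := fun p q => (p * q) ⊗ (c ⊗ b))) //.
rewrite (sw_gam_mult B _ (F := fun t => t ⊗ (c ⊗ b))) //.
by rewrite counit_antipode.
Qed.

End Build.

Section Represents.
Variables (k : fieldType) (H : algType k) (hH : hopf H) (T : algType k).

(** Only the expression of [mu] by [del] is recorded; the one by [gam] follows from [sw_del_gam]. *)
Record represents (s : septuple hH T) (B : bigal hH T) : Prop := Represents {
  rep_del : forall y : Hl (tor s), Hl_val _ y = del B (il s y) :> (T ⊗ T)%type;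
  rep_gam : forall y : Hr (tor s), Hr_val _ y = gam B (ir s y) :> (T ⊗ T)%type;
  rep_mu : forall x, mu (tor s) x = \sw_(h, y <- lam B x) del B h ⊗ y :> (T ⊗ T ⊗ T)%type;
  rep_theta : bigal_theta B (theta (tor s)) }.

Lemma equalizer_val_inj (A A' : algType k) (f g : {lrmorphism A -> A'}) :
  injective (@equalizer_val k A A' f g).
Proof. exact: val_inj. Qed.

Section BuildSeptuple.
Variables (B : bigal hH T) (th : {lrmorphism T -> T}) (thP : bigal_theta B th).
Local Notation s := (build_torsor thP).

(** [Hl s] and [H] both embed into [T ⊗ T^c], the latter by [del]; [Hl_del] and [Hl_del_ex] say that
    the images coincide. *)
Lemma build_il : exists2 i : {lrmorphism Hl s -> H},
  bijective i & forall z, del_lr B (i z) = Hl_val s z.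
Proof.
apply: lrmorphism_iso.
- exact: equalizer_val_inj.
- exact: (@del_inj _ _ _ _ B).
- move=> z; have := equalizerP z; rewrite mem_equalizer => /eqP E.
  exact: (Hl_del_ex thP E).
- move=> h; have P : del_lr B h \in equalizer_pred (Hl_theta_mu s) (Hl_mu_op s).
    by rewrite mem_equalizer; apply/eqP; exact: (Hl_del thP).
  by exists (Equalizer P).
Qed.

Lemma build_ir : exists2 i : {lrmorphism Hr s -> H},
  bijective i & forall z, gam_lr B (i z) = Hr_val s z.
Proof.
apply: lrmorphism_iso.
- exact: equalizer_val_inj.
- exact: (@gam_inj _ _ _ _ B).
- move=> z; have := equalizerP z; rewrite mem_equalizer => /eqP E.
  exact: (Hr_gam_ex thP E).
- move=> h; have P : gam_lr B h \in equalizer_pred (Hr_theta_mu s) (Hr_mu_op s).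
    by rewrite mem_equalizer; apply/eqP; exact: (Hr_gam thP).
  by exists (Equalizer P).
Qed.

Lemma build_il_iso (i : {lrmorphism Hl s -> H}) :
  bijective i -> (forall z, del_lr B (i z) = Hl_val s z) -> hopf_iso_l hH i.
Proof.
move=> ib iE; split=> // x; last first.
  rewrite -iE tmult_sw; apply: (sw_del_mult B (i x) (F := fun t => t)); lin.
pose j := inv_iso ib.
have jE h : Hl_val s (j h) = del B h by rewrite -iE inv_isoK.
(* The coproduct of [H] is transported along the inverse of [i]; that the result lifts [mu ⊠ idfun]
   is the colinearity of [del]. *)
exists ((j ⊠ j) (comul hH (i x))).
  transitivity (\sw_(a, b <- comul hH (i x)) del B a ⊗ del B b : T ⊗ T ⊗ (T ⊗ T)).
    rewrite !tmap_sw sw_sw //.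
    by apply: eq_sw => a b; rewrite sw_pure; [rewrite !jE | lin].
  transitivity (\sw_(a, b <- del B (i x)) \sw_(g, c <- lam B a) del B g ⊗ (c ⊗ b)).
    rewrite (sw_del_lam B _ (F := fun g c b => del B g ⊗ (c ⊗ b))) //.
    by apply: eq_sw => a b; rewrite -{1}(sw_id (del B b)) sw_purer.
  rewrite -(iE x).
  transitivity (tassoc ((mu0 B ⊠ idfun) (del B (i x)))); last by [].
  by repeat first [sw_step | progress rewrite /mu0].
rewrite -[RHS]sw_id tmap_sw sw_sw //.
apply: eq_sw => a b; rewrite sw_pure //.
by rewrite !inv_isoK.
Qed.

Lemma build_ir_iso (i : {lrmorphism Hr s -> H}) :
  bijective i -> (forall z, gam_lr B (i z) = Hr_val s z) -> hopf_iso_r hH i.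
Proof.
move=> ib iE; split=> // x; last first.
  rewrite -iE tmult_sw; apply: (sw_gam_mult B (i x) (F := fun t => t)); lin.
pose j := inv_iso ib.
have jE h : Hr_val s (j h) = gam B h by rewrite -iE inv_isoK.
exists ((j ⊠ j) (comul hH (i x))).
  transitivity (\sw_(a, b <- comul hH (i x)) gam B a ⊗ gam B b : T ⊗ T ⊗ (T ⊗ T)).
    rewrite !tmap_sw sw_sw //.
    by apply: eq_sw => a b; rewrite sw_pure; [rewrite !jE | lin].
  transitivity (\sw_(a, b <- gam B (i x)) \sw_(c, g <- rho B b) (a ⊗ c) ⊗ gam B g).
    rewrite (sw_gam_rho B _ (F := fun a c g => (a ⊗ c) ⊗ gam B g)) //.
    by apply: eq_sw => a b; rewrite -{1}(sw_id (gam B a)) sw_purel.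
  rewrite -(iE x).
  transitivity (tassoc (tflat3 ((idfun ⊠ mu0 B) (gam B (i x))))); last by [].
  transitivity (\sw_(a, b <- gam B (i x)) \sw_(c, g <- rho B b) \sw_(p, q <- gam B g) (a ⊗ c) ⊗ (p ⊗ q)).
    by do 2!apply: eq_sw => ? ?; rewrite -{1}(sw_id (gam B _)) sw_purer.
  by repeat first [progress rewrite ?mu0_rho | sw_step].
rewrite -[RHS]sw_id tmap_sw sw_sw //.
apply: eq_sw => a b; rewrite sw_pure //.
by rewrite !inv_isoK.
Qed.

Lemma build_septuple : exists2 s : septuple hH T, represents s B &
  forall x, theta (tor s) x = th x.
Proof.
have [il ilb ilE] := build_il; have [ir irb irE] := build_ir.
exists (Septuple (build_il_iso ilb ilE) (build_ir_iso irb irE)) => //.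
by split=> // y; [rewrite /= -ilE | rewrite /= -irE].
Qed.

End BuildSeptuple.
End Represents.

(** * From torsors to bi-Galois algebras *)

Section TorsorSw.
Variables (k : fieldType) (T : algType k) (s : torsor T).

Definition muT : {linear T -> (T ⊗ T ⊗ T)%type} := (mu s : {linear T -> (T ⊗ T^c ⊗ T)%type}).
Local Notation th := (theta s).

Variable U : lmodType k.

Lemma sw_muT_unitr (F : T -> T -> U) x : lin2 F ->
  \sw_(u, c <- muT x) \sw_(a, b <- u) F a (b * c) = F x 1.
Proof.
move=> F2; refine (etrans _ (etrans (congr1 (fun t => \sw_(a, b <- t) F a b) (mu_unitr s x)) _)).
  change (mu s x : (T ⊗ T ⊗ T)%type) with (muT x).
  by sw.
by sw.
Qed.

Lemma sw_muT_unitl (F : T -> T -> U) x : lin2 F ->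
  \sw_(u, c <- muT x) \sw_(a, b <- u) F (a * b) c = F 1 x.
Proof.
move=> F2; refine (etrans _ (etrans (congr1 (fun t => \sw_(a, b <- t) F a b) (mu_unitl s x)) _)).
  change (mu s x : (T ⊗ T ⊗ T)%type) with (muT x).
  rewrite tmap_sw sw_sw //; apply: eq_sw => u c; rewrite sw_pure // tmult_sw.
  by rewrite (lin1_sw _ _ (f := fun t => F t c)).
by sw.
Qed.

Lemma sw_muT_assoc (F : T -> T -> T -> T -> T -> U) x : lin5 F ->
  \sw_(u, c <- muT x) \sw_(a, b <- u) \sw_(v, r <- muT a) \sw_(p, q <- v) F p q r b c =
  \sw_(u, c <- muT x) \sw_(a, b <- u) \sw_(v, r <- muT c) \sw_(p, q <- v) F a b p q r.
Proof.
move=> F5; apply: esym.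
pose L (t : T ⊗ T ⊗ T ⊗ T ⊗ T) :=
  \sw_(x, e <- t) \sw_(y, d <- x) \sw_(z, c <- y) \sw_(a, b <- z) F a b c d e.
have E : tflat3 (((idfun : T ⊗ T -> T ⊗ T) ⊠ muT) (muT x)) = (muT ⊠ idfun ⊠ idfun) (muT x).
  exact: (mu_assoc s x).
refine (etrans _ (etrans (congr1 L E) _)); rewrite /L.
  rewrite tflat3_sw tmap_sw.
  rewrite !sw_sw //.
  apply: eq_sw => u c.
  transitivity (\sw_(v, r <- muT c) \sw_(p, q <- v) \sw_(a, b <- u) F a b p q r).
    by rewrite sw_exch; apply: eq_sw => v r; rewrite sw_exch.
  by sw.
rewrite !tmap_sw !sw_sw //.
apply: eq_sw => u c; rewrite sw_pure //.
rewrite sw_sw //.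
apply: eq_sw => a b; by sw.
Qed.

Lemma sw_muT_theta (F : T -> T -> T -> T -> T -> U) x : lin5 F ->
  \sw_(u, c <- muT x) \sw_(a, b <- u) \sw_(v, r <- muT a) \sw_(p, q <- v) F p q (th r) b c =
  \sw_(u, c <- muT x) \sw_(a, b <- u) \sw_(v, r <- muT b) \sw_(p, q <- v) F a r q p c.
Proof.
move=> F5.
pose L (t : T ⊗ T ⊗ T ⊗ T ⊗ T) :=
  \sw_(x, e <- t) \sw_(y, d <- x) \sw_(z, c <- y) \sw_(a, b <- z) F a b c d e.
have E : (idfun ⊠ idfun ⊠ th ⊠ idfun ⊠ idfun) ((muT ⊠ idfun ⊠ idfun) (muT x)) =
    (@tflat3 k T T T T ⊠ idfun) ((idfun ⊠ (@tswap13 k T T T \o muT) ⊠ idfun) (muT x)).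
  exact: (mu_theta s x).
refine (etrans _ (etrans (congr1 L E) _)); rewrite /L.
  rewrite !tmap_sw !sw_sw //.
  apply: eq_sw => u c; rewrite sw_pure //.
  rewrite sw_pure //.
  rewrite !tmap_sw !sw_sw //.
  by apply: eq_sw => a b; sw.
rewrite !tmap_sw !sw_sw //.
apply: eq_sw => u c; rewrite sw_pure //.
rewrite sw_pure //.
rewrite tflat3_sw tmap_sw !sw_sw //.
by apply: eq_sw => a b; sw.
Qed.
End TorsorSw.

Section Extract.
Variables (k : fieldType) (H : algType k) (hH : hopf H) (T : algType k).
Variable s : septuple hH T.
Local Notation t := (tor s).
Local Notation D := (comul hH).
Local Notation e := (counit hH).
Local Notation S := (antipode hH).
Local Notation th := (theta t).
Local Notation m := (muT t).

Lemma Hl_val_inj : injective (Hl_val t). Proof. exact: equalizer_val_inj. Qed.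
Lemma Hr_val_inj : injective (Hr_val t). Proof. exact: equalizer_val_inj. Qed.

(** By exactness [Hl ⊗ T] is again an equalizer, and the equation that [mu x] has to satisfy is the
    axiom [mu_theta]. *)
Lemma mu_Hl x : exists w, (Hl_val t ⊠ idfun) w = mu t x.
Proof.
apply: (@tens_equalizerl _ _ _ _ _ (Hl_theta_mu t) (Hl_mu_op t) (Hl_val t)).
  move=> u uE; have P : u \in equalizer_pred (Hl_theta_mu t) (Hl_mu_op t).
    by rewrite mem_equalizer; apply/eqP.
  by exists (Equalizer P).
transitivity ((((idfun ⊠ idfun ⊠ th ⊠ idfun) \o (m ⊠ idfun)) ⊠ idfun) (m x)); first by [].
transitivity (((@tflat3 k T T T T \o (idfun ⊠ (@tswap13 k T T T \o m))) ⊠ idfun) (m x)); last by [].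
transitivity (\sw_(u, c <- m x) \sw_(a, b <- u) \sw_(v, r <- m a) \sw_(p, q <- v)
   p ⊗ q ⊗ th r ⊗ b ⊗ c).
  by sw.
rewrite (sw_muT_theta _ _ (F := fun a b p q r => a ⊗ b ⊗ p ⊗ q ⊗ r)) //.
by sw.
Qed.

(** Here the equation of [Hr] applies [mu] to the last factor, whereas [mu_theta] applies it to the
    first; [mu_assoc] makes the passage. *)
Lemma mu_Hr x : exists w, (idfun ⊠ Hr_val t) w = @tassoc k T T^c T (mu t x).
Proof.
apply: (@tens_equalizerr _ _ _ _ _ (Hr_theta_mu t) (Hr_mu_op t) (Hr_val t)).
  move=> u uE; have P : u \in equalizer_pred (Hr_theta_mu t) (Hr_mu_op t).
    by rewrite mem_equalizer; apply/eqP.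
  by exists (Equalizer P).
transitivity ((idfun ⊠ ((idfun ⊠ th ⊠ idfun ⊠ idfun) \o @tflat3 k T T T T \o (idfun ⊠ m)))
  (tassoc (m x))); first by [].
transitivity ((idfun ⊠ ((@tswap13 k T T T \o m) ⊠ idfun)) (tassoc (m x))); last by [].
transitivity (\sw_(u, c <- m x) \sw_(a, b <- u) \sw_(v, r <- m c) \sw_(p, q <- v)
   a ⊗ (b ⊗ th p ⊗ q ⊗ r)).
  by sw.
rewrite -(sw_muT_assoc _ _ (F := fun a b p q r => a ⊗ (b ⊗ th p ⊗ q ⊗ r))) //.
rewrite (sw_muT_theta _ _ (F := fun a b p q r => a ⊗ (b ⊗ p ⊗ q ⊗ r))) //.
by sw.
Qed.

Definition il_inv := inv_iso (iso_l_bij (il_iso s)).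
Definition ir_inv := inv_iso (iso_r_bij (ir_iso s)).

Definition delX : {linear H -> (T ⊗ T)%type} :=
  (Hl_val t \o il_inv : {linear H -> (T ⊗ T^c)%type}).
Definition gamX : {linear H -> (T ⊗ T)%type} :=
  (Hr_val t \o ir_inv : {linear H -> (T^c ⊗ T)%type}).

Lemma delX_inj : injective delX.
Proof. by move=> x y /Hl_val_inj; apply: (can_inj (inv_isoK (iso_l_bij (il_iso s)))). Qed.
Lemma gamX_inj : injective gamX.
Proof. by move=> x y /Hr_val_inj; apply: (can_inj (inv_isoK (iso_r_bij (ir_iso s)))). Qed.

Lemma delX_il y : delX (il s y) = Hl_val t y.
Proof. by rewrite /delX /il_inv /= iso_invK. Qed.
Lemma gamX_ir y : gamX (ir s y) = Hr_val t y.
Proof. by rewrite /gamX /ir_inv /= iso_invK. Qed.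

(** The coaction is the corestriction of [mu] to [Hl ⊗ T], followed by [il] on [Hl]. *)
Lemma lamX_ex : exists l : {lrmorphism T -> H ⊗ T}, forall x, m x = \sw_(h, y <- l x) delX h ⊗ y.
Proof.
have [g gE] : exists g : {lrmorphism T -> Hl t ⊗ T},
    forall x, (Hl_val t ⊠ idfun) (g x) = mu t x.
  by apply: lrmorphism_lift; [exact: (tmap_injl Hl_val_inj) | exact: mu_Hl].
exists ((il s ⊠ idfun) \o g) => x.
transitivity ((Hl_val t ⊠ idfun) (g x)); first by rewrite gE.
transitivity (\sw_(h, y <- (il s ⊠ idfun) (g x)) delX h ⊗ y); last by [].
rewrite !tmap_sw sw_sw //.
apply: eq_sw => a b; rewrite sw_pure //.
by rewrite delX_il.
Qed.

Lemma rhoX_ex : exists r : {lrmorphism T -> T ⊗ H},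
  forall x, tassoc (m x) = \sw_(y, h <- r x) y ⊗ gamX h.
Proof.
have [g gE] : exists g : {lrmorphism T -> T ⊗ Hr t},
    forall x, (idfun ⊠ Hr_val t) (g x) = @tassoc k T T^c T (mu t x).
  apply: (@lrmorphism_lift _ _ _ _ (idfun ⊠ Hr_val t) (@tassoc k T T^c T \o mu t)).
    exact: (tmap_injr Hr_val_inj).
  exact: mu_Hr.
exists ((idfun ⊠ ir s) \o g) => x.
transitivity ((idfun ⊠ Hr_val t) (g x)); first by rewrite gE.
transitivity (\sw_(y, h <- (idfun ⊠ ir s) (g x)) y ⊗ gamX h); last by [].
rewrite !tmap_sw sw_sw //.
apply: eq_sw => a b; rewrite sw_pure //.
by rewrite gamX_ir.
Qed.

Section Laws.
Variables (l : {lrmorphism T -> H ⊗ T}) (r : {lrmorphism T -> T ⊗ H}).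
Hypothesis lE : forall x, m x = \sw_(h, y <- l x) delX h ⊗ y.
Hypothesis rE : forall x, tassoc (m x) = \sw_(y, h <- r x) y ⊗ gamX h.

Lemma sw_muT_l (U : lmodType k) (F : T -> T -> T -> U) x : lin3 F ->
  \sw_(u, c <- m x) \sw_(a, b <- u) F a b c = \sw_(h, y <- l x) \sw_(a, b <- delX h) F a b y.
Proof. by move=> F3; rewrite lE; sw. Qed.

Lemma sw_muT_r (U : lmodType k) (F : T -> T -> T -> U) x : lin3 F ->
  \sw_(u, c <- m x) \sw_(a, b <- u) F a b c = \sw_(y, h <- r x) \sw_(a, b <- gamX h) F y a b.
Proof.
move=> F3; transitivity (\sw_(a, v <- tassoc (m x)) \sw_(b, c <- v) F a b c); first by sw.
by rewrite rE; sw.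
Qed.

(** In this direction colinearity comes first and the Galois identities are derived from it: after
    the injective [delX] on the first factor, it is the compatibility of [il] with coproducts. *)
Lemma delX_lam h : \sw_(a, b <- delX h) \sw_(g, c <- l a) g ⊗ (c ⊗ b) =
  \sw_(a, b <- D h) a ⊗ delX b.
Proof.
apply: (tmap_injl (U := (T ⊗ T)%type) delX_inj).
have [z zE1 zE2] := iso_l_comul (il_iso s) (il_inv h).
have {zE2}zE : z = (il_inv ⊠ il_inv) (D h).
  rewrite inv_isoK in zE2; rewrite -zE2 tmap_comp -[LHS]sw_id tmap_sw.
  by apply: eq_sw => a b /=; rewrite !iso_invK.
transitivity (tassoc ((m ⊠ idfun) (delX h))).
  rewrite tassoc_sw !tmap_sw !sw_sw //.
  apply: eq_sw => a b; rewrite sw_sw ?sw_pure //.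
  by rewrite lE; sw.
transitivity (tassoc ((mu t ⊠ idfun) (Hl_val t (il_inv h) : T ⊗ T) : T ⊗ T ⊗ T ⊗ T)).
  by [].
rewrite -zE1 zE tmap_comp !tmap_sw sw_sw //.
by apply: eq_sw => a b; rewrite sw_pure.
Qed.
Lemma gamX_rho h : \sw_(a, b <- gamX h) \sw_(c, g <- r b) (a ⊗ c) ⊗ g =
  \sw_(a, b <- D h) gamX a ⊗ b.
Proof.
apply: (tmap_injr (U := (T ⊗ T)%type) gamX_inj).
have [z zE1 zE2] := iso_r_comul (ir_iso s) (ir_inv h).
have {zE2}zE : z = (ir_inv ⊠ ir_inv) (D h).
  rewrite inv_isoK in zE2; rewrite -zE2 tmap_comp -[LHS]sw_id tmap_sw.
  by apply: eq_sw => a b /=; rewrite !iso_invK.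
transitivity (tassoc (tflat3 ((idfun ⊠ m) (gamX h)))).
  transitivity (\sw_(a, b <- gamX h) \sw_(c, v <- tassoc (m b)) (a ⊗ c) ⊗ v).
    rewrite tmap_sw sw_sw //.
    by apply: eq_sw => a b; rewrite rE; sw.
  rewrite [RHS]tassoc_sw tflat3_sw tmap_sw !sw_sw //.
  apply: eq_sw => a b; rewrite sw_pure //.
  rewrite tassoc_sw !sw_sw //.
  apply: eq_sw => u c; rewrite !sw_sw //.
  by apply: eq_sw => a' b'; sw.
transitivity (tassoc (tflat3 ((idfun ⊠ mu t) (Hr_val t (ir_inv h) : T ⊗ T)) : T ⊗ T ⊗ T ⊗ T)).
  by [].
rewrite -zE1 zE tmap_comp !tmap_sw sw_sw //.
by apply: eq_sw => a b; rewrite sw_pure.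
Qed.

Lemma sw_delX_lam (U : lmodType k) (F : H -> T -> T -> U) h : lin3 F ->
  \sw_(a, b <- delX h) \sw_(g, c <- l a) F g c b =
  \sw_(h1, h2 <- D h) \sw_(a, b <- delX h2) F h1 a b.
Proof.
by move=> F3; sw_from (congr1 (fun t => \sw_(a, v <- t) \sw_(b, c <- v) F a b c) (delX_lam h)).
Qed.

Lemma sw_gamX_rho (U : lmodType k) (F : T -> T -> H -> U) h : lin3 F ->
  \sw_(a, b <- gamX h) \sw_(c, g <- r b) F a c g =
  \sw_(h1, h2 <- D h) \sw_(a, b <- gamX h1) F a b h2.
Proof.
by move=> F3; sw_from (congr1 (fun t => \sw_(v, c <- t) \sw_(a, b <- v) F a b c) (gamX_rho h)).
Qed.

Lemma delX_mult (U : lmodType k) (F : T -> U) h : lin1 F ->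
  \sw_(a, b <- delX h) F (a * b) = e h *: F 1.
Proof.
move=> F1; have E := iso_l_counit (il_iso s) (il_inv h); rewrite inv_isoK in E.
transitivity (F (tmult (delX h))).
  by rewrite tmult_sw (lin1_sw _ _ (f := F)).
transitivity (F (e h)%:A); first by rewrite -E.
by rewrite lin1_scale.
Qed.

Lemma gamX_mult (U : lmodType k) (F : T -> U) h : lin1 F ->
  \sw_(a, b <- gamX h) F (a * b) = e h *: F 1.
Proof.
move=> F1; have E := iso_r_counit (ir_iso s) (ir_inv h); rewrite inv_isoK in E.
transitivity (F (tmult (gamX h))).
  by rewrite tmult_sw (lin1_sw _ _ (f := F)).
transitivity (F (e h)%:A); first by rewrite -E.
by rewrite lin1_scale.
Qed.

(** Once both [H]-factors are embedded by [delX], this is [mu_assoc]: one side applies [mu] again to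
    the first leg of [mu x], the other to the last leg. *)
Lemma lX_coassoc x : \sw_(h, y <- l x) \sw_(a, b <- D h) a ⊗ b ⊗ y =
                   \sw_(h, y <- l x) \sw_(g, z <- l y) h ⊗ g ⊗ z.
Proof.
apply: (tmap_injl (U := T) (tmap_inj delX_inj delX_inj)).
pose G (a b p q c : T) := (a ⊗ b) ⊗ (p ⊗ q) ⊗ c.
have G5 : lin5 G by rewrite /G; lin.
transitivity (\sw_(h, y <- l x) \sw_(a, b <- delX h) \sw_(g, c <- l a) \sw_(p, q <- delX g) G p q c b y).
  rewrite tmap_sw sw_sw //.
  apply: eq_sw => h y.
  rewrite (sw_delX_lam _ (F := fun g c b => \sw_(p, q <- delX g) G p q c b y)) //.
  rewrite sw_sw //.
  apply: eq_sw => a b; rewrite sw_pure //.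
  rewrite -[X in X ⊗ _]/((delX ⊠ delX) (_ ⊗ _)) tmapE -{1}(sw_id (delX a)) -{1}(sw_id (delX b)) sw_purer sw_purel.
  by apply: eq_sw => c d; rewrite sw_purel sw_purel.
transitivity (\sw_(h, y <- l x) \sw_(g, z <- l y) \sw_(a, b <- delX h) \sw_(p, q <- delX g) G a b p q z).
  transitivity (\sw_(u, c <- m x) \sw_(a, b <- u) \sw_(v, r <- m a) \sw_(p, q <- v) G p q r b c).
    rewrite (sw_muT_l _ (F := fun a b c => \sw_(v, r <- m a) \sw_(p, q <- v) G p q r b c)) //.
    do 2!apply: eq_sw => ? ?.
    by rewrite (sw_muT_l _ (F := fun p q r => G p q r _ _)).
  rewrite (sw_muT_assoc _ _ G5).
  rewrite (sw_muT_l _ (F := fun a b c => \sw_(v, r <- m c) \sw_(p, q <- v) G a b p q r)) //.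
  apply: eq_sw => h y; rewrite [RHS]sw_exch; apply: eq_sw => a b.
  by rewrite (sw_muT_l _ (F := fun p q r => G a b p q r)).
rewrite tmap_sw sw_sw //.
apply: eq_sw => h y; rewrite sw_sw //.
apply: eq_sw => g z; rewrite sw_pure //.
rewrite -[X in X ⊗ _]/((delX ⊠ delX) (_ ⊗ _)) tmapE -{2}(sw_id (delX h)) -{2}(sw_id (delX g)) sw_purel sw_purel.
by apply: eq_sw => c d; rewrite sw_purer sw_purel.
Qed.

Lemma rX_coassoc x : \sw_(y, h <- r x) \sw_(a, b <- D h) y ⊗ a ⊗ b =
                   \sw_(y, h <- r x) \sw_(z, g <- r y) z ⊗ g ⊗ h.
Proof.
apply: (tmap_inj (tmap_injr (U := T) gamX_inj) gamX_inj).
pose G (c a b p q : T) := c ⊗ (a ⊗ b) ⊗ (p ⊗ q).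
have G5 : lin5 G by rewrite /G; lin.
transitivity (\sw_(y, h <- r x) \sw_(a, b <- gamX h) \sw_(c, g <- r b) \sw_(p, q <- gamX g) G y a c p q).
  rewrite tmap_sw sw_sw //.
  apply: eq_sw => y h.
  rewrite (sw_gamX_rho _ (F := fun a c g => \sw_(p, q <- gamX g) G y a c p q)) //.
  rewrite sw_sw //.
  apply: eq_sw => a b; rewrite sw_pure //.
  transitivity ((y ⊗ gamX a) ⊗ gamX b); first by congr (_ ⊗ _); exact: tmapE.
  rewrite -{1}(sw_id (gamX a)) sw_purer sw_purel.
  by apply: eq_sw => c d; rewrite -{1}(sw_id (gamX b)) sw_purer.
transitivity (\sw_(y, h <- r x) \sw_(z, g <- r y) \sw_(a, b <- gamX g) \sw_(p, q <- gamX h) G z a b p q).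
  transitivity (\sw_(u, c <- m x) \sw_(a, b <- u) \sw_(v, r <- m c) \sw_(p, q <- v) G a b p q r).
    rewrite (sw_muT_r _ (F := fun a b c => \sw_(v, r <- m c) \sw_(p, q <- v) G a b p q r)) //.
    do 2!apply: eq_sw => ? ?.
    by rewrite (sw_muT_r _ (F := fun p q r => G _ _ p q r)).
  rewrite -(sw_muT_assoc _ _ G5).
  rewrite (sw_muT_r _ (F := fun a b c => \sw_(v, r <- m a) \sw_(p, q <- v) G p q r b c)) //.
  apply: eq_sw => y h.
  transitivity (\sw_(p, q <- gamX h) \sw_(z, g <- r y) \sw_(a, b <- gamX g) G z a b p q).
    apply: eq_sw => p q.
    by rewrite (sw_muT_r _ (F := fun a b c => G a b c p q)).
  by rewrite sw_exch; apply: eq_sw => z g; rewrite sw_exch.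
rewrite tmap_sw sw_sw //.
apply: eq_sw => h y; rewrite sw_sw //.
apply: eq_sw => g z; rewrite sw_pure //.
transitivity ((g ⊗ gamX z) ⊗ gamX y); last by congr (_ ⊗ _); apply/esym/tmapE.
rewrite -{2}(sw_id (gamX z)) sw_purer sw_purel.
by apply: eq_sw => c d; rewrite -{2}(sw_id (gamX y)) sw_purer.
Qed.

Lemma lX_rX x : \sw_(y, h <- r x) \sw_(g, z <- l y) g ⊗ z ⊗ h =
                     \sw_(g, y <- l x) \sw_(z, h <- r y) g ⊗ z ⊗ h.
Proof.
apply: (tmap_inj (tmap_injl (U := T) delX_inj) gamX_inj).
pose G (a b c p q : T) := (a ⊗ b) ⊗ c ⊗ (p ⊗ q).
have G5 : lin5 G by rewrite /G; lin.
transitivity (\sw_(y, h <- r x) \sw_(p, q <- gamX h) \sw_(g, z <- l y) \sw_(a, b <- delX g) G a b z p q).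
  rewrite tmap_sw sw_sw //.
  apply: eq_sw => y h; rewrite sw_sw; [rewrite [RHS]sw_exch|lin].
  apply: eq_sw => g z; rewrite sw_pure //.
  transitivity ((delX g ⊗ z) ⊗ gamX h); first by congr (_ ⊗ _); exact: tmapE.
  rewrite -{1}(sw_id (gamX h)) -{1}(sw_id (delX g)) sw_purer.
  by apply: eq_sw => c d; rewrite sw_purel sw_purel.
transitivity (\sw_(g, y <- l x) \sw_(a, b <- delX g) \sw_(z, h <- r y) \sw_(p, q <- gamX h) G a b z p q).
  transitivity (\sw_(u, c <- m x) \sw_(a, b <- u) \sw_(v, r <- m a) \sw_(p, q <- v) G p q r b c).
    rewrite (sw_muT_r _ (F := fun a b c => \sw_(v, r <- m a) \sw_(p, q <- v) G p q r b c)) //.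
    do 2!apply: eq_sw => ? ?.
    by rewrite (sw_muT_l _ (F := fun p q r => G p q r _ _)).
  rewrite (sw_muT_assoc _ _ G5).
  rewrite (sw_muT_l _ (F := fun a b c => \sw_(v, r <- m c) \sw_(p, q <- v) G a b p q r)) //.
  do 2!apply: eq_sw => ? ?.
  by rewrite (sw_muT_r _ (F := fun p q r => G _ _ p q r)).
rewrite tmap_sw sw_sw //.
apply: eq_sw => g y; rewrite sw_sw; [rewrite [LHS]sw_exch|lin].
apply: eq_sw => z h; rewrite sw_pure //.
transitivity ((delX g ⊗ z) ⊗ gamX h); last by congr (_ ⊗ _); apply/esym/tmapE.
rewrite -{2}(sw_id (delX g)) sw_purel sw_purel.
by apply: eq_sw => c d; rewrite -{2}(sw_id (gamX h)) sw_purer.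
Qed.

Lemma lX_counit x : \sw_(h, y <- l x) e h *: y = x.
Proof.
apply: (@pure1_inj _ _ T).
rewrite -(sw_muT_unitl t x (F := fun a c => a ⊗ c) ) //.
rewrite (sw_muT_l _ (F := fun a b c => (a * b) ⊗ c)) //.
rewrite (lin1_sw _ _ (f := fun t => (1 : T) ⊗ t)) //.
apply: eq_sw => h y.
rewrite (delX_mult _ (F := fun t => t ⊗ y)) //.
exact: linearZr_LR.
Qed.

Lemma rX_counit x : \sw_(y, h <- r x) e h *: y = x.
Proof.
apply: (@pure1r_inj _ _ T).
rewrite -(sw_muT_unitr t x (F := fun a c => a ⊗ c) ) //.
rewrite (sw_muT_r _ (F := fun a b c => a ⊗ (b * c))) //.
rewrite (lin1_sw _ _ (f := fun t => t ⊗ (1 : T))) //.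
apply: eq_sw => y h.
rewrite (gamX_mult _ (F := fun t => y ⊗ t)) //.
exact: linearZl_LR.
Qed.

Lemma lX_gal h : \sw_(a, b <- delX h) \sw_(g, c <- l a) g ⊗ (c * b) = h ⊗ (1 : T).
Proof.
rewrite (sw_delX_lam _ (F := fun g c b => g ⊗ (c * b))) //.
rewrite -(sw_counitr hH h (F := fun a => a ⊗ (1 : T))) //.
apply: eq_sw => a b.
by rewrite (delX_mult _ (F := fun t => a ⊗ t)).
Qed.

Lemma rX_gal h : \sw_(a, b <- gamX h) \sw_(c, g <- r b) (a * c) ⊗ g = (1 : T) ⊗ h.
Proof.
rewrite (sw_gamX_rho _ (F := fun a c g => (a * c) ⊗ g)) //.
rewrite -(sw_counitl hH h (F := fun a => (1 : T) ⊗ a)) //.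
apply: eq_sw => a b.
by rewrite (gamX_mult _ (F := fun t => t ⊗ b)).
Qed.

Lemma lX_galV x : \sw_(h, y <- l x) \sw_(a, b <- delX h) a ⊗ (b * y) = x ⊗ 1.
Proof.
rewrite -(sw_muT_l _ (F := fun a b c => a ⊗ (b * c))) //.
by rewrite (sw_muT_unitr t x (F := fun a c => a ⊗ c)).
Qed.

Lemma rX_galV x : \sw_(y, h <- r x) \sw_(a, b <- gamX h) (y * a) ⊗ b = 1 ⊗ x.
Proof.
rewrite -(sw_muT_r _ (F := fun a b c => (a * b) ⊗ c)) //.
by rewrite (sw_muT_unitl t x (F := fun a c => a ⊗ c)).
Qed.

Definition bigalX : bigal hH T :=
  Bigal lX_coassoc lX_counit rX_coassoc rX_counit lX_rX lX_gal lX_galV rX_gal rX_galV.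

Lemma sw_Hl (U : lmodType k) (F : T -> T -> T -> T -> U) h : lin4 F ->
  \sw_(a, b <- delX h) \sw_(g, c <- l a) \sw_(p, q <- delX g) F p q (th c) b =
  \sw_(a, b <- delX h) \sw_(g, c <- l b) \sw_(p, q <- delX g) F a c q p.
Proof.
move=> F4; have := equalizerP (il_inv h); rewrite mem_equalizer => /eqP E.
have {}E : (idfun ⊠ idfun ⊠ th ⊠ idfun) ((m ⊠ idfun) (delX h)) =
    tflat3 ((idfun ⊠ (@tswap13 k T T T \o m)) (delX h)) by exact: E.
pose L (t : T ⊗ T ⊗ T ⊗ T) := \sw_(y, d <- t) \sw_(z, c <- y) \sw_(a, b <- z) F a b c d.
refine (etrans _ (etrans (congr1 L E) _)); rewrite /L.
  rewrite !tmap_sw !sw_sw //.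
  apply: eq_sw => a b.
  transitivity (\sw_(u, c <- m a) \sw_(p, q <- u) F p q (th c) b); last by sw.
  by rewrite (sw_muT_l _ (F := fun p q c => F p q (th c) b)).
rewrite tflat3_sw !tmap_sw !sw_sw //.
apply: eq_sw => a b.
transitivity (\sw_(u, c <- m b) \sw_(p, q <- u) F a c q p); first by sw.
by rewrite (sw_muT_l _ (F := fun p q c => F a c q p)).
Qed.

(** With a unit factor in front, [delX (S h)] stands next to a contracted [delX h1], so
    [sw_del_lam2] reads it as a coaction on a second leg. The equation of [Hl] moves that coaction
    to the first leg and introduces theta; colinearity and a contraction then remove the extra
    factor. *)
Lemma thX_del h : delX (S h) = \sw_(a, b <- delX h) b ⊗ th a.
Proof.
apply: (@pure1_inj _ _ T).
pose F (p q c b : T) := (p * q) ⊗ (b ⊗ c).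
have F4 : lin4 F by rewrite /F; lin.
transitivity (\sw_(h1, h2 <- D h) \sw_(a, b <- delX h1) \sw_(p, q <- delX (S h2)) F a b q p).
  transitivity (\sw_(h1, h2 <- D h) (e h1 : k) *: ((1 : T) ⊗ delX (S h2))).
    by rewrite (sw_counitl _ (F := fun g => (1 : T) ⊗ delX (S g))).
  apply: eq_sw => h1 h2.
  rewrite -(delX_mult _ (F := fun t => t ⊗ delX (S h2))) //.
  by apply: eq_sw => a b; rewrite -{1}(sw_id (delX (S h2))) sw_purer.
rewrite -(sw_del_lam2 bigalX _ (F := fun a g b => \sw_(p, q <- delX g) F a b q p)) //.
rewrite -(sw_Hl _ F4).
rewrite (sw_delX_lam _ (F := fun g c b => \sw_(p, q <- delX g) F p q (th c) b)) //.
transitivity (\sw_(h1, h2 <- D h) (e h1 : k) *: ((1 : T) ⊗ \sw_(a, b <- delX h2) b ⊗ th a)); last first.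
  by rewrite (sw_counitl _ (F := fun g => (1 : T) ⊗ \sw_(a, b <- delX g) b ⊗ th a)).
apply: eq_sw => h1 h2; rewrite sw_exch.
rewrite -(delX_mult _ (F := fun t => t ⊗ \sw_(a, b <- delX h2) b ⊗ th a)) //.
by apply: eq_sw => a b; rewrite sw_purer.
Qed.

Lemma representsX : represents s bigalX.
Proof.
split=> [y|y|x|].
- exact/esym/delX_il.
- exact/esym/gamX_ir.
- exact: lE.
- split; [exact: theta_bij | exact: thX_del].
Qed.

End Laws.

Lemma septuple_represented : exists B, represents s B.
Proof.
have [l lE] := lamX_ex; have [r rE] := rhoX_ex.
by exists (bigalX lE rE); exact: representsX.
Qed.

End Extract.

(** * Translation maps under the coactions of the opposite side *)

Section MoreTheory.
Variables (k : fieldType) (H : algType k) (hH : hopf H) (T : algType k) (B : bigal hH T).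
Variable U : lmodType k.
Local Notation S := (antipode hH).
Local Notation lam := (lam B).
Local Notation rho := (rho B).
Local Notation del := (del B).
Local Notation gam := (gam B).

(** Coinvariance of [del h] under the diagonal right coaction. The sum containing [rho (y * b)] is
    evaluated in two ways: by [gall], which replaces [y * b] by 1, and by multiplicativity and the
    commutation of the coactions, after which [gallV] restores the first leg. *)
Lemma sw_del_coinv (F : T -> T -> H -> U) h : lin3 F ->
  \sw_(a, b <- del h) \sw_(c, g <- rho a) \sw_(b', g' <- rho b) F c b' (g * g') =
  \sw_(a, b <- del h) F a b 1.
Proof.
move=> F3.
transitivity (\sw_(a, b <- del h) \sw_(k, y <- lam a) \sw_(z, g <- rho (y * b))
    \sw_(p, q <- del k) F p (q * z) g).
  apply: eq_sw => a b.
  transitivity (\sw_(k, y <- lam a) \sw_(z, g <- rho y) \sw_(b', g' <- rho b)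
      \sw_(p, q <- del k) F p (q * (z * b')) (g * g')); last first.
    apply: eq_sw => c y; rewrite (sw_rhoM _ _ _ (F := fun z g => \sw_(p, q <- del c) F p (q * z) g)) //.
  rewrite -(sw_lamrho B _ (F := fun k z g => \sw_(b', g' <- rho b)
      \sw_(p, q <- del k) F p (q * (z * b')) (g * g'))) //.
  apply: eq_sw => c g; rewrite [RHS]sw_exch; apply: eq_sw => b' g'.
  transitivity (\sw_(k, z <- lam c) \sw_(p, q <- del k) F p (q * z * b') (g * g')).
    by rewrite (sw_gallV B _ (F := fun p q => F p (q * b') (g * g'))) ?mul1r.
  by do !apply: eq_sw => ? ?; rewrite mulrA.
rewrite (sw_gall B _ (F := fun k y => \sw_(z, g <- rho y) \sw_(p, q <- del k) F p (q * z) g)) //.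
rewrite rmorph1 sw_one //.
by do !apply: eq_sw => ? ?; rewrite mulr1.
Qed.

Lemma sw_gam_coinv (F : H -> T -> T -> U) h : lin3 F ->
  \sw_(a, b <- gam h) \sw_(g, c <- lam a) \sw_(g', b' <- lam b) F (g * g') c b' =
  \sw_(a, b <- gam h) F 1 a b.
Proof.
move=> F3.
transitivity (\sw_(a, b <- gam h) \sw_(y, k <- rho b) \sw_(g, z <- lam (a * y))
    \sw_(p, q <- gam k) F g (z * p) q).
  apply: eq_sw => a b.
  transitivity (\sw_(y, k <- rho b) \sw_(g', b' <- lam y) \sw_(g, c <- lam a)
      \sw_(p, q <- gam k) F (g * g') (c * b' * p) q); last first.
    apply: eq_sw => y c; rewrite (sw_lamM _ _ _ (F := fun g z => \sw_(p, q <- gam c) F g (z * p) q)).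
      by rewrite [RHS]sw_exch.
    by lin.
  rewrite (sw_lamrho B _ (F := fun g' b' k => \sw_(g, c <- lam a)
      \sw_(p, q <- gam k) F (g * g') (c * b' * p) q)) //.
  rewrite sw_exch; apply: eq_sw => g' b'; rewrite [RHS]sw_exch; apply: eq_sw => g c.
  transitivity (\sw_(z, k <- rho b') \sw_(p, q <- gam k) F (g * g') (c * (z * p)) q).
    by rewrite (sw_galrV B _ (F := fun p q => F (g * g') (c * p) q)) ?mulr1.
  by do !apply: eq_sw => ? ?; rewrite mulrA.
rewrite (sw_galr B _ (F := fun y k => \sw_(g, z <- lam y) \sw_(p, q <- gam k) F g (z * p) q)) //.
rewrite rmorph1 sw_one //.
by do !apply: eq_sw => ? ?; rewrite mul1r.
Qed.

(** Multiply the coinvariance identity by the antipode of a further coefficient of the first leg;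
    the two coefficients of that leg cancel. *)
Lemma sw_del_rho (F : T -> T -> H -> U) h : lin3 F ->
  \sw_(a, b <- del h) \sw_(c, g <- rho b) F a c g =
  \sw_(a, b <- del h) \sw_(c, g <- rho a) F c b (S g).
Proof.
move=> F3; apply: esym.
transitivity (\sw_(a, b <- del h) \sw_(c, g <- rho a) F c b (S g * 1)).
  by do !apply: eq_sw => ? ?; rewrite mulr1.
rewrite -(sw_del_coinv _ (F := fun a b t => \sw_(c, g <- rho a) F c b (S g * t))) //.
apply: eq_sw => a b.
transitivity (\sw_(b', g' <- rho b) \sw_(c, g <- rho a) \sw_(c', g'' <- rho c) F c' b' (S g'' * g * g')).
  rewrite sw_exch; do 3!apply: eq_sw => ? ?; by rewrite mulrA.
apply: eq_sw => b' g'.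
rewrite -(sw_rhoA B _ (F := fun c' g'' g => F c' b' (S g'' * g * g'))) //.
rewrite -(sw_rho1 B _ (F := fun a => F a b' g')) //.
apply: eq_sw => c g.
by rewrite (sw_antipodel _ _ (F := fun t => F c b' (t * g'))) ?mul1r.
Qed.

Lemma sw_gam_lam (F : H -> T -> T -> U) h : lin3 F ->
  \sw_(a, b <- gam h) \sw_(g, c <- lam a) F g c b =
  \sw_(a, b <- gam h) \sw_(g, c <- lam b) F (S g) a c.
Proof.
move=> F3; apply: esym.
transitivity (\sw_(a, b <- gam h) \sw_(g, c <- lam b) F (1 * S g) a c).
  by do !apply: eq_sw => ? ?; rewrite mul1r.
rewrite -(sw_gam_coinv _ (F := fun t a b => \sw_(g, c <- lam b) F (t * S g) a c)) //.
apply: eq_sw => a b; apply: eq_sw => g c.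
transitivity (\sw_(g', b' <- lam b) \sw_(g'', c' <- lam b') F (g * (g' * S g'')) c c').
  by do 2!apply: eq_sw => ? ?; rewrite mulrA.
rewrite -(sw_lamA B _ (F := fun g' g'' c' => F (g * (g' * S g'')) c c')) //.
rewrite -(sw_lam1 B _ (F := fun b => F g c b)) //.
apply: eq_sw => g' b'.
by rewrite (sw_antipoder _ _ (F := fun t => F (g * t) c b')) ?mulr1.
Qed.

End MoreTheory.

(** * Trivial and opposite bi-Galois algebras *)

Section Trivial.
Variables (k : fieldType) (H : algType k) (hH : hopf H).
Local Notation D := (comul hH).
Local Notation e := (counit hH).
Local Notation S := (antipode hH).

Definition del0 (h : H) : H ⊗ H := \sw_(a, b <- D h) a ⊗ S b.
Definition gam0 (h : H) : H ⊗ H := \sw_(a, b <- D h) S a ⊗ b.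

Lemma del0_linear : linear del0.
Proof. by have : lin1 del0 by rewrite /del0; lin. Qed.
Lemma gam0_linear : linear gam0.
Proof. by have : lin1 gam0 by rewrite /gam0; lin. Qed.

HB.instance Definition _ := GRing.isLinear.Build k H (H ⊗ H)%type _ del0 del0_linear.
HB.instance Definition _ := GRing.isLinear.Build k H (H ⊗ H)%type _ gam0 gam0_linear.

Lemma sw_del0 (U : lmodType k) (F : H -> H -> U) h : lin2 F ->
  \sw_(a, b <- del0 h) F a b = \sw_(a, b <- D h) F a (S b).
Proof. by move=> F2; rewrite /del0; sw. Qed.

Lemma sw_gam0 (U : lmodType k) (F : H -> H -> U) h : lin2 F ->
  \sw_(a, b <- gam0 h) F a b = \sw_(a, b <- D h) F (S a) b.
Proof. by move=> F2; rewrite /gam0; sw. Qed.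

Lemma comul_coassoc x : \sw_(h, y <- D x) \sw_(a, b <- D h) a ⊗ b ⊗ y =
  \sw_(h, y <- D x) \sw_(g, z <- D y) h ⊗ g ⊗ z.
Proof. by rewrite (sw_comulA _ _ (F := fun a b c => a ⊗ b ⊗ c)). Qed.

Lemma comul_counitl x : \sw_(h, y <- D x) e h *: y = x.
Proof. by rewrite (sw_counitl _ _ (F := fun y => y)). Qed.

Lemma comul_counitr x : \sw_(y, h <- D x) e h *: y = x.
Proof. by rewrite (sw_counitr _ _ (F := fun y => y)). Qed.

Lemma del0_gal h : \sw_(a, b <- del0 h) \sw_(g, c <- D a) g ⊗ (c * b) = h ⊗ (1 : H).
Proof.
rewrite (sw_del0 _ (F := fun a b => \sw_(g, c <- D a) g ⊗ (c * b))) //.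
rewrite (sw_comulA _ _ (F := fun g c b => g ⊗ (c * S b))) //.
rewrite -(sw_counitr hH h (F := fun a => a ⊗ (1 : H))) //.
apply: eq_sw => a b.
by rewrite (sw_antipoder _ _ (F := fun t => a ⊗ t)).
Qed.

Lemma del0_galV x : \sw_(h, y <- D x) \sw_(a, b <- del0 h) a ⊗ (b * y) = x ⊗ 1.
Proof.
transitivity (\sw_(h, y <- D x) \sw_(a, b <- D h) a ⊗ (S b * y)).
  apply: eq_sw => h y; by rewrite (sw_del0 _ (F := fun a b => a ⊗ (b * y))).
rewrite (sw_comulA _ _ (F := fun a b y => a ⊗ (S b * y))) //.
rewrite -(sw_counitr hH x (F := fun a => a ⊗ (1 : H))) //.
apply: eq_sw => a b.
by rewrite (sw_antipodel _ _ (F := fun t => a ⊗ t)).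
Qed.

Lemma gam0_gal h : \sw_(a, b <- gam0 h) \sw_(c, g <- D b) (a * c) ⊗ g = (1 : H) ⊗ h.
Proof.
rewrite (sw_gam0 _ (F := fun a b => \sw_(c, g <- D b) (a * c) ⊗ g)) //.
rewrite -(sw_comulA _ _ (F := fun a c g => (S a * c) ⊗ g)) //.
rewrite -(sw_counitl hH h (F := fun a => (1 : H) ⊗ a)) //.
apply: eq_sw => a b.
by rewrite (sw_antipodel _ _ (F := fun t => t ⊗ b)).
Qed.

Lemma gam0_galV x : \sw_(y, h <- D x) \sw_(a, b <- gam0 h) (y * a) ⊗ b = 1 ⊗ x.
Proof.
transitivity (\sw_(y, h <- D x) \sw_(a, b <- D h) (y * S a) ⊗ b).
  apply: eq_sw => y h; by rewrite (sw_gam0 _ (F := fun a b => (y * a) ⊗ b)).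
rewrite -(sw_comulA _ _ (F := fun y a b => (y * S a) ⊗ b)) //.
rewrite -(sw_counitl hH x (F := fun a => (1 : H) ⊗ a)) //.
apply: eq_sw => a b.
by rewrite (sw_antipoder _ _ (F := fun t => t ⊗ b)).
Qed.

Definition triv : bigal hH H :=
  @Bigal k H hH H D D del0 gam0 comul_coassoc comul_counitl
    (fun x => esym (comul_coassoc x)) comul_counitr
    comul_coassoc del0_gal del0_galV gam0_gal gam0_galV.

Definition S2 (x : H) := S (S x).

Lemma S2_linear : linear S2. Proof. by have : lin1 S2 by rewrite /S2; lin. Qed.
Lemma S2_monoid_morphism : monoid_morphism S2.
Proof. by split=> [|x y]; rewrite /S2 ?antipode1 // !antipodeM. Qed.

HB.instance Definition _ := GRing.isLinear.Build k H H _ S2 S2_linear.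
HB.instance Definition _ := GRing.isMonoidMorphism.Build H H S2 S2_monoid_morphism.

Lemma triv_theta : bijective (S \o S) -> bigal_theta triv (S2 : {lrmorphism H -> H}).
Proof.
move=> Sb; split=> // h /=.
by rewrite {1}/del0 sw_comul_antipode ?sw_del0.
Qed.

End Trivial.

Section Opposite.
Variables (k : fieldType) (H : algType k) (hH : hopf H) (T : algType k).
Local Notation D := (comul hH).
Local Notation e := (counit hH).
Local Notation S := (antipode hH).
Variables (Si : {linear H -> H}) (SK : cancel S Si) (SiK : cancel Si S).
Variables (B : bigal hH T) (th : {lrmorphism T -> T}) (thP : bigal_theta B th).
Local Notation lam := (lam B).
Local Notation rho := (rho B).
Local Notation del := (del B).
Local Notation gam := (gam B).

Definition lamO (x : T^c) : H ⊗ T^c := \sw_(y, h <- rho x) Si h ⊗ y.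
Definition rhoO (x : T^c) : T^c ⊗ H := \sw_(h, y <- lam x) y ⊗ Si h.
(** In the presence of theta, [th_gam] and [th_del] turn [delO h] and [gamO h] into
    [(idfun ⊠ th) (gam h)] and [(th ⊠ idfun) (del h)], the inverses of the isomorphisms prescribed
    for the opposite torsor. The antipode here cancels the inverse antipode of [lamO] and [rhoO] in
    the Galois identities. *)
Definition delO (h : H) : T^c ⊗ T^c := \sw_(a, b <- gam (S h)) b ⊗ a.
Definition gamO (h : H) : T^c ⊗ T^c := \sw_(a, b <- del (S h)) b ⊗ a.

Lemma lamO_linear : linear lamO.
Proof. by have : lin1 (lamO : T -> H ⊗ T) by rewrite /lamO; lin. Qed.
Lemma rhoO_linear : linear rhoO.
Proof. by have : lin1 (rhoO : T -> T ⊗ H) by rewrite /rhoO; lin. Qed.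
Lemma delO_linear : linear delO.
Proof. by have : lin1 (delO : H -> T ⊗ T) by rewrite /delO; lin. Qed.
Lemma gamO_linear : linear gamO.
Proof. by have : lin1 (gamO : H -> T ⊗ T) by rewrite /gamO; lin. Qed.

Lemma lamO_monoid_morphism : monoid_morphism lamO.
Proof.
split=> [|x y].
  rewrite /lamO (rmorph1 rho) sw_one //.
  by rewrite (antipodeV1 SK).
transitivity (\sw_(p, g <- rho y) \sw_(q, h <- rho x) Si (g * h) ⊗ (p * q) : H ⊗ T).
  by apply: (sw_rhoM B (y : T) (x : T) (F := fun p g => Si g ⊗ p)); lin.
transitivity (\sw_(q, h <- rho x) \sw_(p, g <- rho y) (Si h * Si g) ⊗ (p * q) : H ⊗ T).
  by rewrite sw_exch; do 2!apply: eq_sw => ? ?; rewrite (antipodeVM SK SiK).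
rewrite tmul_sw /lamO.
(* The second factors multiply in [T^c], that is, in reverse order in [T]; [G] makes this visible to
   [sw]. *)
pose G (u : H) (v : T) (u' : H) (v' : T) : H ⊗ T := (u * u') ⊗ (v' * v).
transitivity (\sw_(u, v <- \sw_(y, h <- rho x) Si h ⊗ y)
  \sw_(u', v' <- \sw_(y, h <- rho y) Si h ⊗ y) G u v u' v'); last by [].
rewrite /G; sw.
Qed.

Lemma rhoO_monoid_morphism : monoid_morphism rhoO.
Proof.
split=> [|x y].
  rewrite /rhoO (rmorph1 lam) sw_one //.
  by rewrite (antipodeV1 SK).
transitivity (\sw_(g, p <- lam y) \sw_(h, q <- lam x) (p * q) ⊗ Si (g * h) : T ⊗ H).
  by apply: (sw_lamM B (y : T) (x : T) (F := fun g p => p ⊗ Si g)); lin.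
transitivity (\sw_(h, q <- lam x) \sw_(g, p <- lam y) (p * q) ⊗ (Si h * Si g) : T ⊗ H).
  by rewrite sw_exch; do 2!apply: eq_sw => ? ?; rewrite (antipodeVM SK SiK).
rewrite tmul_sw /rhoO.
pose G (v : T) (u : H) (v' : T) (u' : H) : T ⊗ H := (v' * v) ⊗ (u * u').
transitivity (\sw_(v, u <- \sw_(h, y <- lam x) y ⊗ Si h)
  \sw_(v', u' <- \sw_(h, y <- lam y) y ⊗ Si h) G v u v' u'); last by [].
rewrite /G; sw.
Qed.

HB.instance Definition _ := GRing.isLinear.Build k T^c (H ⊗ T^c)%type _ lamO lamO_linear.
HB.instance Definition _ := GRing.isMonoidMorphism.Build T^c (H ⊗ T^c)%type lamO lamO_monoid_morphism.
HB.instance Definition _ := GRing.isLinear.Build k T^c (T^c ⊗ H)%type _ rhoO rhoO_linear.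
HB.instance Definition _ := GRing.isMonoidMorphism.Build T^c (T^c ⊗ H)%type rhoO rhoO_monoid_morphism.
HB.instance Definition _ := GRing.isLinear.Build k H (T^c ⊗ T^c)%type _ delO delO_linear.
HB.instance Definition _ := GRing.isLinear.Build k H (T^c ⊗ T^c)%type _ gamO gamO_linear.

Lemma sw_lamO (U : lmodType k) (F : H -> T -> U) x : lin2 F ->
  \sw_(h, y <- (lamO x : H ⊗ T)) F h y = \sw_(y, h <- rho x) F (Si h) y.
Proof. by move=> F2; rewrite /lamO; sw. Qed.

Lemma sw_rhoO (U : lmodType k) (F : T -> H -> U) x : lin2 F ->
  \sw_(y, h <- (rhoO x : T ⊗ H)) F y h = \sw_(h, y <- lam x) F y (Si h).
Proof. by move=> F2; rewrite /rhoO; sw. Qed.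

Lemma sw_delO (U : lmodType k) (F : T -> T -> U) h : lin2 F ->
  \sw_(a, b <- (delO h : T ⊗ T)) F a b = \sw_(a, b <- gam (S h)) F b a.
Proof. by move=> F2; rewrite /delO; sw. Qed.

Lemma sw_gamO (U : lmodType k) (F : T -> T -> U) h : lin2 F ->
  \sw_(a, b <- (gamO h : T ⊗ T)) F a b = \sw_(a, b <- del (S h)) F b a.
Proof. by move=> F2; rewrite /gamO; sw. Qed.

Definition lamOT : {linear T -> (H ⊗ T)%type} := (lamO : {linear T^c -> (H ⊗ T^c)%type}).
Definition rhoOT : {linear T -> (T ⊗ H)%type} := (rhoO : {linear T^c -> (T^c ⊗ H)%type}).

Lemma lamO_coassoc (x : T) : \sw_(h, y <- lamOT x) \sw_(a, b <- D h) a ⊗ b ⊗ y =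
  \sw_(h, y <- lamOT x) \sw_(g, z <- lamOT y) h ⊗ g ⊗ z.
Proof.
rewrite (sw_lamO _ (F := fun h y => \sw_(a, b <- D h) a ⊗ b ⊗ y)) //.
rewrite (sw_lamO _ (F := fun h y => \sw_(g, z <- lamOT y) h ⊗ g ⊗ z)) //.
transitivity (\sw_(y, h <- rho x) \sw_(z, g <- rho y) Si h ⊗ Si g ⊗ z); last first.
  apply: eq_sw => y h.
  by rewrite (sw_lamO _ (F := fun g z => Si h ⊗ g ⊗ z)).
rewrite -(sw_rhoA B _ (F := fun z g h => Si h ⊗ Si g ⊗ z)) //.
apply: eq_sw => y h.
by rewrite (sw_comul_antipodeV SK SiK (F := fun a b => a ⊗ b ⊗ y)).
Qed.

Lemma rhoO_coassoc (x : T) : \sw_(y, h <- rhoOT x) \sw_(a, b <- D h) y ⊗ a ⊗ b =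
  \sw_(y, h <- rhoOT x) \sw_(z, g <- rhoOT y) z ⊗ g ⊗ h.
Proof.
rewrite (sw_rhoO _ (F := fun y h => \sw_(a, b <- D h) y ⊗ a ⊗ b)) //.
rewrite (sw_rhoO _ (F := fun y h => \sw_(z, g <- rhoOT y) z ⊗ g ⊗ h)) //.
transitivity (\sw_(h, y <- lam x) \sw_(g, z <- lam y) z ⊗ Si g ⊗ Si h); last first.
  apply: eq_sw => h y.
  by rewrite (sw_rhoO _ (F := fun z g => z ⊗ g ⊗ Si h)).
rewrite -(sw_lamA B _ (F := fun h g z => z ⊗ Si g ⊗ Si h)) //.
apply: eq_sw => h y.
by rewrite (sw_comul_antipodeV SK SiK (F := fun a b => y ⊗ a ⊗ b)).
Qed.

Lemma lamO_counit (x : T) : \sw_(h, y <- lamOT x) e h *: y = x.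
Proof.
rewrite (sw_lamO _ (F := fun h y => e h *: y)) //.
rewrite -[RHS](rho1 B); apply: eq_sw => y h.
by rewrite (counit_antipodeV SiK).
Qed.

Lemma rhoO_counit (x : T) : \sw_(y, h <- rhoOT x) e h *: y = x.
Proof.
rewrite (sw_rhoO _ (F := fun y h => e h *: y)) //.
rewrite -[RHS](lam1 B); apply: eq_sw => y h.
by rewrite (counit_antipodeV SiK).
Qed.

Lemma lamO_rhoO (x : T) : \sw_(y, h <- rhoOT x) \sw_(g, z <- lamOT y) g ⊗ z ⊗ h =
  \sw_(g, y <- lamOT x) \sw_(z, h <- rhoOT y) g ⊗ z ⊗ h.
Proof.
rewrite (sw_rhoO _ (F := fun y h => \sw_(g, z <- lamOT y) g ⊗ z ⊗ h)) //.
rewrite (sw_lamO _ (F := fun g y => \sw_(z, h <- rhoOT y) g ⊗ z ⊗ h)) //.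
transitivity (\sw_(h, y <- lam x) \sw_(z, g <- rho y) Si g ⊗ z ⊗ Si h).
  apply: eq_sw => h y.
  by rewrite (sw_lamO _ (F := fun g z => g ⊗ z ⊗ Si h)).
rewrite -(sw_lamrho B _ (F := fun h z g => Si g ⊗ z ⊗ Si h)) //.
apply: eq_sw => h y.
by rewrite (sw_rhoO _ (F := fun z g => Si y ⊗ z ⊗ g)).
Qed.

Lemma lamO_gal h : \sw_(a, b <- (delO h : T ⊗ T)) \sw_(g, c <- lamOT a) g ⊗ (b * c) = h ⊗ (1 : T).
Proof.
rewrite (sw_delO _ (F := fun a b => \sw_(g, c <- lamOT a) g ⊗ (b * c))) //.
rewrite -{2}[h]SK -(sw_galr B (S h) (F := fun t g => Si g ⊗ t)) //.
apply: eq_sw => a b.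
by rewrite (sw_lamO _ (F := fun g c => g ⊗ (a * c))).
Qed.

Lemma lamO_galV (x : T) : \sw_(h, y <- lamOT x) \sw_(a, b <- (delO h : T ⊗ T)) a ⊗ (y * b) = x ⊗ (1 : T).
Proof.
rewrite (sw_lamO _ (F := fun h y => \sw_(a, b <- (delO h : T ⊗ T)) a ⊗ (y * b))) //.
rewrite -(sw_galrV B x (F := fun p q => q ⊗ p)) //.
apply: eq_sw => y h.
by rewrite (sw_delO _ (F := fun a b => a ⊗ (y * b))) ?SiK.
Qed.

Lemma rhoO_gal h : \sw_(a, b <- (gamO h : T ⊗ T)) \sw_(c, g <- rhoOT b) (c * a) ⊗ g = (1 : T) ⊗ h.
Proof.
rewrite (sw_gamO _ (F := fun a b => \sw_(c, g <- rhoOT b) (c * a) ⊗ g)) //.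
rewrite -{2}[h]SK -(sw_gall B (S h) (F := fun g t => t ⊗ Si g)) //.
apply: eq_sw => a b.
by rewrite (sw_rhoO _ (F := fun c g => (c * b) ⊗ g)).
Qed.

Lemma rhoO_galV (x : T) : \sw_(y, h <- rhoOT x) \sw_(a, b <- (gamO h : T ⊗ T)) (a * y) ⊗ b = (1 : T) ⊗ x.
Proof.
rewrite (sw_rhoO _ (F := fun y h => \sw_(a, b <- (gamO h : T ⊗ T)) (a * y) ⊗ b)) //.
rewrite -(sw_gallV B x (F := fun p q => q ⊗ p)) //.
apply: eq_sw => h y.
by rewrite (sw_gamO _ (F := fun a b => (a * y) ⊗ b)) ?SiK.
Qed.

Definition opp : bigal hH T^c :=
  @Bigal k H hH T^c lamO rhoO delO gamO lamO_coassoc lamO_counit rhoO_coassoc rhoO_counit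
    lamO_rhoO lamO_gal lamO_galV rhoO_gal rhoO_galV.

Definition thO (x : T^c) : T^c := th x.

Lemma thO_linear : linear thO. Proof. exact: (linearP th). Qed.
Lemma thO_monoid_morphism : monoid_morphism thO.
Proof. by split=> [|x y]; [exact: (rmorph1 th) | exact: (rmorphM th y x)]. Qed.

HB.instance Definition _ := GRing.isLinear.Build k T^c T^c _ thO thO_linear.
HB.instance Definition _ := GRing.isMonoidMorphism.Build T^c T^c thO thO_monoid_morphism.

Lemma opp_theta : bigal_theta opp (thO : {lrmorphism T^c -> T^c}).
Proof.
split; first exact: (th_bij thP).
move=> h; transitivity (\sw_(a, b <- (delO h : T ⊗ T)) b ⊗ th a); last by [].
rewrite (sw_delO _ (F := fun a b => b ⊗ th a)) //.
transitivity (\sw_(a, b <- gam (S (S h))) b ⊗ a); first by [].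
by rewrite (sw_th_gam thP _ (F := fun a b => b ⊗ a)).
Qed.

End Opposite.

(** * Cotensor products *)

Section Cotensor.
Variables (k : fieldType) (H : algType k) (hH : hopf H) (T1 T2 : algType k).
Variables (B1 : bigal hH T1) (B2 : bigal hH T2).
Local Notation D := (comul hH).
Local Notation e := (counit hH).
Local Notation S := (antipode hH).
Local Notation lam1 := (lam B1).
Local Notation rho1 := (rho B1).
Local Notation del1 := (del B1).
Local Notation gam1 := (gam B1).
Local Notation lam2 := (lam B2).
Local Notation rho2 := (rho B2).
Local Notation del2 := (del B2).
Local Notation gam2 := (gam B2).

Definition cotl : {linear (T1 ⊗ T2)%type -> (T1 ⊗ H ⊗ T2)%type} := rho1 ⊠ idfun.
Definition cotr : {linear (T1 ⊗ T2)%type -> (T1 ⊗ H ⊗ T2)%type} :=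
  @tassocI k T1 H T2 \o (idfun ⊠ lam2).

Lemma cotl_sw z : cotl z = \sw_(x, y <- z) \sw_(c, h <- rho1 x) c ⊗ h ⊗ y.
Proof.
transitivity (\sw_(x, y <- z) rho1 x ⊗ y); first by [].
by apply: eq_sw => x y; rewrite -{1}(sw_id (rho1 x)) sw_purel.
Qed.

Lemma cotr_sw z : cotr z = \sw_(x, y <- z) \sw_(h, c <- lam2 y) x ⊗ h ⊗ c.
Proof.
transitivity (tassocI ((idfun ⊠ lam2) z)); first by [].
by sw.
Qed.

(* v identifies P with the cotensor product T1 □_H T2. *)
Record is_cotensor (P : algType k) (v : {lrmorphism P -> T1 ⊗ T2}) : Prop := IsCotensor {
  cot_inj : injective v;
  cot_eq : forall p, cotl (v p) = cotr (v p);
  cot_ex : forall z, cotl z = cotr z -> exists p, v p = z }.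

Section Product.
Variables (P : algType k) (v : {lrmorphism P -> T1 ⊗ T2}) (vP : is_cotensor v).

Lemma sw_cot (U : lmodType k) (F : T1 -> H -> T2 -> U) p : lin3 F ->
  \sw_(x, y <- v p) \sw_(c, h <- rho1 x) F c h y =
  \sw_(x, y <- v p) \sw_(h, c <- lam2 y) F x h c.
Proof.
move=> F3; have E := cot_eq vP p; rewrite cotl_sw cotr_sw in E.
by sw_from (congr1 (fun t => \sw_(u, c <- t) \sw_(a, b <- u) F a b c) E).
Qed.

(** [lam1] commutes with [rho1], hence preserves the equation of the cotensor product; exactness
    puts its values in [H ⊗ P]. *)
Lemma lamP_ex : exists l : {lrmorphism P -> H ⊗ P}, forall p,
  (idfun ⊠ v) (l p) = tassoc ((lam1 ⊠ idfun) (v p)).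
Proof.
apply: (@lrmorphism_lift _ _ _ _ (idfun ⊠ v) (@tassoc k H T1 T2 \o (lam1 ⊠ idfun) \o v)).
  exact: (tmap_injr (cot_inj vP)).
move=> p; apply: (tens_equalizerr (f := cotl) (g := cotr)); first exact: (cot_ex vP).
transitivity (\sw_(x, y <- v p) \sw_(c, h <- rho1 x) \sw_(g, z <- lam1 c) g ⊗ (z ⊗ h ⊗ y)).
  transitivity (\sw_(x, y <- v p) \sw_(g, z <- lam1 x) g ⊗ cotl (z ⊗ y)).
    transitivity ((idfun ⊠ cotl) (tassoc ((lam1 ⊠ idfun) (v p)))); first by [].
    by sw.
  apply: eq_sw => x y.
  rewrite (sw_lamrho B1 _ (F := fun g z h => g ⊗ (z ⊗ h ⊗ y))) //.
  by apply: eq_sw => g z; rewrite cotl_sw sw_pure // sw_purer.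
rewrite (sw_cot _ (F := fun c h y => \sw_(g, z <- lam1 c) g ⊗ (z ⊗ h ⊗ y))) //.
transitivity (\sw_(x, y <- v p) \sw_(g, z <- lam1 x) g ⊗ cotr (z ⊗ y)); last first.
  transitivity ((idfun ⊠ cotr) (tassoc ((lam1 ⊠ idfun) (v p)))); last by [].
  by sw.
apply: eq_sw => x y; rewrite sw_exch; apply: eq_sw => g z.
by rewrite cotr_sw sw_pure // sw_purer.
Qed.

Lemma rhoP_ex : exists r : {lrmorphism P -> P ⊗ H}, forall p,
  (v ⊠ idfun) (r p) = tassocI ((idfun ⊠ rho2) (v p)).
Proof.
apply: (@lrmorphism_lift _ _ _ _ (v ⊠ idfun) (@tassocI k T1 T2 H \o (idfun ⊠ rho2) \o v)).
  exact: (tmap_injl (cot_inj vP)).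
move=> p; apply: (tens_equalizerl (f := cotl) (g := cotr)); first exact: (cot_ex vP).
transitivity (\sw_(x, y <- v p) \sw_(h, c <- lam2 y) \sw_(z, g <- rho2 c) (x ⊗ h ⊗ z) ⊗ g).
  transitivity (\sw_(x, y <- v p) \sw_(z, g <- rho2 y) cotl (x ⊗ z) ⊗ g).
    transitivity ((cotl ⊠ idfun) (tassocI ((idfun ⊠ rho2) (v p)))); first by [].
    by sw.
  rewrite -(sw_cot _ (F := fun x h c => \sw_(z, g <- rho2 c) (x ⊗ h ⊗ z) ⊗ g)) //.
  apply: eq_sw => x y; rewrite [RHS]sw_exch; apply: eq_sw => z g.
  by rewrite cotl_sw sw_pure // sw_purel.
transitivity (\sw_(x, y <- v p) \sw_(z, g <- rho2 y) cotr (x ⊗ z) ⊗ g); last first.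
  transitivity ((cotr ⊠ idfun) (tassocI ((idfun ⊠ rho2) (v p)))); last by [].
  by sw.
apply: eq_sw => x y.
rewrite -(sw_lamrho B2 _ (F := fun h z g => (x ⊗ h ⊗ z) ⊗ g)) //.
apply: eq_sw => z g.
by rewrite cotr_sw sw_pure // sw_purel.
Qed.

(** The right coefficient [g] of the first leg of [del1 h] is translated through [T2]. Replacing
    [del2 g] by the counit of [g] gives back [del1 h], in agreement with the isomorphism [il]
    prescribed for the product. *)
Definition delT (h : H) : T1 ⊗ T2 ⊗ (T1 ⊗ T2) :=
  \sw_(a, b <- del1 h) \sw_(c, g <- rho1 a) \sw_(p, q <- del2 g) (c ⊗ p) ⊗ (b ⊗ q).

Definition gamT (h : H) : T1 ⊗ T2 ⊗ (T1 ⊗ T2) :=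
  \sw_(c, d <- gam2 h) \sw_(g, y <- lam2 d) \sw_(p, q <- gam1 g) (p ⊗ c) ⊗ (q ⊗ y).

Lemma delT_linear : linear delT.
Proof. by have : lin1 delT by rewrite /delT; lin. Qed.
Lemma gamT_linear : linear gamT.
Proof. by have : lin1 gamT by rewrite /gamT; lin. Qed.
HB.instance Definition _ := GRing.isLinear.Build k H (T1 ⊗ T2 ⊗ (T1 ⊗ T2))%type _ delT delT_linear.
HB.instance Definition _ := GRing.isLinear.Build k H (T1 ⊗ T2 ⊗ (T1 ⊗ T2))%type _ gamT gamT_linear.

(** The cotensor equation is needed on each of the two factors [T1 ⊗ T2]. On the first it is
    coassociativity of [rho1] against colinearity of [del2]; on the second both coactions hit second
    legs and produce the same antipode, by [sw_del_rho] and [sw_del_lam2]. *)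
Lemma delP_ex : exists d : {linear H -> (P ⊗ P)%type}, forall h, (v ⊠ v) (d h) = delT h.
Proof.
apply: (linear_lift (i := v ⊠ v) (f := delT)).
  exact: (tmap_inj (cot_inj vP) (cot_inj vP)).
move=> h; apply: (tens_equalizer2 (f := cotl) (g := cotr)).
- exact: (cot_inj vP).
- exact: (cot_ex vP).
- transitivity (\sw_(a, b <- del1 h) \sw_(c, g <- rho1 a) \sw_(p, q <- del2 g)
     cotl (c ⊗ p) ⊗ (b ⊗ q)); first by rewrite /delT; sw.
  transitivity (\sw_(a, b <- del1 h) \sw_(c, g <- rho1 a) \sw_(p, q <- del2 g)
     cotr (c ⊗ p) ⊗ (b ⊗ q)); last by rewrite /delT; sw.
  apply: eq_sw => a b.
  transitivity (\sw_(c, g <- rho1 a) \sw_(c', h' <- rho1 c) \sw_(p, q <- del2 g)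
     (c' ⊗ h' ⊗ p) ⊗ (b ⊗ q)).
    apply: eq_sw => c g; rewrite [RHS]sw_exch; apply: eq_sw => p q.
    by rewrite cotl_sw sw_pure // sw_purel.
  rewrite -(sw_rhoA B1 _ (F := fun c h g => \sw_(p, q <- del2 g) (c ⊗ h ⊗ p) ⊗ (b ⊗ q))) //.
  apply: eq_sw => c g.
  rewrite -(sw_del_lam B2 _ (F := fun h p q => (c ⊗ h ⊗ p) ⊗ (b ⊗ q))) //.
  apply: eq_sw => p q.
  by rewrite cotr_sw sw_pure // sw_purel.
- transitivity (\sw_(a, b <- del1 h) \sw_(c, g <- rho1 a) \sw_(p, q <- del2 g)
     (c ⊗ p) ⊗ cotl (b ⊗ q)); first by rewrite /delT; sw.
  transitivity (\sw_(a, b <- del1 h) \sw_(c, g <- rho1 a) \sw_(p, q <- del2 g)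
     (c ⊗ p) ⊗ cotr (b ⊗ q)); last by rewrite /delT; sw.
  transitivity (\sw_(a, b <- del1 h) \sw_(b', h' <- rho1 b) \sw_(c, g <- rho1 a) \sw_(p, q <- del2 g)
     (c ⊗ p) ⊗ (b' ⊗ h' ⊗ q)).
    apply: eq_sw => a b; rewrite [RHS]sw_exch; apply: eq_sw => c g.
    rewrite [RHS]sw_exch; apply: eq_sw => p q.
    by rewrite cotl_sw sw_pure // sw_purer.
  rewrite (sw_del_rho B1 _ (F := fun a b h => \sw_(c, g <- rho1 a) \sw_(p, q <- del2 g)
     (c ⊗ p) ⊗ (b ⊗ h ⊗ q))) //.
  apply: eq_sw => a b.
  rewrite -(sw_rhoA B1 _ (F := fun c g g' => \sw_(p, q <- del2 g)
     (c ⊗ p) ⊗ (b ⊗ S g' ⊗ q))) //.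
  apply: eq_sw => c g.
  rewrite -(sw_del_lam2 B2 _ (F := fun p h q => (c ⊗ p) ⊗ (b ⊗ h ⊗ q))) //.
  apply: eq_sw => p q.
  by rewrite cotr_sw sw_pure // sw_purer.
Qed.

Lemma gamP_ex : exists d : {linear H -> (P ⊗ P)%type}, forall h, (v ⊠ v) (d h) = gamT h.
Proof.
apply: (linear_lift (i := v ⊠ v) (f := gamT)).
  exact: (tmap_inj (cot_inj vP) (cot_inj vP)).
move=> h; apply: (tens_equalizer2 (f := cotl) (g := cotr)).
- exact: (cot_inj vP).
- exact: (cot_ex vP).
- transitivity (\sw_(c, d <- gam2 h) \sw_(g, y <- lam2 d) \sw_(p, q <- gam1 g)
     cotl (p ⊗ c) ⊗ (q ⊗ y)); first by rewrite /gamT; sw.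
  transitivity (\sw_(c, d <- gam2 h) \sw_(g, y <- lam2 d) \sw_(p, q <- gam1 g)
     cotr (p ⊗ c) ⊗ (q ⊗ y)); last by rewrite /gamT; sw.
  apply: esym.
  transitivity (\sw_(c, d <- gam2 h) \sw_(k', c' <- lam2 c) \sw_(g, y <- lam2 d) \sw_(p, q <- gam1 g)
     (p ⊗ k' ⊗ c') ⊗ (q ⊗ y)).
    apply: eq_sw => c d; rewrite [RHS]sw_exch; apply: eq_sw => g y.
    rewrite [RHS]sw_exch; apply: eq_sw => p q.
    by rewrite cotr_sw sw_pure // sw_purel.
  rewrite (sw_gam_lam B2 _ (F := fun k' c d => \sw_(g, y <- lam2 d) \sw_(p, q <- gam1 g)
     (p ⊗ k' ⊗ c) ⊗ (q ⊗ y))) //.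
  apply: eq_sw => c d.
  rewrite -(sw_lamA B2 _ (F := fun k' g y => \sw_(p, q <- gam1 g)
     (p ⊗ S k' ⊗ c) ⊗ (q ⊗ y))) //.
  apply: eq_sw => g y.
  rewrite -(sw_gam_rho2 B1 _ (F := fun p h q => (p ⊗ h ⊗ c) ⊗ (q ⊗ y))) //.
  apply: eq_sw => p q.
  by rewrite cotl_sw sw_pure // sw_purel.
- transitivity (\sw_(c, d <- gam2 h) \sw_(g, y <- lam2 d) \sw_(p, q <- gam1 g)
     (p ⊗ c) ⊗ cotl (q ⊗ y)); first by rewrite /gamT; sw.
  transitivity (\sw_(c, d <- gam2 h) \sw_(g, y <- lam2 d) \sw_(p, q <- gam1 g)
     (p ⊗ c) ⊗ cotr (q ⊗ y)); last by rewrite /gamT; sw.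
  apply: eq_sw => c d; apply: esym.
  transitivity (\sw_(g, y <- lam2 d) \sw_(h', y' <- lam2 y) \sw_(p, q <- gam1 g)
     (p ⊗ c) ⊗ (q ⊗ h' ⊗ y')).
    apply: eq_sw => g y; rewrite [RHS]sw_exch; apply: eq_sw => p q.
    by rewrite cotr_sw sw_pure // sw_purer.
  rewrite -(sw_lamA B2 _ (F := fun g h y => \sw_(p, q <- gam1 g) (p ⊗ c) ⊗ (q ⊗ h ⊗ y))) //.
  apply: eq_sw => g y.
  rewrite -(sw_gam_rho B1 _ (F := fun p q h => (p ⊗ c) ⊗ (q ⊗ h ⊗ y))) //.
  apply: eq_sw => p q.
  by rewrite cotl_sw sw_pure // sw_purer.
Qed.

Section Laws.
Variables (l : {lrmorphism P -> H ⊗ P}) (r : {lrmorphism P -> P ⊗ H}).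
Variables (d c : {linear H -> (P ⊗ P)%type}).
Hypothesis lE : forall p, (idfun ⊠ v) (l p) = tassoc ((lam1 ⊠ idfun) (v p)).
Hypothesis rE : forall p, (v ⊠ idfun) (r p) = tassocI ((idfun ⊠ rho2) (v p)).
Hypothesis dE : forall h, (v ⊠ v) (d h) = delT h.
Hypothesis cE : forall h, (v ⊠ v) (c h) = gamT h.

Lemma sw_lamP (U : lmodType k) (F : H -> T1 -> T2 -> U) p : lin3 F ->
  \sw_(h, q <- l p) \sw_(x, y <- v q) F h x y = \sw_(x, y <- v p) \sw_(h, z <- lam1 x) F h z y.
Proof.
move=> F3.
by sw_from (congr1 (fun t => \sw_(h, u <- t) \sw_(x, y <- u) F h x y) (lE p)).
Qed.

Lemma sw_rhoP (U : lmodType k) (F : T1 -> T2 -> H -> U) p : lin3 F ->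
  \sw_(q, h <- r p) \sw_(x, y <- v q) F x y h = \sw_(x, y <- v p) \sw_(z, h <- rho2 y) F x z h.
Proof.
move=> F3.
by sw_from (congr1 (fun t => \sw_(u, h <- t) \sw_(x, y <- u) F x y h) (rE p)).
Qed.

Lemma sw_delP (U : lmodType k) (F : T1 -> T2 -> T1 -> T2 -> U) h : lin4 F ->
  \sw_(s, t <- d h) \sw_(x, y <- v s) \sw_(x', y' <- v t) F x y x' y' =
  \sw_(a, b <- del1 h) \sw_(c, g <- rho1 a) \sw_(p, q <- del2 g) F c p b q.
Proof.
move=> F4.
have := congr1 (fun t => \sw_(u, w <- t) \sw_(x, y <- u) \sw_(x', y' <- w) F x y x' y') (dE h).
by rewrite /delT => E; sw_from E.
Qed.

Lemma sw_gamP (U : lmodType k) (F : T1 -> T2 -> T1 -> T2 -> U) h : lin4 F ->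
  \sw_(s, t <- c h) \sw_(x, y <- v s) \sw_(x', y' <- v t) F x y x' y' =
  \sw_(c, d <- gam2 h) \sw_(g, y <- lam2 d) \sw_(p, q <- gam1 g) F p c q y.
Proof.
move=> F4.
have := congr1 (fun t => \sw_(u, w <- t) \sw_(x, y <- u) \sw_(x', y' <- w) F x y x' y') (cE h).
by rewrite /gamT => E; sw_from E.
Qed.

Lemma v_mul_sw (U : lmodType k) (F : T1 -> T2 -> U) p q : lin2 F ->
  \sw_(x, y <- v (p * q)) F x y =
  \sw_(x, y <- v p) \sw_(x', y' <- v q) F (x * x') (y * y').
Proof. by move=> F2; rewrite rmorphM sw_mul. Qed.

Lemma v_expandr (U : lmodType k) (u : U) q : u ⊗ v q = \sw_(x, y <- v q) u ⊗ (x ⊗ y).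
Proof. by rewrite -{1}(sw_id (v q)) sw_purer. Qed.

Lemma v_expandl (U : lmodType k) (u : U) q : v q ⊗ u = \sw_(x, y <- v q) (x ⊗ y) ⊗ u.
Proof. by rewrite -{1}(sw_id (v q)) sw_purel. Qed.

Lemma lP_coassoc p : \sw_(h, y <- l p) \sw_(a, b <- D h) a ⊗ b ⊗ y =
  \sw_(h, y <- l p) \sw_(g, z <- l y) h ⊗ g ⊗ z.
Proof.
apply: (tmap_injr (U := (H ⊗ H)%type) (cot_inj vP)).
transitivity (\sw_(h, q <- l p) \sw_(x, y <- v q) \sw_(a, b <- D h) (a ⊗ b) ⊗ (x ⊗ y)).
  rewrite tmap_sw sw_sw //.
  apply: eq_sw => h q; rewrite sw_sw //.
  rewrite [RHS]sw_exch; apply: eq_sw => a b; rewrite sw_pure //.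
  exact: v_expandr.
transitivity (\sw_(h, q <- l p) \sw_(g, z <- l q) \sw_(x, y <- v z) (h ⊗ g) ⊗ (x ⊗ y)); last first.
  rewrite [RHS]tmap_sw [RHS]sw_sw //.
  apply: eq_sw => h q; rewrite [RHS]sw_sw //.
  apply: eq_sw => g z; rewrite sw_pure //.
  exact/esym/v_expandr.
rewrite (sw_lamP _ (F := fun h x y => \sw_(a, b <- D h) (a ⊗ b) ⊗ (x ⊗ y))) //.
transitivity (\sw_(h, q <- l p) \sw_(x, y <- v q) \sw_(g, z <- lam1 x) (h ⊗ g) ⊗ (z ⊗ y)); last first.
  apply: eq_sw => h q.
  by rewrite (sw_lamP _ (F := fun g x y => (h ⊗ g) ⊗ (x ⊗ y))).
rewrite (sw_lamP _ (F := fun h x y => \sw_(g, z <- lam1 x) (h ⊗ g) ⊗ (z ⊗ y))) //.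
apply: eq_sw => x y.
by rewrite (sw_lamA B1 _ (F := fun h g z => (h ⊗ g) ⊗ (z ⊗ y))).
Qed.

Lemma rP_coassoc p : \sw_(y, h <- r p) \sw_(a, b <- D h) y ⊗ a ⊗ b =
  \sw_(y, h <- r p) \sw_(z, g <- r y) z ⊗ g ⊗ h.
Proof.
apply: (tmap_injl (tmap_injl (U := H) (cot_inj vP))).
transitivity (\sw_(q, h <- r p) \sw_(x, y <- v q) \sw_(a, b <- D h) (x ⊗ y) ⊗ a ⊗ b).
  rewrite tmap_sw sw_sw //.
  apply: eq_sw => q h; rewrite sw_sw //.
  rewrite [RHS]sw_exch; apply: eq_sw => a b; rewrite sw_pure //.
  transitivity (v q ⊗ a ⊗ b); first by congr (_ ⊗ _); exact: tmapE.
  by rewrite v_expandl sw_purel.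
transitivity (\sw_(q, h <- r p) \sw_(z, g <- r q) \sw_(x, y <- v z) (x ⊗ y) ⊗ g ⊗ h); last first.
  rewrite [RHS]tmap_sw [RHS]sw_sw //.
  apply: eq_sw => q h; rewrite [RHS]sw_sw //.
  apply: eq_sw => z g; rewrite sw_pure //.
  transitivity (v z ⊗ g ⊗ h); last by congr (_ ⊗ _); exact/esym/tmapE.
  by rewrite v_expandl sw_purel.
rewrite (sw_rhoP _ (F := fun x y h => \sw_(a, b <- D h) (x ⊗ y) ⊗ a ⊗ b)) //.
transitivity (\sw_(q, h <- r p) \sw_(x, y <- v q) \sw_(z, g <- rho2 y) (x ⊗ z) ⊗ g ⊗ h); last first.
  apply: eq_sw => q h.
  by rewrite (sw_rhoP _ (F := fun x y g => (x ⊗ y) ⊗ g ⊗ h)).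
rewrite (sw_rhoP _ (F := fun x y h => \sw_(z, g <- rho2 y) (x ⊗ z) ⊗ g ⊗ h)) //.
apply: eq_sw => x y.
by rewrite (sw_rhoA B2 _ (F := fun z g h => (x ⊗ z) ⊗ g ⊗ h)).
Qed.

Lemma lP_counit p : \sw_(h, y <- l p) e h *: y = p.
Proof.
apply: (cot_inj vP); rewrite (lin1_sw _ _ (f := v)) //.
transitivity (\sw_(h, q <- l p) \sw_(x, y <- v q) (e h : k) *: (x ⊗ y)).
  by apply: eq_sw => h q; rewrite sw_scale sw_id; exact: linearZ.
rewrite (sw_lamP _ (F := fun h x y => (e h : k) *: (x ⊗ y))) //.
rewrite -[RHS]sw_id; apply: eq_sw => x y.
by rewrite (sw_lam1 B1 _ (F := fun z => z ⊗ y)).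
Qed.

Lemma rP_counit p : \sw_(y, h <- r p) e h *: y = p.
Proof.
apply: (cot_inj vP); rewrite (lin1_sw _ _ (f := v)) //.
transitivity (\sw_(q, h <- r p) \sw_(x, y <- v q) (e h : k) *: (x ⊗ y)).
  by apply: eq_sw => q h; rewrite sw_scale sw_id; exact: linearZ.
rewrite (sw_rhoP _ (F := fun x y h => (e h : k) *: (x ⊗ y))) //.
rewrite -[RHS]sw_id; apply: eq_sw => x y.
by rewrite (sw_rho1 B2 _ (F := fun z => x ⊗ z)).
Qed.

Lemma lP_rP p : \sw_(y, h <- r p) \sw_(g, z <- l y) g ⊗ z ⊗ h =
  \sw_(g, y <- l p) \sw_(z, h <- r y) g ⊗ z ⊗ h.
Proof.
apply: (tmap_injl (tmap_injr (U := H) (cot_inj vP))).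
transitivity (\sw_(q, h <- r p) \sw_(g, z <- l q) \sw_(x, y <- v z) g ⊗ (x ⊗ y) ⊗ h).
  rewrite tmap_sw sw_sw //.
  apply: eq_sw => q h; rewrite sw_sw //.
  apply: eq_sw => g z; rewrite sw_pure //.
  transitivity (g ⊗ v z ⊗ h); first by congr (_ ⊗ _); exact: tmapE.
  by rewrite v_expandr sw_purel.
transitivity (\sw_(g, q <- l p) \sw_(z, h <- r q) \sw_(x, y <- v z) g ⊗ (x ⊗ y) ⊗ h); last first.
  rewrite [RHS]tmap_sw [RHS]sw_sw //.
  apply: eq_sw => g q; rewrite [RHS]sw_sw //.
  apply: eq_sw => z h; rewrite sw_pure //.
  transitivity (g ⊗ v z ⊗ h); last by congr (_ ⊗ _); exact/esym/tmapE.
  by rewrite v_expandr sw_purel.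
transitivity (\sw_(q, h <- r p) \sw_(x, y <- v q) \sw_(g, z <- lam1 x) g ⊗ (z ⊗ y) ⊗ h).
  apply: eq_sw => q h.
  by rewrite (sw_lamP _ (F := fun g x y => g ⊗ (x ⊗ y) ⊗ h)).
rewrite (sw_rhoP _ (F := fun x y h => \sw_(g, z <- lam1 x) g ⊗ (z ⊗ y) ⊗ h)) //.
transitivity (\sw_(g, q <- l p) \sw_(x, y <- v q) \sw_(z, h <- rho2 y) g ⊗ (x ⊗ z) ⊗ h); last first.
  apply: eq_sw => g q.
  by rewrite (sw_rhoP _ (F := fun x y h => g ⊗ (x ⊗ y) ⊗ h)).
rewrite (sw_lamP _ (F := fun g x y => \sw_(z, h <- rho2 y) g ⊗ (x ⊗ z) ⊗ h)) //.
by apply: eq_sw => x y; rewrite sw_exch.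
Qed.

Lemma lP_gal h : \sw_(a, b <- d h) \sw_(g, q <- l a) g ⊗ (q * b) = h ⊗ (1 : P).
Proof.
apply: (tmap_injr (U := H) (cot_inj vP)).
transitivity (\sw_(a, b <- d h) \sw_(g, q <- l a) \sw_(x, y <- v q) \sw_(x', y' <- v b)
    g ⊗ ((x * x') ⊗ (y * y'))).
  rewrite tmap_sw sw_sw //.
  apply: eq_sw => a b; rewrite sw_sw //.
  apply: eq_sw => g q; rewrite sw_pure //.
  by rewrite v_expandr v_mul_sw.
transitivity (\sw_(a, b <- d h) \sw_(x, y <- v a) \sw_(x', y' <- v b) \sw_(g, z <- lam1 x)
    g ⊗ ((z * x') ⊗ (y * y'))).
  apply: eq_sw => a b.
  rewrite (sw_lamP _ (F := fun g x y => \sw_(x', y' <- v b) g ⊗ ((x * x') ⊗ (y * y')))) //.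
  by apply: eq_sw => x y; rewrite sw_exch.
rewrite (sw_delP _ (F := fun x y x' y' => \sw_(g, z <- lam1 x) g ⊗ ((z * x') ⊗ (y * y')))) //.
transitivity (\sw_(a, b <- del1 h) \sw_(c, n <- rho1 a) e n *:
   (\sw_(g, z <- lam1 c) g ⊗ ((z * b) ⊗ (1 : T2)))).
  apply: eq_sw => a b; apply: eq_sw => c' n.
  by rewrite (sw_del_mult B2 _ (F := fun t => \sw_(g, z <- lam1 c') g ⊗ ((z * b) ⊗ t))).
transitivity (\sw_(a, b <- del1 h) \sw_(g, z <- lam1 a) g ⊗ ((z * b) ⊗ (1 : T2))).
  apply: eq_sw => a b.
  by rewrite (sw_rho1 B1 _ (F := fun c => \sw_(g, z <- lam1 c) g ⊗ ((z * b) ⊗ (1 : T2)))).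
rewrite (sw_gall B1 _ (F := fun g t => g ⊗ (t ⊗ (1 : T2)))) //.
by rewrite tmapE /= (rmorph1 v).
Qed.

(** [gallV] of [T1] leaves a translation in [T2] at the right coefficient of [x]; the cotensor
    equation makes it the left coefficient of [y], to which [gallV] of [T2] applies. *)
Lemma lP_galV p : \sw_(h, q <- l p) \sw_(a, b <- d h) a ⊗ (b * q) = p ⊗ 1.
Proof.
apply: (tmap_inj (cot_inj vP) (cot_inj vP)).
transitivity (\sw_(h, q <- l p) \sw_(x, y <- v q) \sw_(a, b <- d h) \sw_(x1, y1 <- v a) \sw_(x2, y2 <- v b)
    (x1 ⊗ y1) ⊗ ((x2 * x) ⊗ (y2 * y))).
  rewrite tmap_sw sw_sw //.
  apply: eq_sw => h q; rewrite sw_sw //.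
  rewrite [RHS]sw_exch; apply: eq_sw => a b; rewrite sw_pure //.
  rewrite v_expandl [RHS]sw_exch; apply: eq_sw => x1 y1.
  rewrite v_expandr v_mul_sw //.
  exact: sw_exch.
rewrite (sw_lamP _ (F := fun h x y => \sw_(a, b <- d h) \sw_(x1, y1 <- v a) \sw_(x2, y2 <- v b)
    (x1 ⊗ y1) ⊗ ((x2 * x) ⊗ (y2 * y)))) //.
transitivity (\sw_(x, y <- v p) \sw_(h, z <- lam1 x) \sw_(a, b <- del1 h) \sw_(c, g <- rho1 a)
    \sw_(s, t <- del2 g) (c ⊗ s) ⊗ ((b * z) ⊗ (t * y))).
  apply: eq_sw => x y; apply: eq_sw => h z.
  by rewrite (sw_delP _ (F := fun x1 y1 x2 y2 => (x1 ⊗ y1) ⊗ ((x2 * z) ⊗ (y2 * y)))).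
transitivity (\sw_(x, y <- v p) \sw_(c, g <- rho1 x) \sw_(s, t <- del2 g)
    (c ⊗ s) ⊗ ((1 : T1) ⊗ (t * y))).
  apply: eq_sw => x y.
  by rewrite (sw_gallV B1 _ (F := fun a w => \sw_(c, g <- rho1 a) \sw_(s, t <- del2 g)
    (c ⊗ s) ⊗ (w ⊗ (t * y)))) //.
rewrite (sw_cot _ (F := fun c g y => \sw_(s, t <- del2 g) (c ⊗ s) ⊗ ((1 : T1) ⊗ (t * y)))) //.
transitivity (\sw_(x, y <- v p) (x ⊗ y) ⊗ ((1 : T1) ⊗ (1 : T2))).
  apply: eq_sw => x y.
  by rewrite (sw_gallV B2 _ (F := fun s t => (x ⊗ s) ⊗ ((1 : T1) ⊗ t))).
by rewrite tmapE (rmorph1 v) v_expandl.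
Qed.

Lemma rP_gal h : \sw_(a, b <- c h) \sw_(q, g <- r b) (a * q) ⊗ g = (1 : P) ⊗ h.
Proof.
apply: (tmap_injl (U := H) (cot_inj vP)).
transitivity (\sw_(a, b <- c h) \sw_(x, y <- v a) \sw_(q, g <- r b) \sw_(x', y' <- v q)
    ((x * x') ⊗ (y * y')) ⊗ g).
  rewrite tmap_sw sw_sw //.
  apply: eq_sw => a b; rewrite sw_sw //.
  rewrite [RHS]sw_exch; apply: eq_sw => g q; rewrite sw_pure //.
  by rewrite v_expandl v_mul_sw.
transitivity (\sw_(a, b <- c h) \sw_(x, y <- v a) \sw_(x', y' <- v b) \sw_(z, g <- rho2 y')
    ((x * x') ⊗ (y * z)) ⊗ g).
  apply: eq_sw => a b; apply: eq_sw => x y.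
  by rewrite (sw_rhoP _ (F := fun x' y' g => ((x * x') ⊗ (y * y')) ⊗ g)).
rewrite (sw_gamP _ (F := fun x y x' y' => \sw_(z, g <- rho2 y') ((x * x') ⊗ (y * z)) ⊗ g)) //.
transitivity (\sw_(s, t <- gam2 h) \sw_(n, y <- lam2 t) e n *:
   (\sw_(z, g <- rho2 y) ((1 : T1) ⊗ (s * z)) ⊗ g)).
  apply: eq_sw => s t; apply: eq_sw => n y.
  by rewrite (sw_gam_mult B1 _ (F := fun t => \sw_(z, g <- rho2 y) (t ⊗ (s * z)) ⊗ g)).
transitivity (\sw_(s, t <- gam2 h) \sw_(z, g <- rho2 t) ((1 : T1) ⊗ (s * z)) ⊗ g).
  apply: eq_sw => s t.
  by rewrite (sw_lam1 B2 _ (F := fun y => \sw_(z, g <- rho2 y) ((1 : T1) ⊗ (s * z)) ⊗ g)).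
rewrite (sw_galr B2 _ (F := fun t g => ((1 : T1) ⊗ t) ⊗ g)) //.
by rewrite tmapE /= (rmorph1 v).
Qed.

Lemma rP_galV p : \sw_(q, h <- r p) \sw_(a, b <- c h) (q * a) ⊗ b = 1 ⊗ p.
Proof.
apply: (tmap_inj (cot_inj vP) (cot_inj vP)).
transitivity (\sw_(q, h <- r p) \sw_(x, y <- v q) \sw_(a, b <- c h) \sw_(x1, y1 <- v a) \sw_(x2, y2 <- v b)
    ((x * x1) ⊗ (y * y1)) ⊗ (x2 ⊗ y2)).
  rewrite tmap_sw sw_sw //.
  apply: eq_sw => h q; rewrite sw_sw //.
  rewrite [RHS]sw_exch; apply: eq_sw => a b; rewrite sw_pure //.
  rewrite v_expandl v_mul_sw //.
  by do 2!apply: eq_sw => ? ?; rewrite v_expandr.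
rewrite (sw_rhoP _ (F := fun x y h => \sw_(a, b <- c h) \sw_(x1, y1 <- v a) \sw_(x2, y2 <- v b)
    ((x * x1) ⊗ (y * y1)) ⊗ (x2 ⊗ y2))) //.
transitivity (\sw_(x, y <- v p) \sw_(z, h <- rho2 y) \sw_(s, t <- gam2 h) \sw_(g, y2 <- lam2 t)
    \sw_(m, n <- gam1 g) ((x * m) ⊗ (z * s)) ⊗ (n ⊗ y2)).
  apply: eq_sw => x y; apply: eq_sw => z h.
  by rewrite (sw_gamP _ (F := fun x1 y1 x2 y2 => ((x * x1) ⊗ (z * y1)) ⊗ (x2 ⊗ y2))).
transitivity (\sw_(x, y <- v p) \sw_(g, y2 <- lam2 y) \sw_(m, n <- gam1 g)
    ((x * m) ⊗ (1 : T2)) ⊗ (n ⊗ y2)).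
  apply: eq_sw => x y.
  by rewrite (sw_galrV B2 _ (F := fun w t => \sw_(g, y2 <- lam2 t)
    \sw_(m, n <- gam1 g) ((x * m) ⊗ w) ⊗ (n ⊗ y2))) //.
rewrite -(sw_cot _ (F := fun x g y => \sw_(m, n <- gam1 g) ((x * m) ⊗ (1 : T2)) ⊗ (n ⊗ y))) //.
transitivity (\sw_(x, y <- v p) ((1 : T1) ⊗ (1 : T2)) ⊗ (x ⊗ y)).
  apply: eq_sw => x y.
  by rewrite (sw_galrV B1 _ (F := fun s t => (s ⊗ (1 : T2)) ⊗ (t ⊗ y))).
by rewrite tmapE (rmorph1 v) v_expandr.
Qed.

Definition bigalP : bigal hH P :=
  Bigal lP_coassoc lP_counit rP_coassoc rP_counit lP_rP lP_gal lP_galV rP_gal rP_galV.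

End Laws.

Record is_product_bigal (B : bigal hH P) : Prop := IsProductBigal {
  prod_lam : forall p, (idfun ⊠ v) (lam B p) = tassoc ((lam1 ⊠ idfun) (v p));
  prod_rho : forall p, (v ⊠ idfun) (rho B p) = tassocI ((idfun ⊠ rho2) (v p));
  prod_del : forall h, (v ⊠ v) (del B h) = delT h;
  prod_gam : forall h, (v ⊠ v) (gam B h) = gamT h }.

Lemma product_bigal : exists B : bigal hH P, is_product_bigal B.
Proof.
have [l lE] := lamP_ex; have [r rE] := rhoP_ex.
have [d dE] := delP_ex; have [c cE] := gamP_ex.
by exists (bigalP lE rE dE cE).
Qed.

Variables (th1 : {lrmorphism T1 -> T1}) (th2 : {lrmorphism T2 -> T2}).
Hypothesis th1P : bigal_theta B1 th1.
Hypothesis th2P : bigal_theta B2 th2.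

Lemma cotl_th z : cotl ((th1 ⊠ th2) z) = (th1 ⊠ @S2 k H hH ⊠ th2) (cotl z).
Proof.
rewrite !cotl_sw tmap_sw sw_sw //.
rewrite [RHS]tmap_sw [RHS]sw_sw //.
apply: eq_sw => x y; rewrite sw_pure //.
rewrite (rho_th th1P _ (F := fun c h => c ⊗ h ⊗ th2 y)) //.
rewrite [RHS]sw_sw //.
by apply: eq_sw => c h; sw.
Qed.

Lemma cotr_th z : cotr ((th1 ⊠ th2) z) = (th1 ⊠ @S2 k H hH ⊠ th2) (cotr z).
Proof.
rewrite !cotr_sw tmap_sw sw_sw //.
rewrite [RHS]tmap_sw [RHS]sw_sw //.
apply: eq_sw => x y; rewrite sw_pure //.
rewrite (lam_th th2P _ (F := fun h c => th1 x ⊗ h ⊗ c)) //.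
rewrite [RHS]sw_sw //.
by apply: eq_sw => c h; sw.
Qed.

(** Under [th1 ⊠ th2] both coactions are twisted by the same [S2], so the cotensor product is
    preserved; injectivity of the twist shows the same for the inverse map. In [th_del] for the
    product, the antipode produced by [sw_del_rho] is the one consumed by [th_del] of [T2]. *)
Lemma product_theta (S_inj : injective S) B : is_product_bigal B ->
  exists2 th : {lrmorphism P -> P}, bigal_theta B th &
    forall p, v (th p) = (th1 ⊠ th2) (v p).
Proof.
move=> BP.
have S2i : injective (@S2 k H hH) by move=> x y /S_inj/S_inj.
have i1 := bij_inj (th_bij th1P); have i2 := bij_inj (th_bij th2P).
have [th thb thE] : exists2 th : {lrmorphism P -> P}, bijective th &
    forall p, v (th p) = (th1 ⊠ th2) (v p).
  apply: (@lrmorphism_iso _ _ _ _ ((th1 ⊠ th2) \o v) v).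
  - by move=> x y /= /(tmap_inj i1 i2)/(cot_inj vP).
  - exact: (cot_inj vP).
  - move=> p; apply: (cot_ex vP).
    exact: (etrans (cotl_th _) (etrans (congr1 _ (cot_eq vP p)) (esym (cotr_th _)))).
  - move=> p.
    pose g1 := inv_iso (th_bij th1P); pose g2 := inv_iso (th_bij th2P).
    have gE z : (th1 ⊠ th2) ((g1 ⊠ g2) z) = z.
      rewrite -[RHS]sw_id !tmap_sw sw_sw //.
      by apply: eq_sw => a b; rewrite sw_pure ?inv_isoK.
    have [q qE] : exists q, v q = (g1 ⊠ g2) (v p).
      apply: (cot_ex vP).
      apply: (tmap_inj (tmap_inj i1 S2i) i2).
      by rewrite -cotl_th -cotr_th !gE (cot_eq vP).
    by exists q; rewrite /= qE gE.
exists th => //; split=> // h.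
apply: (tmap_inj (cot_inj vP) (cot_inj vP)).
transitivity (delT (S h)); first exact: (prod_del BP).
rewrite /delT (sw_th_del th1P _ (F := fun a b => \sw_(c, g <- rho1 a) \sw_(p, q <- del2 g)
   (c ⊗ p) ⊗ (b ⊗ q))) //.
rewrite (sw_del_rho B1 _ (F := fun a c g => \sw_(p, q <- del2 g) (c ⊗ p) ⊗ (th1 a ⊗ q))) //.
transitivity (\sw_(a, b <- del1 h) \sw_(c, g <- rho1 a) \sw_(p, q <- del2 g)
   (b ⊗ q) ⊗ (th1 c ⊗ th2 p)).
  apply: eq_sw => a b; apply: eq_sw => c g.
  by rewrite (sw_th_del th2P _ (F := fun p q => (b ⊗ p) ⊗ (th1 c ⊗ q))).
transitivity (\sw_(s, t <- del B h) v t ⊗ (th1 ⊠ th2) (v s)); last first.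
  rewrite [RHS]tmap_sw [RHS]sw_sw //.
  by apply: eq_sw => s t; rewrite sw_pure; [congr (_ ⊗ _); apply/esym/thE | lin].
transitivity (\sw_(s, t <- del B h) \sw_(x, y <- v s) \sw_(x', y' <- v t)
   (x' ⊗ y') ⊗ (th1 x ⊗ th2 y)).
  by rewrite (sw_delP (prod_del BP) _ (F := fun x y x' y' => (x' ⊗ y') ⊗ (th1 x ⊗ th2 y))).
apply: eq_sw => s t; rewrite tmap_sw sw_purer; apply: eq_sw => x y.
by rewrite v_expandl.
Qed.

End Product.
End Cotensor.

(** * Equivalence of septuples *)

Section Equivalence.
Variables (k : fieldType) (H : algType k) (hH : hopf H).

Definition colinear (T1 T2 : algType k) (B1 : bigal hH T1) (B2 : bigal hH T2) (f : T1 -> T2) :=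
  (forall x, lam B2 (f x) = (idfun ⊠ f) (lam B1 x)) /\
  (forall x, rho B2 (f x) = (f ⊠ idfun) (rho B1 x)).

Section Colinear.
Variables (T1 T2 : algType k) (B1 : bigal hH T1) (B2 : bigal hH T2).
Variables (f : {lrmorphism T1 -> T2}) (fc : colinear B1 B2 f).

(** A colinear algebra map commutes with the Galois maps, so uniqueness of the preimage applies. *)
Lemma colinear_del h : (f ⊠ f) (del B1 h) = del B2 h.
Proof.
apply: del_uniq; rewrite tmap_sw sw_sw //.
transitivity (\sw_(a, b <- del B1 h) \sw_(g, c <- lam B1 a) g ⊗ f (c * b)).
  apply: eq_sw => a b; rewrite sw_pure //.
  rewrite fc.1 tmap_sw sw_sw //.
  by apply: eq_sw => g c; rewrite sw_pure ?rmorphM.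
rewrite (sw_gall B1 _ (F := fun g t => g ⊗ f t)) //.
by rewrite rmorph1.
Qed.

Lemma colinear_gam h : (f ⊠ f) (gam B1 h) = gam B2 h.
Proof.
apply: gam_uniq; rewrite tmap_sw sw_sw //.
transitivity (\sw_(a, b <- gam B1 h) \sw_(c, g <- rho B1 b) f (a * c) ⊗ g).
  apply: eq_sw => a b; rewrite sw_pure //.
  rewrite fc.2 tmap_sw sw_sw //.
  by apply: eq_sw => g c; rewrite sw_pure ?rmorphM.
rewrite (sw_galr B1 _ (F := fun t g => f t ⊗ g)) //.
by rewrite rmorph1.
Qed.

(** By [gallV], [x ⊗ 1] is built from values of [del], so it suffices to compare the two maps on the
    first leg of [del h], in the presence of the second. There [th_del] expresses both through [del]
    at the antipode of [h], which [f ⊠ f] preserves. *)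
Lemma colinear_theta (th1 : {lrmorphism T1 -> T1}) (th2 : {lrmorphism T2 -> T2}) x :
  bigal_theta B1 th1 -> bigal_theta B2 th2 -> th2 (f x) = f (th1 x).
Proof.
move=> th1P th2P; apply: (@pure1_inj _ _ T2).
pose G (b a : T1) (y : T1) : T2 ⊗ T2 := f b ⊗ f a.
have E h : \sw_(a, b <- del B1 h) f b ⊗ f (th1 a) = \sw_(a, b <- del B1 h) f b ⊗ th2 (f a).
  rewrite -(sw_th_del th1P _ (F := fun b a => f b ⊗ f a)) //.
  transitivity ((f ⊠ f) (del B1 (antipode hH h))); first by rewrite tmap_sw.
  rewrite colinear_del (th_del th2P) -colinear_del tmap_sw sw_sw //.
  by apply: eq_sw => a b; rewrite sw_pure.
have E' (g : T1 -> T2) : lin1 g ->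
    1 ⊗ g x = \sw_(h, y <- lam B1 x) \sw_(a, b <- del B1 h) (f b * f y) ⊗ g a.
  move=> gl; rewrite -(rmorph1 f) -(sw_gallV B1 x (F := fun a t => f t ⊗ g a)) //.
  by do 2!apply: eq_sw => ? ?; rewrite rmorphM.
rewrite (E' (fun x => th2 (f x))) //.
rewrite (E' (fun x => f (th1 x))) //.
apply: eq_sw => h y.
have /(congr1 (fun t => \sw_(p, q <- t) (p * f y) ⊗ q)) := E h.
rewrite sw_sw //.
rewrite sw_sw //.
move=> Eh; apply: esym; refine (etrans _ (etrans Eh _)).
  by apply: eq_sw => a b; rewrite sw_pure.
by apply: eq_sw => a b; rewrite sw_pure.
Qed.

End Colinear.

(** From an equivalence, compatibility with [il] and [ir] says that [f ⊠ f] preserves [del] and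
    [gam]; the coactions are then read off from [mu], the right one through its expression by [gam].
    Conversely a colinear map preserves the translation maps and theta automatically. *)
Lemma represents_equiv (T1 T2 : algType k) (s1 : septuple hH T1) (s2 : septuple hH T2) B1 B2 :
  represents s1 B1 -> represents s2 B2 ->
  tor_equiv (TorHat s1) (TorHat s2) <->
  exists2 f : {lrmorphism T1 -> T2}, bijective f & colinear B1 B2 f.
Proof.
move=> r1 r2; split; last first.
  move=> [f fb fc]; exists f; split=> //= [x|x|x|x].
  - transitivity (\sw_(h, y <- lam B2 (f x)) del B2 h ⊗ y); first exact: (rep_mu r2).
    transitivity ((f ⊠ f ⊠ f) (\sw_(h, y <- lam B1 x) del B1 h ⊗ y)); last first.
      by congr (tlift _ _); exact/esym/(rep_mu r1).
    rewrite fc.1 !tmap_sw !sw_sw //.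
    apply: eq_sw => h y; rewrite !sw_pure //.
    by rewrite -(colinear_del fc).
  - exact: (colinear_theta fc _ (rep_theta r1) (rep_theta r2)).
  - exists (inv_iso (iso_l_bij (il_iso s2)) (il s1 x)); last by rewrite inv_isoK.
    transitivity (del B2 (il s1 x)); first by rewrite (rep_del r2) inv_isoK.
    by rewrite -(colinear_del fc) (rep_del r1).
  - exists (inv_iso (iso_r_bij (ir_iso s2)) (ir s1 x)); last by rewrite inv_isoK.
    transitivity (gam B2 (ir s1 x)); first by rewrite (rep_gam r2) inv_isoK.
    by rewrite -(colinear_gam fc) (rep_gam r1).
move=> [/= f [fb fmu _ fl fr]]; exists f => //.
have fdel h : (f ⊠ f) (del B1 h) = del B2 h.
  have [y yE ilE] := fl (inv_iso (iso_l_bij (il_iso s1)) h).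
  rewrite inv_isoK in ilE.
  transitivity ((f ⊠ f) (Hl_val _ (inv_iso (iso_l_bij (il_iso s1)) h) : T1 ⊗ T1)).
    by rewrite (rep_del r1) inv_isoK.
  by rewrite -yE (rep_del r2) -ilE.
have fgam h : (f ⊠ f) (gam B1 h) = gam B2 h.
  have [y yE irE] := fr (inv_iso (iso_r_bij (ir_iso s1)) h).
  rewrite inv_isoK in irE.
  transitivity ((f ⊠ f) (Hr_val _ (inv_iso (iso_r_bij (ir_iso s1)) h) : T1 ⊗ T1)).
    by rewrite (rep_gam r1) inv_isoK.
  by rewrite -yE (rep_gam r2) -irE.
have muE x : \sw_(h, y <- lam B2 (f x)) del B2 h ⊗ y =
    (f ⊠ f ⊠ f) (\sw_(h, y <- lam B1 x) del B1 h ⊗ y).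
  transitivity (mu (tor s2) (f x) : T2 ⊗ T2 ⊗ T2); first exact/esym/(rep_mu r2).
  by rewrite fmu; congr (tlift _ _); exact: (rep_mu r1).
split=> x.
  apply: (tmap_injl (U := T2) (@del_inj _ _ _ _ B2)).
  refine (etrans (muE x) _).
  rewrite !tmap_sw !sw_sw //.
  apply: eq_sw => h y; rewrite !sw_pure //.
  by rewrite fdel.
apply: (tmap_injr (U := T2) (@gam_inj _ _ _ _ B2)).
have := congr1 (fun t => \sw_(u, c <- t) \sw_(a, b <- u) a ⊗ (b ⊗ c)) (muE x).
have L (T : algType k) (B : bigal hH T) y :
    \sw_(u, c <- \sw_(h, y <- lam B y) del B h ⊗ y) \sw_(a, b <- u) a ⊗ (b ⊗ c) =
    \sw_(y, h <- rho B y) y ⊗ gam B h.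
  transitivity (\sw_(h, y <- lam B y) \sw_(a, b <- del B h) a ⊗ (b ⊗ y)); first by sw.
  rewrite (sw_del_gam B _ (F := fun a b c => a ⊗ (b ⊗ c))) //.
  by apply: eq_sw => z h; rewrite -{2}(sw_id (gam B h)) sw_purer.
rewrite L => E; refine (etrans E _).
transitivity ((f ⊠ (f ⊠ f)) (\sw_(u, c <- \sw_(h, y <- lam B1 x) del B1 h ⊗ y) \sw_(a, b <- u) a ⊗ (b ⊗ c))).
  rewrite !tmap_sw !sw_sw //.
  apply: eq_sw => h y; rewrite !sw_pure //.
  rewrite tmap_sw !sw_sw //.
  by apply: eq_sw => a b; rewrite !sw_pure // tmapE.
rewrite L !tmap_sw !sw_sw //.
apply: eq_sw => y h; rewrite !sw_pure //.
by rewrite fgam.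
Qed.

End Equivalence.

Section SameStructure.
Variables (k : fieldType) (H : algType k) (hH : hopf H) (T : algType k).

Lemma equalizer_transfer (A B : algType k) (f g f' g' : {lrmorphism A -> B}) :
  f =1 f' -> g =1 g' -> forall x : equalizer f g,
  exists y : equalizer f' g', equalizer_val y = equalizer_val x.
Proof.
move=> ff gg x; have P : equalizer_val x \in equalizer_pred f' g'.
  by have := equalizerP x; rewrite !mem_equalizer ff gg.
by exists (Equalizer P).
Qed.

Lemma Hl_transfer (t t' : torsor T) : mu t =1 mu t' -> theta t =1 theta t' ->
  forall x : Hl t, exists y : Hl t', Hl_val t' y = Hl_val t x.
Proof.
move=> /funext Em /funext Et; apply: equalizer_transfer => u.
  transitivity ((@idfun T ⊠ @idfun T^c ⊠ theta t ⊠ @idfun T^c) ((mu t ⊠ @idfun T^c) u)).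
    by [].
  by rewrite Em Et.
transitivity (@tflat3 k T T T T ((@idfun T ⊠ (fun x => @tswap13 k T T T (mu t x))) u)).
  by [].
by rewrite Em.
Qed.

Lemma Hr_transfer (t t' : torsor T) : mu t =1 mu t' -> theta t =1 theta t' ->
  forall x : Hr t, exists y : Hr t', Hr_val t' y = Hr_val t x.
Proof.
move=> /funext Em /funext Et; apply: equalizer_transfer => u.
  transitivity ((@idfun T ⊠ theta t ⊠ @idfun T ⊠ @idfun T)
    (@tflat3 k T T T T ((@idfun T ⊠ mu t) u))).
    by [].
  by rewrite Em Et.
transitivity (((fun x => @tswap13 k T T T (mu t x)) ⊠ @idfun T) u).
  by [].
by rewrite Em.
Qed.

(** The types [Hl (tor s)] and [Hl (tor s')] differ even when the structure maps agree pointwise, so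
    [il] and [ir] are compared on elements with the same value in the tensor square. This serves to
    show that a prescription of structure maps determines one class. *)
Lemma same_structure_equiv (s s' : septuple hH T) :
  mu (tor s) =1 mu (tor s') -> theta (tor s) =1 theta (tor s') ->
  (forall x y, Hl_val (tor s') y = Hl_val (tor s) x -> il s x = il s' y) ->
  (forall x y, Hr_val (tor s') y = Hr_val (tor s) x -> ir s x = ir s' y) ->
  tor_equiv (TorHat s) (TorHat s').
Proof.
move=> Em Et El Er.
have I2 (u : T ⊗ T) : ((idfun : T -> T) ⊠ (idfun : T -> T)) u = u.
  by rewrite tmap_sw sw_id.
exists (idfun : {lrmorphism T -> T}); split=> /= [|x|x|x|x].
- by exists id.
- rewrite -Em; apply: esym; rewrite tmap_sw -[RHS]sw_id.
  by apply: eq_sw => u c; congr (_ ⊗ _); exact: I2.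
- by rewrite Et.
- have [y yE] := Hl_transfer Em Et x.
  exists y; last exact: El.
  by rewrite yE; apply/esym/I2.
- have [y yE] := Hr_transfer Em Et x.
  exists y; last exact: Er.
  by rewrite yE; apply/esym/I2.
Qed.

End SameStructure.

Section TorEquiv.
Variables (k : fieldType) (H : algType k) (hH : hopf H).

Lemma tor_equiv_refl (t : Tor_hat hH) : tor_equiv t t.
Proof.
case: t => T' s; apply: same_structure_equiv => // x y.
  by move=> /Hl_val_inj ->.
by move=> /Hr_val_inj ->.
Qed.

Lemma colinear_comp (T1 T2 T3 : algType k) (B1 : bigal hH T1) (B2 : bigal hH T2) (B3 : bigal hH T3)
    (f : {lrmorphism T1 -> T2}) (g : {lrmorphism T2 -> T3}) :
  colinear B1 B2 f -> colinear B2 B3 g -> colinear B1 B3 (g \o f).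
Proof.
move=> [fl fr] [gl gr]; split=> x /=.
  rewrite gl fl !tmap_sw sw_sw //.
  by apply: eq_sw => h y; rewrite sw_pure.
rewrite gr fr !tmap_sw sw_sw //.
by apply: eq_sw => h y; rewrite sw_pure.
Qed.

Lemma colinear_inv (T1 T2 : algType k) (B1 : bigal hH T1) (B2 : bigal hH T2)
    (f : {lrmorphism T1 -> T2}) (fb : bijective f) :
  colinear B1 B2 f -> colinear B2 B1 (inv_iso fb).
Proof.
move=> [fl fr]; split=> x.
  apply: (tmap_injr (U := H) (bij_inj fb)).
  transitivity (lam B2 (f (inv_iso fb x))); first by rewrite fl.
  rewrite inv_isoK -[LHS]sw_id !tmap_sw sw_sw //.
  by apply: eq_sw => a b; rewrite sw_pure //; congr (_ ⊗ _); exact/esym/inv_isoK.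
apply: (tmap_injl (U := H) (bij_inj fb)).
transitivity (rho B2 (f (inv_iso fb x))); first by rewrite fr.
rewrite inv_isoK -[LHS]sw_id !tmap_sw sw_sw //.
by apply: eq_sw => a b; rewrite sw_pure //; congr (_ ⊗ _); exact/esym/inv_isoK.
Qed.

Lemma tor_equiv_sym (t1 t2 : Tor_hat hH) : tor_equiv t1 t2 -> tor_equiv t2 t1.
Proof.
case: t1 t2 => [T1 s1] [T2 s2].
have [B1 r1] := septuple_represented s1; have [B2 r2] := septuple_represented s2.
move=> /(represents_equiv r1 r2)[f fb fc]; apply/(represents_equiv r2 r1).
exists (inv_iso fb : {lrmorphism T2 -> T1}); last exact: colinear_inv.
by exists f; [exact: inv_isoK | exact: iso_invK].
Qed.

Lemma tor_equiv_trans (t1 t2 t3 : Tor_hat hH) :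
  tor_equiv t1 t2 -> tor_equiv t2 t3 -> tor_equiv t1 t3.
Proof.
case: t1 t2 t3 => [T1 s1] [T2 s2] [T3 s3].
have [B1 r1] := septuple_represented s1; have [B2 r2] := septuple_represented s2.
have [B3 r3] := septuple_represented s3.
move=> /(represents_equiv r1 r2)[f fb fc] /(represents_equiv r2 r3)[g gb gc].
apply/(represents_equiv r1 r3); exists (g \o f : {lrmorphism T1 -> T3}).
  exact: bij_comp.
exact: (colinear_comp fc gc).
Qed.

End TorEquiv.

(** * The carrier [cotensor] as a cotensor product, and its prescribed structure maps *)

Section CotensorSeptuple.
Variables (k : fieldType) (H : algType k) (hH : hopf H) (T1 T2 : algType k).
Variables (s1 : septuple hH T1) (s2 : septuple hH T2).
Variables (B1 : bigal hH T1) (B2 : bigal hH T2).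
Hypothesis (r1 : represents s1 B1) (r2 : represents s2 B2).

Definition irV1 := inv_iso (iso_r_bij (ir_iso s1)).
Definition ilV2 := inv_iso (iso_l_bij (il_iso s2)).

Definition HrT : {linear Hr (tor s1) -> (T1 ⊗ T1)%type} :=
  (Hr_val (tor s1) : {linear _ -> (T1^c ⊗ T1)%type}).
Definition HlT : {linear Hl (tor s2) -> (T2 ⊗ T2)%type} :=
  (Hl_val (tor s2) : {linear _ -> (T2 ⊗ T2^c)%type}).

Lemma HrT_irV1 h : HrT (irV1 h) = gam B1 h.
Proof. by rewrite [LHS](rep_gam r1) /irV1 inv_isoK. Qed.

Lemma HlT_ilV2 h : HlT (ilV2 h) = del B2 h.
Proof. by rewrite [LHS](rep_del r2) /ilV2 inv_isoK. Qed.

Lemma Hl_Phi z : Hl_val (tor s2) (Phi s1 s2 z) = del B2 (ir s1 z) :> (T2 ⊗ T2)%type.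
Proof. by rewrite (rep_del r2) /Phi /= inv_isoK. Qed.

Lemma tassoc_mu1 (x : T1) : tassoc (mu (tor s1) x : T1 ⊗ T1 ⊗ T1) = \sw_(y, h <- rho B1 x) y ⊗ gam B1 h.
Proof.
transitivity (tassoc (\sw_(h, y <- lam B1 x) del B1 h ⊗ y)); first by congr (tassoc _); exact: (rep_mu r1).
transitivity (\sw_(h, y <- lam B1 x) \sw_(a, b <- del B1 h) a ⊗ (b ⊗ y)); first by sw.
rewrite (sw_del_gam B1 _ (F := fun a b c => a ⊗ (b ⊗ c))) //.
by apply: eq_sw => z h; rewrite -{2}(sw_id (gam B1 h)) sw_purer.
Qed.

(** The middle factor [H] is sent to [Hr] by the inverse of [ir] in [liftZ], and to [T2 ⊗ T2] by
    [del B2] in [liftQ]. Since [Phi] matches [ir] with [il], it becomes the identity of [H] in these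
    coordinates. *)
Definition liftZ (t : T1 ⊗ H ⊗ T2) : T1 ⊗ Hr (tor s1) ⊗ T2 := (idfun ⊠ irV1 ⊠ idfun) t.
Definition liftQ (t : T1 ⊗ H ⊗ T2) : T1 ⊗ T2 ⊗ T2 ⊗ T2 :=
  (@tassocI k T1 T2 T2 ⊠ idfun) ((idfun ⊠ del B2 ⊠ idfun) t).

Lemma liftQ_inj : injective liftQ.
Proof.
move=> x y /(tmap_injl (can_inj (@tassocIK k T1 T2 T2))).
exact: (tmap_injl (tmap_injr (@del_inj _ _ _ _ B2))).
Qed.

Lemma cotensor_i_inj : injective (cotensor_i T2 s1).
Proof. exact: (tmap_injl (tmap_injr (@Hr_val_inj _ _ _ _ s1))). Qed.

Lemma cotensor_iZ u : cotensor_i T2 s1 (liftZ (cotl T2 B1 u)) = cotensor_j T2 s1 u.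
Proof.
transitivity (\sw_(x, y <- u) \sw_(c, h <- rho B1 x) (c ⊗ gam B1 h) ⊗ y : T1 ⊗ (T1 ⊗ T1) ⊗ T2).
  transitivity ((idfun ⊠ (Hr_val (tor s1) : {linear _ -> (T1 ⊗ T1)%type}) ⊠ idfun) (liftZ (cotl T2 B1 u))).
    by [].
  rewrite cotl_sw /liftZ !tmap_sw !sw_sw //.
  apply: eq_sw => x y; rewrite !sw_sw //.
  apply: eq_sw => c h; rewrite !sw_pure //.
  rewrite !tmap_sw !sw_pure //.
  by congr (_ ⊗ _ ⊗ _); exact: HrT_irV1.
transitivity (\sw_(x, y <- u) tassoc (mu (tor s1) x : T1 ⊗ T1 ⊗ T1) ⊗ y).
  by apply: eq_sw => x y; rewrite tassoc_mu1 sw_purel.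
transitivity ((@tassoc k T1 T1 T1 ⊠ idfun) ((muT (tor s1) ⊠ idfun) u)); last by [].
rewrite !tmap_sw sw_sw //.
by apply: eq_sw => x y; rewrite sw_pure.
Qed.

Lemma cotensor_pZ t : cotensor_p s1 s2 (liftZ t) = liftQ t.
Proof.
transitivity ((@tassocI k T1 T2 T2 ⊠ idfun)
  ((idfun ⊠ (Hl_val (tor s2) \o Phi s1 s2 : {linear _ -> (T2 ⊗ T2)%type}) ⊠ idfun) (liftZ t))).
  by [].
rewrite /liftQ; congr (tlift _ _).
rewrite /liftZ !tmap_sw !sw_sw //.
apply: eq_sw => u y; rewrite !sw_pure //.
rewrite !tmap_sw !sw_sw //.
congr (_ ⊗ _); apply: eq_sw => c h; rewrite !sw_pure //.
congr (_ ⊗ _); refine (etrans (Hl_Phi _) _).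
by rewrite inv_isoK.
Qed.

Lemma cotensor_hQ u : cotensor_h T1 s2 u = liftQ (cotr T1 B2 u).
Proof.
transitivity (@tflat3 k T1 T2 T2 T2 ((idfun ⊠ muT (tor s2)) u)); first by [].
transitivity (\sw_(x, y <- u) \sw_(h, c <- lam B2 y) \sw_(a, b <- del B2 h) x ⊗ a ⊗ b ⊗ c).
  rewrite tflat3_sw tmap_sw sw_sw //.
  apply: eq_sw => x y; rewrite sw_pure //.
  transitivity (\sw_(v, c <- \sw_(h, c <- lam B2 y) del B2 h ⊗ c) \sw_(a, b <- v) x ⊗ a ⊗ b ⊗ c).
    by congr (tlift _ _); exact: (rep_mu r2).
  by sw.
rewrite cotr_sw /liftQ; apply: esym.
rewrite !tmap_sw !sw_sw //.
apply: eq_sw => x y; rewrite !sw_sw //.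
apply: eq_sw => h c; rewrite !sw_pure //.
rewrite !tmap_sw !sw_pure //.
by rewrite tassocI_sw sw_pure ?sw_purel.
Qed.

(** The witness required by [lift_equalizer] is unique and equal to [liftZ (cotl T2 B1 u)]; applying
    [cotensor_p] to it and cancelling the injective [liftQ] leaves the equation between [cotl] and
    [cotr]. *)
Lemma cot_val_is_cotensor : is_cotensor B1 B2 (cot_val s1 s2).
Proof.
split=> [|p|u E].
- exact: val_inj.
- have := lift_equalizerP p; rewrite mem_lift_equalizer => /asboolP[z].
  rewrite -[cotensor_j _ _ _]cotensor_iZ => /cotensor_i_inj ->.
  by rewrite cotensor_pZ cotensor_hQ => /liftQ_inj.
- have P : u \in lift_equalizer_pred (cotensor_i T2 s1) (cotensor_j T2 s1)
      (cotensor_p s1 s2) (cotensor_h T1 s2).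
    rewrite mem_lift_equalizer; apply/asboolP; exists (liftZ (cotl T2 B1 u)).
      exact: cotensor_iZ.
    by rewrite cotensor_pZ cotensor_hQ E.
  by exists (LiftEqualizer P).
Qed.

Lemma HlT_Phi h : HlT (Phi s1 s2 (irV1 h)) = del B2 h.
Proof. by refine (etrans (Hl_Phi _) _); rewrite inv_isoK. Qed.

Section Product.
Variable s : septuple hH (cotensor s1 s2).
Variable B : bigal hH (cotensor s1 s2).
Hypothesis rs : represents s B.
Hypothesis BP : is_product_bigal B1 B2 (cot_val s1 s2) B.
Local Notation v := (cot_val s1 s2).
Let vP := cot_val_is_cotensor.

(** The sum over the components of [mu5]: [mu] gives [a ⊗ b ⊗ z], and [mu] again on [a] gives [c]
    followed by [gam B1 g]. Keeping [g] in [H] leaves open whether it is sent to [Hr] or, by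
    [del B2], to [T2 ⊗ T2]. *)
Definition sw4 (U : lmodType k) (F : T1 -> H -> T1 -> T1 -> T2 -> U) x :=
  \sw_(x, y <- v x) \sw_(h, z <- lam B1 x) \sw_(a, b <- del B1 h) \sw_(c, g <- rho B1 a)
    F c g b z y.

Lemma lin1_sw4 (U V : lmodType k) (f : U -> V) (F : T1 -> H -> T1 -> T1 -> T2 -> U) x :
  lin1 f -> f (sw4 F x) = sw4 (fun c g b z y => f (F c g b z y)) x.
Proof.
move=> fl; rewrite /sw4 lin1_sw //; apply: eq_sw => ? ?.
rewrite lin1_sw //; apply: eq_sw => ? ?.
by rewrite lin1_sw //; apply: eq_sw => ? ?; rewrite lin1_sw.
Qed.

Lemma eq_sw4 (U : lmodType k) (F G : T1 -> H -> T1 -> T1 -> T2 -> U) x :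
  (forall c g b z y, F c g b z y = G c g b z y) -> sw4 F x = sw4 G x.
Proof. by move=> FG; do 4!apply: eq_sw => ? ?; rewrite FG. Qed.

Lemma product_mu_graph x : prod_mu_graph s1 s2 (v x)
  ((v ⊠ v ⊠ v) (mu (tor s) x : cotensor s1 s2 ⊗ cotensor s1 s2 ⊗ cotensor s1 s2)).
Proof.
(* [irV1 g] has value [gam B1 g], the second and third components of [mu5], and [Phi] sends it to
   the element of [Hl] with value [del B2 g]; the prescribed formula thus becomes [delT] followed by
   [z ⊗ y]. *)
pose w := sw4 (fun c g b z y => c ⊗ irV1 g ⊗ b ⊗ z ⊗ y) x.
exists w.
  transitivity (sw4 (fun c g b z y => c ⊗ gam B1 g ⊗ b ⊗ z ⊗ y) x).
    transitivity ((idfun ⊠ HrT ⊠ idfun ⊠ idfun ⊠ idfun) w); first by [].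
    rewrite (lin1_sw4 (f := (idfun ⊠ HrT ⊠ idfun ⊠ idfun ⊠ idfun))) //.
    apply: eq_sw4 => c g b z y; rewrite !tmap_pure //.
    by rewrite HrT_irV1.
  transitivity (\sw_(x, y <- v x) \sw_(h, z <- lam B1 x) \sw_(a, b <- del B1 h)
     tassoc (muT (tor s1) a) ⊗ b ⊗ z ⊗ y).
    do 3!apply: eq_sw => ? ?.
    by rewrite [tassoc _]tassoc_mu1 !sw_purel.
  pose m5 := (muT (tor s1) ⊠ idfun ⊠ idfun) \o muT (tor s1).
  transitivity ((@tassoc k T1 T1 T1 ⊠ idfun ⊠ idfun ⊠ idfun) ((m5 ⊠ idfun) (v x))); last by [].
  rewrite /m5 !tmap_sw !sw_sw //.
  apply: eq_sw => x1 y1; rewrite sw_pure //.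
  transitivity ((@tassoc k T1 T1 T1 ⊠ idfun ⊠ idfun)
    ((muT (tor s1) ⊠ idfun ⊠ idfun) (\sw_(h, z <- lam B1 x1) del B1 h ⊗ z)) ⊗ y1); last first.
    by congr (_ ⊗ _); congr (tmap _ _ (tmap _ _ _)); exact/esym/(rep_mu r1).
  rewrite !tmap_sw !sw_sw //.
  rewrite sw_purel; apply: eq_sw => h z; rewrite !sw_pure //.
  rewrite !tmap_sw !sw_sw //.
  rewrite !sw_purel; apply: eq_sw => a b; rewrite !sw_pure; try lin.
  by [].
transitivity (sw4 (fun c g b z y =>
    (\sw_(p, q <- del B2 g) (c ⊗ p) ⊗ (b ⊗ q)) ⊗ (z ⊗ y)) x).
  transitivity ((v ⊠ v ⊠ v) (\sw_(h, q <- lam B x) del B h ⊗ q)).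
    by congr (tmap _ _ _); exact: (rep_mu rs).
  transitivity (\sw_(h, q <- lam B x) delT B1 B2 h ⊗ v q).
    rewrite !tmap_sw !sw_sw //.
    by apply: eq_sw => h q; rewrite sw_pure; [congr (_ ⊗ _); exact: (prod_del BP)|lin].
  transitivity (\sw_(h, q <- lam B x) \sw_(x, y <- v q) delT B1 B2 h ⊗ (x ⊗ y)).
    by apply: eq_sw => h q; rewrite v_expandr.
  rewrite (sw_lamP (prod_lam BP) _ (F := fun h x y => delT B1 B2 h ⊗ (x ⊗ y))) //.
  by apply: eq_sw => x1 y1; apply: eq_sw => h z; rewrite /delT !sw_purel;
    apply: eq_sw => a b; rewrite !sw_purel.
transitivity ((@tassoc k (T1 ⊗ T2)%type T1 T2 ⊠ idfun) (tassoc
  ((@tswap23 k (T1 ⊗ T2)%type T2 T1 ⊠ idfun ⊠ idfun)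
     ((@tassocI k T1 T2 T2 ⊠ idfun ⊠ idfun ⊠ idfun)
       ((idfun ⊠ (HlT \o Phi s1 s2) ⊠ idfun ⊠ idfun ⊠ idfun) w))))); last by [].
transitivity (sw4 (fun c g b z y => (@tassoc k (T1 ⊗ T2)%type T1 T2 ⊠ idfun) (tassoc
  ((@tswap23 k (T1 ⊗ T2)%type T2 T1 ⊠ idfun ⊠ idfun)
     ((@tassocI k T1 T2 T2 ⊠ idfun ⊠ idfun ⊠ idfun)
       ((idfun ⊠ (HlT \o Phi s1 s2) ⊠ idfun ⊠ idfun ⊠ idfun) (c ⊗ irV1 g ⊗ b ⊗ z ⊗ y)))))) x);
  last first.
  rewrite (lin1_sw4 (f := fun w => (@tassoc k (T1 ⊗ T2)%type T1 T2 ⊠ idfun) (tassoc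
  ((@tswap23 k (T1 ⊗ T2)%type T2 T1 ⊠ idfun ⊠ idfun)
     ((@tassocI k T1 T2 T2 ⊠ idfun ⊠ idfun ⊠ idfun)
       ((idfun ⊠ (HlT \o Phi s1 s2) ⊠ idfun ⊠ idfun ⊠ idfun) w)))))) //.
apply: eq_sw4 => c g b z y.
rewrite (tmap_pure (f := (idfun ⊠ (HlT \o Phi s1 s2) ⊠ idfun ⊠ idfun))) //.
rewrite !(tmap_pure (k := k)) //.
rewrite [(HlT \o Phi s1 s2) _]HlT_Phi.
pose L t := (@tassoc k (T1 ⊗ T2)%type T1 T2 ⊠ idfun) (tassoc
  (@tswap23 k (T1 ⊗ T2)%type T2 T1 (@tassocI k T1 T2 T2 (c ⊗ t) ⊗ b) ⊗ z ⊗ y)).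
have L1 : lin1 L by rewrite /L; lin.
transitivity (L (del B2 g)); last by [].
rewrite -{2}(sw_id (del B2 g)) lin1_sw // sw_purel.
apply: eq_sw => p q; rewrite /L tassocIE tswap23E tassocE tmap_pure //.
by rewrite tassocE.
Qed.

Lemma product_il_graph (x : Hl (tor s)) : exists2 y : Hl (tor s1),
  prod_il_graph s2 ((v ⊠ v) (Hl_val (tor s) x : cotensor s1 s2 ⊗ cotensor s1 s2)) (Hl_val (tor s1) y) &
  il s x = il s1 y.
Proof.
exists (inv_iso (iso_l_bij (il_iso s1)) (il s x)); last by rewrite inv_isoK.
(* This is [delT] with its two [T2]-factors brought together: they form [del B2 g], the value of
   [ilV2 g], and the counit of [prod_il_graph] takes there the value [e g]. *)
pose w := \sw_(a, b <- del B1 (il s x)) \sw_(c, g <- rho B1 a) c ⊗ ilV2 g ⊗ b.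
exists w.
  transitivity (\sw_(a, b <- del B1 (il s x)) \sw_(c, g <- rho B1 a) c ⊗ del B2 g ⊗ b).
    transitivity ((idfun ⊠ HlT ⊠ idfun) w); first by [].
    rewrite tmap_swr //.
    apply: eq_sw => a b.
    rewrite tmap_swr //.
    apply: eq_sw => c g; rewrite !tmap_pure //.
    by rewrite HlT_ilV2.
  pose L t := (@tassoc k T1 T2 T2 ⊠ idfun) (tswap23 (@tassocI k (T1 ⊗ T2)%type T1 T2 t)).
  have L1 : lin1 L by rewrite /L; lin.
  transitivity (L (delT B1 B2 (il s x))); last first.
    transitivity (L ((v ⊠ v) (del B (il s x)))); first by rewrite (prod_del BP).
    by congr (L (tmap _ _ _)); exact/esym/(rep_del rs).
  rewrite /delT lin1_sw //; apply: eq_sw => a b.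
  rewrite lin1_sw //; apply: eq_sw => c g.
  rewrite -{1}(sw_id (del B2 g)) sw_purer sw_purel lin1_sw //; apply: eq_sw => p q.
  by rewrite /L tassocIE tswap23E tmap_pure // tassocE.
transitivity (del B1 (il s x)); first by rewrite (rep_del r1) inv_isoK.
pose L := @tcontrr k T1 _ (counit_l s2) ⊠ (idfun : T1 -> T1).
have L1 : lin1 L by rewrite /L; lin.
rewrite -[_ w]/(L w) /w lin1_sw // -[LHS]sw_id; apply: eq_sw => a b.
rewrite lin1_sw // -(sw_rho1 B1 _ (F := fun a => a ⊗ b)) //.
apply: eq_sw => c g; rewrite /L tmap_pure //.
rewrite /tcontrr sw_pure /tcontrr_fun //.
have -> : counit_l s2 (ilV2 g) = counit hH g by rewrite /= inv_isoK.
exact/esym/linearZl_LR.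
Qed.

Lemma product_ir_graph (x : Hr (tor s)) : exists2 y : Hr (tor s2),
  prod_ir_graph s1 ((v ⊠ v) (Hr_val (tor s) x : cotensor s1 s2 ⊗ cotensor s1 s2)) (Hr_val (tor s2) y) &
  ir s x = ir s2 y.
Proof.
exists (inv_iso (iso_r_bij (ir_iso s2)) (ir s x)); last by rewrite inv_isoK.
pose w := \sw_(c, d <- gam B2 (ir s x)) \sw_(g, y <- lam B2 d) c ⊗ irV1 g ⊗ y.
exists w.
  transitivity (\sw_(c, d <- gam B2 (ir s x)) \sw_(g, y <- lam B2 d) c ⊗ gam B1 g ⊗ y).
    transitivity ((idfun ⊠ HrT ⊠ idfun) w); first by [].
    rewrite tmap_swr //.
    apply: eq_sw => a b.
    rewrite tmap_swr //.
    apply: eq_sw => c g; rewrite !tmap_pure //.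
    by rewrite HrT_irV1.
  pose L t := (@tassoc k T2 T1 T1 ⊠ idfun)
    (@tassocI k (T2 ⊗ T1)%type T1 T2 ((@tswap k T1 T2 ⊠ idfun) t)).
  have L1 : lin1 L by rewrite /L; lin.
  transitivity (L (gamT B1 B2 (ir s x))); last first.
    transitivity (L ((v ⊠ v) (gam B (ir s x)))); first by rewrite (prod_gam BP).
    by congr (L (tmap _ _ _)); exact/esym/(rep_gam rs).
  rewrite /gamT lin1_sw //; apply: eq_sw => a b.
  rewrite lin1_sw //; apply: eq_sw => g c.
  rewrite -{1}(sw_id (gam B1 g)) sw_purer sw_purel lin1_sw //; apply: eq_sw => p q.
  rewrite /L tmap_pure //.
  by rewrite tswapE tassocIE tmap_pure // tassocE.
transitivity (gam B2 (ir s x)); first by rewrite (rep_gam r2) inv_isoK.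
pose L := @tcontrr k T2 _ (counit_r s1) ⊠ (idfun : T2 -> T2).
have L1 : lin1 L by rewrite /L; lin.
rewrite -[_ w]/(L w) /w lin1_sw // -[LHS]sw_id; apply: eq_sw => a b.
rewrite lin1_sw // -(sw_lam1 B2 _ (F := fun y => a ⊗ y)) //.
apply: eq_sw => g c; rewrite /L tmap_pure //.
rewrite /tcontrr sw_pure /tcontrr_fun //.
have -> : counit_r s1 (irV1 g) = counit hH g by rewrite /= inv_isoK.
exact/esym/linearZl_LR.
Qed.

End Product.
End CotensorSeptuple.

(** * Unit, inverse and associativity isomorphisms *)

Section ProductIso.
Variables (k : fieldType) (H : algType k) (hH : hopf H).
Local Notation D := (comul hH).
Local Notation e := (counit hH).
Local Notation S := (antipode hH).

(** Colinearity is tested after the injection [v], where the coactions of [Q] are those of the outer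
    factors. *)
Lemma colinear_product (T Q T1 T2 : algType k) (BT : bigal hH T) (B1 : bigal hH T1) (B2 : bigal hH T2)
    (BQ : bigal hH Q) (v : {lrmorphism Q -> T1 ⊗ T2}) (u : {lrmorphism T -> T1 ⊗ T2})
    (f : {lrmorphism T -> Q}) :
  is_cotensor B1 B2 v -> is_product_bigal B1 B2 v BQ ->
  (forall x, v (f x) = u x) ->
  (forall x, (idfun ⊠ u) (lam BT x) = tassoc ((lam B1 ⊠ idfun) (u x))) ->
  (forall x, (u ⊠ idfun) (rho BT x) = tassocI ((idfun ⊠ rho B2) (u x))) ->
  colinear BT BQ f.
Proof.
move=> vP BP fE ul ur; split=> x.
  apply: (tmap_injr (cot_inj vP)).
  refine (etrans (prod_lam BP _) _); rewrite fE -ul !tmap_sw sw_sw //.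
  by apply: eq_sw => h y; rewrite sw_pure //; congr (_ ⊗ _); exact/esym/fE.
apply: (tmap_injl (cot_inj vP)).
refine (etrans (prod_rho BP _) _); rewrite fE -ur !tmap_sw sw_sw //.
by apply: eq_sw => h y; rewrite sw_pure //; congr (_ ⊗ _); exact/esym/fE.
Qed.

(** The isomorphism is [lam]. Its image satisfies the cotensor equation by coassociativity;
    conversely, the counit on the [H]-factor gives a preimage, because the cotensor equation
    replaces the coaction on [y] by the coproduct of [h], which the counit removes. *)
Lemma product_unitl (T Q : algType k) (B : bigal hH T) (BQ : bigal hH Q)
    (v : {lrmorphism Q -> H ⊗ T}) :
  is_cotensor (triv hH) B v -> is_product_bigal (triv hH) B v BQ ->
  exists2 f : {lrmorphism T -> Q}, bijective f & colinear B BQ f.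
Proof.
move=> vP BP.
have lami : injective (lam B).
  move=> x y /(congr1 (tcontrl e)).
  have E z : tcontrl e (lam B z) = z by exact: (lam1 B z).
  by rewrite !E.
have [f fb fE] : exists2 f : {lrmorphism T -> Q}, bijective f & forall x, v (f x) = lam B x.
  apply: lrmorphism_iso => // [|x|q]; first exact: (cot_inj vP).
    apply: (cot_ex vP); rewrite cotl_sw cotr_sw.
    by rewrite -(sw_lamA B _ (F := fun a b c => a ⊗ b ⊗ c)).
  exists (\sw_(h, y <- v q) e h *: y).
  rewrite (lin1_sw _ _ (f := lam B)) //.
  transitivity (\sw_(h, y <- v q) \sw_(g, z <- lam B y) (e h : k) *: (g ⊗ z)).
    by apply: eq_sw => h y; rewrite sw_scale sw_id; exact: linearZ.
  rewrite -(sw_cot vP _ (F := fun h g z => (e h : k) *: (g ⊗ z))) //.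
  rewrite -[RHS]sw_id; apply: eq_sw => h y.
  by rewrite (sw_counitl _ _ (F := fun g => g ⊗ y)).
exists f => //; apply: (colinear_product vP BP fE) => x.
  transitivity (\sw_(h, y <- lam B x) \sw_(g, z <- lam B y) h ⊗ (g ⊗ z)).
    by rewrite tmap_sw; apply: eq_sw => h y; rewrite -{1}(sw_id (lam B y)) sw_purer.
  rewrite -(sw_lamA B _ (F := fun a b c => a ⊗ (b ⊗ c))) //.
  transitivity (tassoc ((D ⊠ idfun) (lam B x))); last by [].
  by sw.
transitivity (\sw_(y, h <- rho B x) \sw_(g, z <- lam B y) g ⊗ z ⊗ h).
  by rewrite tmap_sw; apply: eq_sw => y h; rewrite -{1}(sw_id (lam B y)) sw_purel.
rewrite (sw_lamrho B _ (F := fun g z h => g ⊗ z ⊗ h)) //.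
by sw.
Qed.

(** The isomorphism is [gam]. It lands in the cotensor product because the antipode of [sw_gam_lam]
    cancels the inverse antipode of the opposite coaction; that it fills the cotensor product rests
    on theta, through [thx]. *)
Lemma product_invl (Si : {linear H -> H}) (SK : cancel S Si) (SiK : cancel Si S)
    (T Q : algType k) (B : bigal hH T) (BQ : bigal hH Q) (v : {lrmorphism Q -> T^c ⊗ T})
    (th : {lrmorphism T -> T}) : bigal_theta B th ->
  is_cotensor (opp SK SiK B) B v -> is_product_bigal (opp SK SiK B) B v BQ ->
  exists2 f : {lrmorphism H -> Q}, bijective f & colinear (triv hH) BQ f.
Proof.
move=> thP vP BP.
have cotO (z : T ⊗ T) : cotl T (opp SK SiK B) z =
    \sw_(x, y <- z) \sw_(g, c <- lam B x) c ⊗ Si g ⊗ y :> (T ⊗ H ⊗ T)%type.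
  transitivity (\sw_(x, y <- z) \sw_(c, g <- rhoOT Si B x) c ⊗ g ⊗ y).
    exact: (@cotl_sw k H hH T^c T (opp SK SiK B) z).
  apply: eq_sw => x y.
  by rewrite (sw_rhoO Si B x (F := fun c g => c ⊗ g ⊗ y)).
have [f fb fE] : exists2 f : {lrmorphism H -> Q}, bijective f & forall h, v (f h) = gam_lr B h.
  apply: lrmorphism_iso => // [|||q].
  - exact: (@gam_inj _ _ _ _ B).
  - exact: (cot_inj vP).
  - move=> h; apply: (cot_ex vP); refine (etrans (cotO _) _).
    refine (etrans _ (esym (cotr_sw _ _))).
    transitivity (\sw_(a, b <- gam B h) \sw_(g, c <- lam B a) c ⊗ Si g ⊗ b); first by [].
    rewrite (sw_gam_lam B _ (F := fun g c b => c ⊗ Si g ⊗ b)) //.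
    transitivity (\sw_(a, b <- gam B h) \sw_(g, c <- lam B b) a ⊗ g ⊗ c); last by [].
    by do 2!apply: eq_sw => ? ?; rewrite SK.
  pose z : T ⊗ T := v q.
  have zE : \sw_(x, y <- z) \sw_(g, c <- lam B x) c ⊗ Si g ⊗ y =
      \sw_(x, y <- z) \sw_(h, c <- lam B y) x ⊗ h ⊗ c.
    by refine (etrans (esym (cotO _)) (etrans (cot_eq vP q) _)); exact: cotr_sw.
  apply: (@gam_ex _ _ _ _ B z).
  (* After [th] on the first factor, [th_del] replaces the translation at [Si g] by a flipped one at
     [g]; [sw_del_gam_th] and the contraction of [gam] then conclude. *)
  have thx x : \sw_(g, c <- lam B x) \sw_(p, q <- del B (Si g)) (c * p) ⊗ q = 1 ⊗ x.
    apply: (tmap_injl (bij_inj (th_bij thP))).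
    transitivity (\sw_(g, c <- lam B x) \sw_(a, b <- del B g) (th c * b) ⊗ a).
      rewrite tmap_sw sw_sw //.
      apply: eq_sw => g c; rewrite sw_sw //.
      rewrite -{2}[g]SiK (sw_th_del thP _ (F := fun a b => (th c * b) ⊗ a)) //.
      by apply: eq_sw => a b; rewrite sw_pure ?rmorphM.
    pose F (p q t u : T) := (t * q * u) ⊗ p.
    have F4 : lin4 F by rewrite /F; lin.
    transitivity (\sw_(g, c <- lam B x) \sw_(a, b <- del B g) F a b (th c) 1).
      by do 2!apply: eq_sw => ? ?; rewrite /F mulr1.
    rewrite (sw_del_gam_th thP _ F4) /F tmapE /= (rmorph1 th).
    transitivity (\sw_(y, h <- rho B x) (e h : k) *: ((1 : T) ⊗ y)); last first.
      by rewrite (sw_rho1 B _ (F := fun y => (1 : T) ⊗ y)).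
    apply: eq_sw => y h.
    rewrite -(counit_antipode hH h) -(sw_gam_mult B _ (F := fun t => t ⊗ y)) //.
    by apply: eq_sw => ? ?; rewrite mulr1.
  (* The criterion of [gam_ex] is rewritten with [lam] in place of [rho], so that the cotensor
     equation [zE] can move the coaction from [y] to [x], where [thx] applies. *)
  transitivity (\sw_(x, y <- z) \sw_(g, c <- lam B y) \sw_(p, q <- del B g) (x * p) ⊗ (q ⊗ c)).
    apply: eq_sw => x y.
    rewrite (sw_del_gam B _ (F := fun a b c => (x * a) ⊗ (b ⊗ c))) //.
    by apply: eq_sw => c g; rewrite -{1}(sw_id (gam B g)) sw_purer.
  transitivity (\sw_(x, y <- z) \sw_(g, c <- lam B x) \sw_(p, q <- del B (Si g)) (c * p) ⊗ (q ⊗ y)).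
    apply: esym.
    by sw_from (congr1 (fun t => \sw_(u, c <- t) \sw_(x, g <- u) \sw_(p, q <- del B g) (x * p) ⊗ (q ⊗ c)) zE).
  rewrite -{2}(sw_id z) sw_purer; apply: eq_sw => x y.
  have /(congr1 (fun t => \sw_(a, b <- t) a ⊗ (b ⊗ y))) := thx x.
  rewrite [X in _ = X -> _]sw_pure //.
  by move=> <-; sw.
exists f => //; apply: (colinear_product vP BP fE) => h.
  transitivity (\sw_(a, b <- D h) a ⊗ gam B b : H ⊗ (T ⊗ T)); first by [].
  transitivity (\sw_(a, b <- gam B h) \sw_(c, g <- rho B a) Si g ⊗ (c ⊗ b)).
    rewrite (sw_gam_rho2 B _ (F := fun c g b => Si g ⊗ (c ⊗ b))) //.
    by apply: eq_sw => a b; rewrite -{1}(sw_id (gam B b)) sw_purer SK.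
  transitivity (tassoc ((lamOT Si B ⊠ idfun) (gam B h))); last by [].
  rewrite tassoc_sw tmap_sw !sw_sw //.
  apply: eq_sw => a b; rewrite sw_pure //.
  by rewrite (sw_lamO Si B a (F := fun g c => g ⊗ (c ⊗ b))).
transitivity (\sw_(a, b <- D h) gam B a ⊗ b : T ⊗ T ⊗ H); first by [].
transitivity (tassocI ((idfun ⊠ rho B) (gam B h))); last by [].
transitivity (\sw_(a, b <- gam B h) \sw_(c, g <- rho B b) a ⊗ c ⊗ g); last by sw.
rewrite (sw_gam_rho B _ (F := fun a c g => a ⊗ c ⊗ g)) //.
by apply: eq_sw => a b; rewrite -{1}(sw_id (gam B a)) sw_purel.
Qed.

Section Congruence.
Variables (T1 T2 T1' T2' : algType k).
Variables (B1 : bigal hH T1) (B2 : bigal hH T2) (B1' : bigal hH T1') (B2' : bigal hH T2').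
Variables (f1 : {lrmorphism T1 -> T1'}) (f2 : {lrmorphism T2 -> T2'}).
Hypotheses (f1c : colinear B1 B1' f1) (f2c : colinear B2 B2' f2).

Lemma colinear_cotl z : cotl T2' B1' ((f1 ⊠ f2) z) = (f1 ⊠ idfun ⊠ f2) (cotl T2 B1 z).
Proof.
rewrite !cotl_sw tmap_sw sw_sw //.
rewrite [RHS]tmap_swr //.
apply: eq_sw => x y; rewrite sw_pure //.
rewrite f1c.2 tmap_sw sw_sw //.
rewrite [RHS]tmap_swr //.
by apply: eq_sw => c h; rewrite sw_pure ?tmap_pure.
Qed.

Lemma colinear_cotr z : cotr T1' B2' ((f1 ⊠ f2) z) = (f1 ⊠ idfun ⊠ f2) (cotr T1 B2 z).
Proof.
rewrite !cotr_sw tmap_sw sw_sw //.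
rewrite [RHS]tmap_swr //.
apply: eq_sw => x y; rewrite sw_pure //.
rewrite f2c.1 tmap_sw sw_sw //.
rewrite [RHS]tmap_swr //.
by apply: eq_sw => c h; rewrite sw_pure ?tmap_pure.
Qed.

Lemma product_congr (P P' : algType k) (v : {lrmorphism P -> T1 ⊗ T2})
    (v' : {lrmorphism P' -> T1' ⊗ T2'}) (BP : bigal hH P) (BP' : bigal hH P') :
  bijective f1 -> bijective f2 ->
  is_cotensor B1 B2 v -> is_product_bigal B1 B2 v BP ->
  is_cotensor B1' B2' v' -> is_product_bigal B1' B2' v' BP' ->
  exists2 f : {lrmorphism P -> P'}, bijective f & colinear BP BP' f.
Proof.
move=> f1b f2b vP pP vP' pP'.
have f12i := tmap_inj (bij_inj f1b) (bij_inj f2b).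
have [f fb fE] : exists2 f : {lrmorphism P -> P'}, bijective f & forall p, v' (f p) = (f1 ⊠ f2) (v p).
  apply: (@lrmorphism_iso _ _ _ _ ((f1 ⊠ f2) \o v) v').
  - by move=> x y /= /f12i/(cot_inj vP).
  - exact: (cot_inj vP').
  - move=> p; apply: (cot_ex vP').
    exact: (etrans (colinear_cotl _) (etrans (congr1 _ (cot_eq vP p)) (esym (colinear_cotr _)))).
  - move=> p.
    have gE z : (f1 ⊠ f2) ((inv_iso f1b ⊠ inv_iso f2b) z) = z.
      rewrite -[RHS]sw_id !tmap_sw sw_sw //.
      by apply: eq_sw => a b; rewrite sw_pure ?inv_isoK.
    have [q qE] : exists q, v q = (inv_iso f1b ⊠ inv_iso f2b) (v' p).
      apply: (cot_ex vP).
      apply: (tmap_inj (tmap_injl (bij_inj f1b)) (bij_inj f2b)).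
      refine (etrans (esym (colinear_cotl _)) (etrans _ (colinear_cotr _))).
      by rewrite gE (cot_eq vP').
    by exists q; rewrite /= qE gE.
exists f => //; apply: (colinear_product (u := (f1 ⊠ f2) \o v) vP' pP' fE) => x.
  transitivity ((idfun ⊠ (f1 ⊠ f2)) ((idfun ⊠ v) (lam BP x))).
    rewrite [RHS]tmap_comp //.
  rewrite (prod_lam pP).
  transitivity (tassoc ((lam B1' ⊠ idfun) ((f1 ⊠ f2) (v x)))); last by [].
  rewrite !tmap_sw !tassoc_sw !sw_sw //.
  apply: eq_sw => a b; rewrite !sw_pure //.
  rewrite f1c.1 tmap_sw !sw_sw //.
  apply: eq_sw => c d; rewrite !sw_pure //.
  by rewrite tmap_pure.
transitivity (((f1 ⊠ f2) ⊠ idfun) ((v ⊠ idfun) (rho BP x))).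
  by rewrite [RHS]tmap_comp.
rewrite (prod_rho pP).
transitivity (tassocI ((idfun ⊠ rho B2') ((f1 ⊠ f2) (v x)))); last by [].
rewrite !tmap_sw !tassocI_sw !sw_sw //.
apply: eq_sw => a b; rewrite !sw_pure //.
rewrite f2c.2 tmap_sw !sw_sw //.
apply: eq_sw => c d; rewrite !sw_pure //.
by rewrite tmap_pure.
Qed.

End Congruence.

Section Associativity.
Variables (T1 T2 T3 P12 P23 Q R : algType k).
Variables (B1 : bigal hH T1) (B2 : bigal hH T2) (B3 : bigal hH T3).
Variables (B12 : bigal hH P12) (B23 : bigal hH P23) (BQ : bigal hH Q) (BR : bigal hH R).
Variables (v12 : {lrmorphism P12 -> T1 ⊗ T2}) (v23 : {lrmorphism P23 -> T2 ⊗ T3}).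
Variables (vQ : {lrmorphism Q -> P12 ⊗ T3}) (vR : {lrmorphism R -> T1 ⊗ P23}).
Hypotheses (c12 : is_cotensor B1 B2 v12) (p12 : is_product_bigal B1 B2 v12 B12).
Hypotheses (c23 : is_cotensor B2 B3 v23) (p23 : is_product_bigal B2 B3 v23 B23).
Hypotheses (cQ : is_cotensor B12 B3 vQ) (pQ : is_product_bigal B12 B3 vQ BQ).
Hypotheses (cR : is_cotensor B1 B23 vR) (pR : is_product_bigal B1 B23 vR BR).

(** [assocQ] and [assocR] embed both iterated products in one triple tensor product, so that
    associativity becomes an equality of images. *)
Definition assocQ : {lrmorphism Q -> T1 ⊗ (T2 ⊗ T3)} :=
  @tassoc k T1 T2 T3 \o (v12 ⊠ idfun) \o vQ.
Definition assocR : {lrmorphism R -> T1 ⊗ (T2 ⊗ T3)} := (idfun ⊠ v23) \o vR.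

Lemma assocQ_sw q : assocQ q = \sw_(p, z <- vQ q) \sw_(x, y <- v12 p) x ⊗ (y ⊗ z).
Proof.
transitivity (tassoc ((v12 ⊠ idfun) (vQ q))); first by [].
by sw.
Qed.

Lemma assocR_sw r : assocR r = \sw_(x, p <- vR r) \sw_(y, z <- v23 p) x ⊗ (y ⊗ z).
Proof.
transitivity ((idfun ⊠ v23) (vR r)); first by [].
by rewrite tmap_sw; apply: eq_sw => x p; rewrite -{1}(sw_id (v23 p)) sw_purer.
Qed.

Lemma assocQ_inj : injective assocQ.
Proof.
move=> x y xy; apply: (cot_inj cQ); apply: (tmap_injl (cot_inj c12)).
exact: (can_inj (@tassocK k T1 T2 T3)).
Qed.

Lemma assocR_inj : injective assocR.
Proof.
move=> x y xy; apply: (cot_inj cR); exact: (tmap_injr (cot_inj c23)).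
Qed.

(** As [rho B12] is [rho B2] on the last factor, the equation defining [Q] is the cotensor equation
    between [T2] and [T3], which lifts the element to [T1 ⊗ P23]. The equation of [P12] then becomes
    that of [R], as [lam B23] is [lam B2] on the first factor. *)
Lemma assocQR q : exists r, assocR r = assocQ q.
Proof.
have [w wE] : exists w : T1 ⊗ P23, (idfun ⊠ v23) w = assocQ q.
  apply: (tens_equalizerr (f := cotl T3 B2) (g := cotr T2 B3)); first exact: (cot_ex c23).
  rewrite assocQ_sw.
  transitivity (\sw_(p, z <- vQ q) \sw_(x, y <- v12 p) \sw_(c, h <- rho B2 y) x ⊗ (c ⊗ h ⊗ z)).
    rewrite tmap_swr //.
    apply: eq_sw => p z.
    rewrite tmap_swr //.
    apply: eq_sw => x y; rewrite tmap_pure //.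
    by rewrite cotl_sw sw_pure ?sw_purer.
  transitivity (\sw_(p, z <- vQ q) \sw_(x, y <- v12 p) \sw_(h, c <- lam B3 z) x ⊗ (y ⊗ h ⊗ c)); last first.
    rewrite [RHS]tmap_swr //.
    apply: eq_sw => p z.
    rewrite [RHS]tmap_swr //.
    apply: eq_sw => x y; rewrite tmap_pure //.
    by rewrite cotr_sw sw_pure ?sw_purer.
  transitivity (\sw_(p, z <- vQ q) \sw_(p', h <- rho B12 p) \sw_(x, y <- v12 p') x ⊗ (y ⊗ h ⊗ z)).
    apply: eq_sw => p z.
    by rewrite (sw_rhoP (prod_rho p12) _ (F := fun x y h => x ⊗ (y ⊗ h ⊗ z))).
  rewrite (sw_cot cQ _ (F := fun p h z => \sw_(x, y <- v12 p) x ⊗ (y ⊗ h ⊗ z))) //.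
  by apply: eq_sw => p z; rewrite sw_exch.
have [r rE] : exists r, vR r = w.
  apply: (cot_ex cR); apply: (tmap_injr (cot_inj c23)).
  transitivity (\sw_(x, y <- assocQ q) \sw_(c, h <- rho B1 x) c ⊗ h ⊗ y).
    rewrite -wE cotl_sw !(tmap_sw _ _ w) !sw_sw //.
    rewrite tmap_swr //.
    apply: eq_sw => x p; rewrite sw_pure //.
    rewrite tmap_swr //.
    by apply: eq_sw => c h; rewrite tmap_pure.
  transitivity (\sw_(p, z <- vQ q) \sw_(x, y <- v12 p) \sw_(h, c <- lam B2 y) x ⊗ h ⊗ (c ⊗ z)).
    rewrite assocQ_sw sw_sw //.
    apply: eq_sw => p z; rewrite sw_sw //.
    rewrite -(sw_cot c12 _ (F := fun x h c => x ⊗ h ⊗ (c ⊗ z))) //.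
    by apply: eq_sw => x y; rewrite sw_pure.
  transitivity (\sw_(x, p <- w) \sw_(y, z <- v23 p) \sw_(h, c <- lam B2 y) x ⊗ h ⊗ (c ⊗ z)).
    pose G x (u : T2 ⊗ T3) := \sw_(y, z <- u) \sw_(h, c <- lam B2 y) x ⊗ h ⊗ (c ⊗ z) : T1 ⊗ H ⊗ (T2 ⊗ T3).
    transitivity (\sw_(x, u <- assocQ q) G x u).
      by rewrite assocQ_sw /G; sw.
    by rewrite -wE /G tmap_sw sw_sw; [apply: eq_sw => x p; rewrite sw_pure //; lin | lin].
  rewrite cotr_sw tmap_swr //.
  apply: eq_sw => x p.
  rewrite tmap_swr //.
  transitivity (\sw_(h, p' <- lam B23 p) \sw_(y, z <- v23 p') x ⊗ h ⊗ (y ⊗ z)).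
    by rewrite (sw_lamP (prod_lam p23) _ (F := fun h y z => x ⊗ h ⊗ (y ⊗ z))).
  by apply: eq_sw => h p'; rewrite tmap_pure // v_expandr.
by exists r; rewrite -wE -rE.
Qed.

Lemma assocRQ r : exists q, assocQ q = assocR r.
Proof.
have tI := can_inj (@tassocK k T1 T2 T3).
pose a0 := @tassocI k T1 T2 T3 (assocR r).
have a0E : tassoc a0 = assocR r by exact: (@tassocIK k T1 T2 T3).
have a0_sw : a0 = \sw_(x, p <- vR r) \sw_(y, z <- v23 p) x ⊗ y ⊗ z.
  by rewrite /a0 assocR_sw; sw.
have [w wE] : exists w : P12 ⊗ T3, (v12 ⊠ idfun) w = a0.
  apply: (tens_equalizerl (f := cotl T2 B1) (g := cotr T1 B2)); first exact: (cot_ex c12).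
  rewrite a0_sw.
  transitivity (\sw_(x, p <- vR r) \sw_(y, z <- v23 p) \sw_(c, h <- rho B1 x) (c ⊗ h ⊗ y) ⊗ z).
    rewrite tmap_swr //.
    apply: eq_sw => p z.
    rewrite tmap_swr //.
    apply: eq_sw => x y; rewrite tmap_pure //.
    by rewrite cotl_sw sw_pure ?sw_purel.
  transitivity (\sw_(x, p <- vR r) \sw_(y, z <- v23 p) \sw_(h, c <- lam B2 y) (x ⊗ h ⊗ c) ⊗ z); last first.
    rewrite [RHS]tmap_swr //.
    apply: eq_sw => p z.
    rewrite [RHS]tmap_swr //.
    apply: eq_sw => x y; rewrite tmap_pure //.
    by rewrite cotr_sw sw_pure ?sw_purel.
  transitivity (\sw_(x, p <- vR r) \sw_(h, p' <- lam B23 p) \sw_(y, z <- v23 p') (x ⊗ h ⊗ y) ⊗ z); last first.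
    apply: eq_sw => x p.
    by rewrite (sw_lamP (prod_lam p23) _ (F := fun h y z => (x ⊗ h ⊗ y) ⊗ z)).
  rewrite -(sw_cot cR _ (F := fun x h p => \sw_(y, z <- v23 p) (x ⊗ h ⊗ y) ⊗ z)) //.
  by apply: eq_sw => p z; rewrite sw_exch.
have [q qE] : exists q, vQ q = w.
  apply: (cot_ex cQ); apply: (tmap_injl (tmap_injl (cot_inj c12))).
  transitivity (\sw_(u, z <- a0) \sw_(x, y <- u) \sw_(c, h <- rho B2 y) (x ⊗ c) ⊗ h ⊗ z).
    transitivity (\sw_(p, z <- w) \sw_(p', h <- rho B12 p) v12 p' ⊗ h ⊗ z).
      rewrite cotl_sw (lin1_sw _ _ (f := (v12 ⊠ idfun) ⊠ idfun)) //.
      apply: eq_sw => p z.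
      rewrite (lin1_sw _ _ (f := (v12 ⊠ idfun) ⊠ idfun)) //.
      by apply: eq_sw => p' h; rewrite !tmap_pure.
    rewrite -wE tmap_sw sw_sw //.
    apply: eq_sw => p z; rewrite sw_pure //.
    rewrite -(sw_rhoP (prod_rho p12) _ (F := fun x y h => (x ⊗ y) ⊗ h ⊗ z)) //.
    by apply: eq_sw => p' h; rewrite v_expandl sw_purel.
  transitivity (\sw_(x, p <- vR r) \sw_(y, z <- v23 p) \sw_(h, c <- lam B3 z) (x ⊗ y) ⊗ h ⊗ c).
    rewrite a0_sw sw_sw //.
    apply: eq_sw => x p; rewrite sw_sw //.
    rewrite -(sw_cot c23 _ (F := fun y h c => (x ⊗ y) ⊗ h ⊗ c)) //.
    by apply: eq_sw => y z; rewrite !sw_pure.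
  transitivity (\sw_(u, z <- a0) \sw_(h, c <- lam B3 z) u ⊗ h ⊗ c).
    by rewrite a0_sw; sw.
  rewrite -wE tmap_sw sw_sw //.
  rewrite cotr_sw (lin1_sw _ _ (f := (v12 ⊠ idfun) ⊠ idfun)) //.
  apply: eq_sw => p z; rewrite sw_pure //.
  rewrite (lin1_sw _ _ (f := (v12 ⊠ idfun) ⊠ idfun)) //.
  by apply: eq_sw => h c; rewrite !tmap_pure.
by exists q; rewrite -a0E -wE -qE.
Qed.

Lemma product_assoc : exists2 f : {lrmorphism Q -> R}, bijective f & colinear BQ BR f.
Proof.
have [f fb fE] := lrmorphism_iso assocQ_inj assocR_inj assocQR assocRQ.
exists f => //.
(* In the triple tensor product the coactions of [Q] and of [R] are both [lam B1] and [rho B3];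
   colinearity of [f] follows because [assocR] after [f] is [assocQ]. *)
have Ql (U : lmodType k) (F : H -> T1 -> T2 -> T3 -> U) q : lin4 F ->
    \sw_(h, q' <- lam BQ q) \sw_(x, u <- assocQ q') \sw_(y, z <- u) F h x y z =
    \sw_(x, u <- assocQ q) \sw_(y, z <- u) \sw_(h, c <- lam B1 x) F h c y z.
  move=> F4.
  transitivity (\sw_(h, q' <- lam BQ q) \sw_(p, z <- vQ q') \sw_(x, y <- v12 p) F h x y z).
    by apply: eq_sw => h q'; rewrite assocQ_sw; sw.
  rewrite (sw_lamP (prod_lam pQ) _ (F := fun h p z => \sw_(x, y <- v12 p) F h x y z)) //.
  transitivity (\sw_(p, z <- vQ q) \sw_(x, y <- v12 p) \sw_(h, c <- lam B1 x) F h c y z).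
    apply: eq_sw => p z.
    by rewrite (sw_lamP (prod_lam p12) _ (F := fun h x y => F h x y z)).
  by rewrite assocQ_sw; sw.
have Qr (U : lmodType k) (F : T1 -> T2 -> T3 -> H -> U) q : lin4 F ->
    \sw_(q', h <- rho BQ q) \sw_(x, u <- assocQ q') \sw_(y, z <- u) F x y z h =
    \sw_(x, u <- assocQ q) \sw_(y, z <- u) \sw_(c, h <- rho B3 z) F x y c h.
  move=> F4.
  transitivity (\sw_(q', h <- rho BQ q) \sw_(p, z <- vQ q') \sw_(x, y <- v12 p) F x y z h).
    by apply: eq_sw => h q'; rewrite assocQ_sw; sw.
  rewrite (sw_rhoP (prod_rho pQ) _ (F := fun p z h => \sw_(x, y <- v12 p) F x y z h)) //.
  rewrite assocQ_sw sw_sw //.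
  apply: eq_sw => p z; rewrite sw_exch sw_sw //.
  by apply: eq_sw => x y; rewrite !sw_pure.
have Rl (U : lmodType k) (F : H -> T1 -> T2 -> T3 -> U) r : lin4 F ->
    \sw_(h, r' <- lam BR r) \sw_(x, u <- assocR r') \sw_(y, z <- u) F h x y z =
    \sw_(x, u <- assocR r) \sw_(y, z <- u) \sw_(h, c <- lam B1 x) F h c y z.
  move=> F4.
  transitivity (\sw_(h, r' <- lam BR r) \sw_(x, p <- vR r') \sw_(y, z <- v23 p) F h x y z).
    by apply: eq_sw => h q'; rewrite assocR_sw; sw.
  rewrite (sw_lamP (prod_lam pR) _ (F := fun h x p => \sw_(y, z <- v23 p) F h x y z)) //.
  rewrite assocR_sw sw_sw //.
  apply: eq_sw => p z; rewrite sw_exch sw_sw //.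
  by apply: eq_sw => x y; rewrite !sw_pure.
have Rr (U : lmodType k) (F : T1 -> T2 -> T3 -> H -> U) r : lin4 F ->
    \sw_(r', h <- rho BR r) \sw_(x, u <- assocR r') \sw_(y, z <- u) F x y z h =
    \sw_(x, u <- assocR r) \sw_(y, z <- u) \sw_(c, h <- rho B3 z) F x y c h.
  move=> F4.
  transitivity (\sw_(r', h <- rho BR r) \sw_(x, p <- vR r') \sw_(y, z <- v23 p) F x y z h).
    by apply: eq_sw => h q'; rewrite assocR_sw; sw.
  rewrite (sw_rhoP (prod_rho pR) _ (F := fun x p h => \sw_(y, z <- v23 p) F x y z h)) //.
  transitivity (\sw_(x, p <- vR r) \sw_(y, z <- v23 p) \sw_(c, h <- rho B3 z) F x y c h).
    apply: eq_sw => x p.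
    by rewrite (sw_rhoP (prod_rho p23) _ (F := fun y z h => F x y z h)).
  by rewrite assocR_sw; sw.
have ex3r (U : lmodType k) (h : U) (a : T1 ⊗ (T2 ⊗ T3)) :
    h ⊗ a = \sw_(x, u <- a) \sw_(y, z <- u) h ⊗ (x ⊗ (y ⊗ z)).
  rewrite -{1}(sw_id a) sw_purer; apply: eq_sw => x u.
  by rewrite -{1}(sw_id u) !sw_purer.
have ex3l (U : lmodType k) (h : U) (a : T1 ⊗ (T2 ⊗ T3)) :
    a ⊗ h = \sw_(x, u <- a) \sw_(y, z <- u) (x ⊗ (y ⊗ z)) ⊗ h.
  rewrite -{1}(sw_id a) sw_purel; apply: eq_sw => x u.
  by rewrite -{1}(sw_id u) sw_purer sw_purel.
split=> q.
  apply: (tmap_injr assocR_inj).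
  transitivity (\sw_(h, r' <- lam BR (f q)) \sw_(x, u <- assocR r') \sw_(y, z <- u) h ⊗ (x ⊗ (y ⊗ z))).
    by rewrite tmap_sw; apply: eq_sw => h r'; exact: ex3r.
  rewrite (Rl _ (fun h x y z => h ⊗ (x ⊗ (y ⊗ z)))) //.
  rewrite fE -(Ql _ (fun h x y z => h ⊗ (x ⊗ (y ⊗ z)))) //.
  rewrite !tmap_sw sw_sw //.
  apply: eq_sw => h q'; rewrite sw_pure //.
  transitivity (h ⊗ assocQ q'); first exact/esym/ex3r.
  by congr (_ ⊗ _); exact/esym/fE.
apply: (tmap_injl assocR_inj).
transitivity (\sw_(r', h <- rho BR (f q)) \sw_(x, u <- assocR r') \sw_(y, z <- u) (x ⊗ (y ⊗ z)) ⊗ h).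
  by rewrite tmap_sw; apply: eq_sw => r' h; exact: ex3l.
rewrite (Rr _ (fun x y z h => (x ⊗ (y ⊗ z)) ⊗ h)) //.
rewrite fE -(Qr _ (fun x y z h => (x ⊗ (y ⊗ z)) ⊗ h)) //.
rewrite !tmap_sw sw_sw //.
apply: eq_sw => q' h; rewrite sw_pure //.
transitivity (assocQ q' ⊗ h); first exact/esym/ex3l.
by congr (_ ⊗ _); exact/esym/fE.
Qed.

End Associativity.
End ProductIso.

(** * Classes of septuples *)

Section Structures.
Variables (k : fieldType) (H : algType k) (hH : hopf H).
Hypothesis S2_bij : bijective (antipode hH \o antipode hH).
Local Notation D := (comul hH).
Local Notation e := (counit hH).
Local Notation S := (antipode hH).

Lemma S_inj : injective S. Proof. exact: (bij_inj (antipode_bij S2_bij)). Qed.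

Section Product.
Variables (T1 T2 : algType k) (s1 : septuple hH T1) (s2 : septuple hH T2).
Local Notation v := (cot_val s1 s2).

(** The witness [w] is unique, since the inclusion of [Hr] remains injective after tensoring. *)
Lemma prod_mu_graph_functional x y y' :
  prod_mu_graph s1 s2 x y -> prod_mu_graph s1 s2 x y' -> y = y'.
Proof.
move=> [w wE ->] [w' wE' ->]; congr (tmap _ _ (tassoc (tmap _ _ (apply_Phi _ _)))).
pose i := tmap_injr (U := T1) (@Hr_val_inj _ _ _ _ s1).
apply: (tmap_injl (tmap_injl (tmap_injl i))).
by rewrite wE wE'.
Qed.

Lemma prod_il_graph_functional x y y' :
  prod_il_graph (T1 := T1) s2 x y -> prod_il_graph s2 x y' -> y = y'.
Proof.
move=> [w wE ->] [w' wE' ->]; congr (tmap _ _ _).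
apply: (tmap_injl (tmap_injr (@Hl_val_inj _ _ _ _ s2))).
by rewrite wE wE'.
Qed.

Lemma prod_ir_graph_functional x y y' :
  prod_ir_graph (T2 := T2) s1 x y -> prod_ir_graph s1 x y' -> y = y'.
Proof.
move=> [w wE ->] [w' wE' ->]; congr (tmap _ _ _).
apply: (tmap_injl (tmap_injr (@Hr_val_inj _ _ _ _ s1))).
by rewrite wE wE'.
Qed.

Lemma is_product_unique (s s' : septuple hH (cotensor s1 s2)) :
  is_product s -> is_product s' -> tor_equiv (TorHat s) (TorHat s').
Proof.
have vi : injective v by exact: val_inj.
move=> [th m l r] [th' m' l' r']; apply: same_structure_equiv => [x|x|x y xy|x y xy].
- apply: (tmap_inj (tmap_inj vi vi) vi).
  exact: (prod_mu_graph_functional (m x) (m' x)).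
- by apply: vi; rewrite th th'.
- have [z zG ->] := l x; have [z' zG' ->] := l' y; congr (il s1 _).
  apply: (@Hl_val_inj _ _ _ _ s1).
  by rewrite xy in zG'; exact: (prod_il_graph_functional zG zG').
- have [z zG ->] := r x; have [z' zG' ->] := r' y; congr (ir s2 _).
  apply: (@Hr_val_inj _ _ _ _ s2).
  by rewrite xy in zG'; exact: (prod_ir_graph_functional zG zG').
Qed.

(** The representing bi-Galois algebra is returned along with the septuple, so that products can
    later be compared by colinear maps. *)
Lemma is_product_exists B1 B2 : represents s1 B1 -> represents s2 B2 ->
  exists s : septuple hH (cotensor s1 s2), is_product s /\
    exists2 B, represents s B & is_product_bigal B1 B2 v B.
Proof.
move=> r1 r2; have vP := cot_val_is_cotensor r1 r2.
have [B BP] := product_bigal vP.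
have [th thP thE] := product_theta vP (rep_theta r1) (rep_theta r2) S_inj BP.
have [s rs sth] := build_septuple thP.
exists s; split; last by exists B.
split=> [x|x|x|x].
- by rewrite sth thE.
- exact: (product_mu_graph r1 r2 rs BP).
- exact: (product_il_graph r1 r2 rs BP).
- exact: (product_ir_graph r1 r2 rs BP).
Qed.

End Product.

Lemma is_trivial_unique (s s' : septuple hH H) :
  is_trivial s -> is_trivial s' -> tor_equiv (TorHat s) (TorHat s').
Proof.
move=> [m th l r] [m' th' l' r']; apply: same_structure_equiv => [x|x|x y xy|x y xy].
- exact: (etrans (m x) (esym (m' x))).
- by rewrite th th'.
- by rewrite l l' xy.
- by rewrite r r' xy.
Qed.

(** [S2_bij] provides the bijectivity of theta on the trivial torsor. *)
Lemma is_trivial_exists : exists2 s : septuple hH H, is_trivial s & represents s (triv hH).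
Proof.
have [s rs sth] := build_septuple (triv_theta S2_bij).
exists s => //; split=> [x|x|x|x].
- refine (etrans (rep_mu rs x) _).
  transitivity (\sw_(h, y <- D x) del0 hH h ⊗ y); first by [].
  by rewrite /del0; sw.
- exact: sth.
- transitivity (tcontrr e (del0 hH (il s x))); last by congr (tcontrr _ _); exact/esym/(rep_del rs).
  rewrite /tcontrr (sw_del0 hH _ (F := tcontrr_fun e)); last by rewrite /tcontrr_fun; lin.
  rewrite -[LHS](sw_counitr hH _ (@lin1_id k H)); apply: eq_sw => a b.
  by rewrite /tcontrr_fun counit_antipode.
- transitivity (tcontrl e (gam0 hH (ir s x))); last by congr (tcontrl _ _); exact/esym/(rep_gam rs).
  rewrite /tcontrl (sw_gam0 hH _ (F := tcontrl_fun e)); last by rewrite /tcontrl_fun; lin.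
  rewrite -[LHS](sw_counitl hH _ (@lin1_id k H)); apply: eq_sw => a b.
  by rewrite /tcontrl_fun counit_antipode.
Qed.

Section Opposite.
Variables (T : algType k) (s : septuple hH T).
Local Notation th := (theta (tor s)).

Lemma is_opposite_unique (s1 s2 : septuple hH T^c) :
  is_opposite s s1 -> is_opposite s s2 -> tor_equiv (TorHat s1) (TorHat s2).
Proof.
have thi := bij_inj (theta_bij (tor s)).
move=> [m t l r] [m' t' l' r']; apply: same_structure_equiv => [x|x|x y xy|x y xy].
- exact: (etrans (m x) (esym (m' x))).
- exact: (etrans (t x) (esym (t' x))).
- have [z zE ->] := l x; have [z' zE' ->] := l' y; congr (ir s _).
  apply: (@Hr_val_inj _ _ _ _ s); apply: (tmap_injr (U := T) thi).
  by refine (etrans (esym zE) (etrans (esym xy) zE')).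
- have [z zE ->] := r x; have [z' zE' ->] := r' y; congr (il s _).
  apply: (@Hl_val_inj _ _ _ _ s); apply: (tmap_injl (U := T) thi).
  by refine (etrans (esym zE) (etrans (esym xy) zE')).
Qed.

Lemma is_opposite_exists (Si : {linear H -> H}) (SK : cancel S Si) (SiK : cancel Si S) B :
  represents s B -> exists2 s' : septuple hH T^c, is_opposite s s' & represents s' (opp SK SiK B).
Proof.
move=> rs; have thP := rep_theta rs.
have [s' rs' sth] := build_septuple (opp_theta SK SiK thP).
exists s' => //; split=> [x|x|x|x].
- refine (etrans (rep_mu rs' x) _).
  transitivity (\sw_(h, y <- lamOT Si B x) (delO B h : T ⊗ T) ⊗ y); first by [].
  rewrite (sw_lamO Si B x (F := fun h y => (delO B h : T ⊗ T) ⊗ y)) //.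
  transitivity (tswap13 (\sw_(h, y <- lam B x) del B h ⊗ y)); last first.
    by congr (tswap13 _); exact/esym/(rep_mu rs).
  transitivity (\sw_(h, y <- lam B x) \sw_(a, b <- del B h) y ⊗ b ⊗ a); last by sw.
  rewrite (sw_del_gam B _ (F := fun a b y => y ⊗ b ⊗ a)) //.
  apply: eq_sw => y h; rewrite /delO SiK.
  by rewrite sw_purel.
- exact: sth.
- exists (inv_iso (iso_r_bij (ir_iso s)) (il s' x)); last by rewrite inv_isoK.
  refine (etrans (rep_del rs' x) _).
  transitivity ((idfun ⊠ th) (gam B (il s' x))); last first.
    by congr (tmap _ _ _); rewrite (rep_gam rs) inv_isoK.
  transitivity (\sw_(a, b <- gam B (S (il s' x))) b ⊗ a); first by [].
  by rewrite (sw_th_gam thP _ (F := fun a b => b ⊗ a)).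
- exists (inv_iso (iso_l_bij (il_iso s)) (ir s' x)); last by rewrite inv_isoK.
  refine (etrans (rep_gam rs' x) _).
  transitivity ((th ⊠ idfun) (del B (ir s' x))); last first.
    by congr (tmap _ _ _); rewrite (rep_del rs) inv_isoK.
  transitivity (\sw_(a, b <- del B (S (ir s' x))) b ⊗ a); first by [].
  by rewrite (sw_th_del thP _ (F := fun a b => b ⊗ a)).
Qed.

End Opposite.

Section Classes.
Implicit Types t : Tor_hat hH.

Lemma tor_class_eq t t' : tor_equiv t t' -> tor_class t = tor_class t'.
Proof.
move=> tt'; apply/predeqP => u; split; last exact: tor_equiv_trans.
exact/tor_equiv_trans/tor_equiv_sym.
Qed.

(** By uniqueness, arbitrary products may be replaced by those of [is_product_exists], for which a
    bi-Galois algebra is known; there [product_congr] applies. *)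
Lemma is_product_congr (T1 T2 T1' T2' : algType k)
    (s1 : septuple hH T1) (s2 : septuple hH T2) (s1' : septuple hH T1') (s2' : septuple hH T2')
    (s : septuple hH (cotensor s1 s2)) (s' : septuple hH (cotensor s1' s2')) :
  tor_equiv (TorHat s1) (TorHat s1') -> tor_equiv (TorHat s2) (TorHat s2') ->
  is_product s -> is_product s' -> tor_equiv (TorHat s) (TorHat s').
Proof.
have [B1 r1] := septuple_represented s1; have [B2 r2] := septuple_represented s2.
have [B1' r1'] := septuple_represented s1'; have [B2' r2'] := septuple_represented s2'.
move=> /(represents_equiv r1 r1')[f1 f1b f1c] /(represents_equiv r2 r2')[f2 f2b f2c] sP sP'.
have [u [uP [B rB BP]]] := is_product_exists r1 r2.
have [u' [uP' [B' rB' BP']]] := is_product_exists r1' r2'.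
apply: (tor_equiv_trans (is_product_unique sP uP)).
apply: tor_equiv_trans (is_product_unique uP' sP').
apply/(represents_equiv rB rB').
exact: (product_congr f1c f2c f1b f2b (cot_val_is_cotensor r1 r2) BP
  (cot_val_is_cotensor r1' r2') BP').
Qed.

(** By [is_product_congr], all products of members of the two classes are equivalent, so any one of
    them represents the set [tor_mul]; the group laws are then checked on chosen representatives. *)
Lemma tor_mul_class t1 t2 (s : septuple hH (cotensor (data t1) (data t2))) :
  is_product s -> tor_mul hH (tor_class t1) (tor_class t2) = tor_class (TorHat s).
Proof.
move=> sP; apply/predeqP => t; split=> [[t1' [t2' [s' [e1 e2 sP' e']]]]|st].
  apply: tor_equiv_trans e'; case: t1 t2 t1' t2' s s' sP sP' e1 e2 => [? ?] [? ?] [? ?] [? ?] /=.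
  by move=> s s' sP sP' e1 e2; apply: is_product_congr.
by exists t1, t2, s; split=> //; apply: tor_equiv_refl.
Qed.

Lemma tor_one_class (s : septuple hH H) : is_trivial s -> tor_one hH = tor_class (TorHat s).
Proof.
move=> sP; apply/predeqP => t; split=> [[s' sP' e']|st]; last by exists s.
exact: tor_equiv_trans (is_trivial_unique sP sP') e'.
Qed.

Lemma colinear_opp (Si : {linear H -> H}) (SK : cancel S Si) (SiK : cancel Si S)
    (T T' : algType k) (B : bigal hH T) (B' : bigal hH T') (f : {lrmorphism T -> T'}) :
  bijective f -> colinear B B' f ->
  exists2 g : {lrmorphism T^c -> T'^c}, bijective g & colinear (opp SK SiK B) (opp SK SiK B') g.
Proof.
move=> fb fc; pose g (x : T^c) : T'^c := f x.
have gl : linear g by exact: (linearP f).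
have gm : monoid_morphism g by split=> [|x y]; [exact: (rmorph1 f) | exact: (rmorphM f y x)].
pose glr : {lrmorphism T^c -> T'^c} := HB.pack_for {lrmorphism T^c -> T'^c} g
  (GRing.isLinear.Build k T^c T'^c _ g gl) (GRing.isMonoidMorphism.Build T^c T'^c g gm).
exists glr; first exact: fb.
split=> x.
  transitivity (\sw_(y, h <- rho B' (f x)) Si h ⊗ y); first by [].
  transitivity ((idfun ⊠ f) (lamOT Si B x)); last by [].
  rewrite fc.2 tmap_sw sw_sw //.
  rewrite tmap_sw (sw_lamO Si B x (F := fun h y => idfun h ⊗ f y)) //.
  by apply: eq_sw => y h; rewrite sw_pure.
transitivity (\sw_(h, y <- lam B' (f x)) y ⊗ Si h); first by [].
transitivity ((f ⊠ idfun) (rhoOT Si B x)); last by [].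
rewrite fc.1 tmap_sw sw_sw //.
rewrite tmap_sw (sw_rhoO Si B x (F := fun y h => f y ⊗ idfun h)) //.
by apply: eq_sw => y h; rewrite sw_pure.
Qed.

Lemma is_opposite_congr (T T' : algType k) (s : septuple hH T) (s' : septuple hH T')
    (u : septuple hH T^c) (u' : septuple hH T'^c) :
  tor_equiv (TorHat s) (TorHat s') -> is_opposite s u -> is_opposite s' u' ->
  tor_equiv (TorHat u) (TorHat u').
Proof.
have [Si [SK SiK]] := antipode_inv S2_bij.
have [B r] := septuple_represented s; have [B' r'] := septuple_represented s'.
move=> /(represents_equiv r r')[f fb fc] uP uP'.
have [w wP rw] := is_opposite_exists SK SiK r.
have [w' wP' rw'] := is_opposite_exists SK SiK r'.
apply: (tor_equiv_trans (is_opposite_unique uP wP)).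
apply: tor_equiv_trans (is_opposite_unique wP' uP').
apply/(represents_equiv rw rw').
exact: colinear_opp fb fc.
Qed.

Lemma tor_inv_class t (s : septuple hH (carrier t)^c) :
  is_opposite (data t) s -> tor_inv hH (tor_class t) = tor_class (TorHat s).
Proof.
move=> sP; apply/predeqP => u; split=> [[t' [s' [e1 sP' e']]]|st].
  apply: tor_equiv_trans e'; case: t t' s s' sP sP' e1 => [? ?] [? ?] /= s s' sP sP' e1.
  exact: is_opposite_congr e1 sP sP'.
by exists t, s; split=> //; apply: tor_equiv_refl.
Qed.

Lemma tor_mul_exists t1 t2 : exists s : septuple hH (cotensor (data t1) (data t2)), is_product s.
Proof.
have [B1 r1] := septuple_represented (data t1); have [B2 r2] := septuple_represented (data t2).
by have [s [sP _]] := is_product_exists r1 r2; exists s.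
Qed.

Lemma tor_mul_closed C1 C2 : Tor hH C1 -> Tor hH C2 -> Tor hH (tor_mul hH C1 C2).
Proof.
move=> [t1 ->] [t2 ->]; have [s sP] := tor_mul_exists t1 t2.
by exists (TorHat s); exact: tor_mul_class.
Qed.

Lemma tor_one_closed : Tor hH (tor_one hH).
Proof.
by have [s sP _] := is_trivial_exists; exists (TorHat s); exact: tor_one_class.
Qed.

Lemma tor_inv_closed C : Tor hH C -> Tor hH (tor_inv hH C).
Proof.
move=> [[T s] ->]; have [Si [SK SiK]] := antipode_inv S2_bij.
have [B r] := septuple_represented s.
have [w wP rw] := is_opposite_exists SK SiK r.
by exists (TorHat w); exact: (@tor_inv_class (TorHat s)).
Qed.

Lemma tor_mulA C1 C2 C3 : Tor hH C1 -> Tor hH C2 -> Tor hH C3 ->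
  tor_mul hH C1 (tor_mul hH C2 C3) = tor_mul hH (tor_mul hH C1 C2) C3.
Proof.
move=> [[T1 s1] ->] [[T2 s2] ->] [[T3 s3] ->].
have [B1 r1] := septuple_represented s1; have [B2 r2] := septuple_represented s2.
have [B3 r3] := septuple_represented s3.
have [s12 [P12 [B12 r12 p12]]] := is_product_exists r1 r2.
have [s23 [P23 [B23 r23 p23]]] := is_product_exists r2 r3.
have [sQ [PQ [BQ rQ pQ]]] := is_product_exists r12 r3.
have [sR [PR [BR rR pR]]] := is_product_exists r1 r23.
rewrite (@tor_mul_class (TorHat s2) (TorHat s3) s23 P23).
rewrite (@tor_mul_class (TorHat s1) (TorHat s2) s12 P12).
rewrite (@tor_mul_class (TorHat s1) (TorHat s23) sR PR).
rewrite (@tor_mul_class (TorHat s12) (TorHat s3) sQ PQ).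
apply/esym/tor_class_eq/(represents_equiv rQ rR).
exact: (product_assoc (cot_val_is_cotensor r1 r2) p12 (cot_val_is_cotensor r2 r3) p23
  (cot_val_is_cotensor r12 r3) pQ (cot_val_is_cotensor r1 r23) pR).
Qed.

Lemma tor_mul1l C : Tor hH C -> tor_mul hH (tor_one hH) C = C.
Proof.
move=> [[T s] ->]; have [B r] := septuple_represented s.
have [s0 s0P r0] := is_trivial_exists.
have [sQ [PQ [BQ rQ pQ]]] := is_product_exists r0 r.
rewrite (tor_one_class s0P) (@tor_mul_class (TorHat s0) (TorHat s) sQ PQ).
apply/esym/tor_class_eq/(represents_equiv r rQ).
exact: (product_unitl (cot_val_is_cotensor r0 r) pQ).
Qed.

Lemma tor_mulVl C : Tor hH C -> tor_mul hH (tor_inv hH C) C = tor_one hH.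
Proof.
move=> [[T s] ->]; have [B r] := septuple_represented s.
have [Si [SK SiK]] := antipode_inv S2_bij.
have [w wP rw] := is_opposite_exists SK SiK r.
have [s0 s0P r0] := is_trivial_exists.
have [sQ [PQ [BQ rQ pQ]]] := is_product_exists rw r.
rewrite (tor_one_class s0P) (@tor_inv_class (TorHat s) w wP).
rewrite (@tor_mul_class (TorHat w) (TorHat s) sQ PQ).
apply/esym/tor_class_eq/(represents_equiv r0 rQ).
exact: (product_invl (rep_theta r) (cot_val_is_cotensor rw r) pQ).
Qed.

End Classes.
End Structures.

(** With [x'] the left inverse of [x] and [x''] that of [x'], the product [x x'] equals
    [x'' x' x x'], which reduces to [x'' x'] and so to [e]. *)
Lemma group_on_left (X : Type) (G : X -> Prop) (op : X -> X -> X) (e : X) (inv : X -> X) :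
  (forall x y, G x -> G y -> G (op x y)) -> G e -> (forall x, G x -> G (inv x)) ->
  (forall x y z, G x -> G y -> G z -> op x (op y z) = op (op x y) z) ->
  (forall x, G x -> op e x = x) -> (forall x, G x -> op (inv x) x = e) ->
  group_on G op e inv.
Proof.
move=> Gop Ge Ginv opA op1 opV.
have opVr x : G x -> op x (inv x) = e.
  move=> Gx; have Gi := Ginv _ Gx; have Gii := Ginv _ Gi.
  rewrite -[op x _]op1; last exact: Gop.
  rewrite -{1}(opV _ Gi) -opA //; last exact: Gop.
  by rewrite [op (inv x) (op _ _)]opA // opV // op1 // opV.
split=> // x Gx.
by rewrite -(opV _ Gx) opA // ?opVr // ?op1 //; exact: Ginv.
Qed.

Theorem theorem3p3 (k : fieldType) (H : algType k) (hH : hopf H)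
    (S2_bij : bijective (antipode hH \o antipode hH)) :
  group_on (Tor hH) (tor_mul hH) (tor_one hH) (tor_inv hH).
Proof.
apply: group_on_left.
- exact: tor_mul_closed.
- exact: tor_one_closed.
- exact: tor_inv_closed.
- exact: tor_mulA.
- exact: tor_mul1l.
- exact: tor_mulVl.
Qed.
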